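(* In the white noise model, fix $0<\gamma<1$ and $s_{\min}\in(0,s_{\max}]$, and set $$r_n(s):=(n/\log n)^{-s/(2s+1)}\log n,\qquad \mathcal F:=\bigcup_{s\in[s_{\min},s_{\max}],\,M>0}C^s_0(M).$$ Then there exist confidence bands $C_n=\{g\in C([0,1]):\|g-\hat f_n\|_\infty\le R_n\}$, whose centre $\hat f_n$ and radius $R_n$ depend only on the data and on $\gamma,s_{\min},s_{\max},\varepsilon,\rho$ (and the fixed wavelet basis), such that: (i) $\sup_{f\in\mathcal F}\left|\mathbb P_f(f\notin C_n)-\gamma\right|\to0$ as $n\to\infty$; and (ii) for a fixed constant $L>0$ (not depending on $s$ or $M$), and any $s\in[s_{\min},s_{\max}]$, $M>0$, $$\sup_{f\in C^s_0(M)}\mathbb P_f\left(R_n>L\,M^{1/(2s+1)}\,r_n(s)\right)\to0\quad\text{as }n\to\infty.$$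
   Context: White noise model: for an unknown $f:[0,1]\to\mathbb R$ one observes the process $Y_t=\int_0^t f(u)\,du+n^{-1/2}B_t$, $t\in[0,1]$, with $B$ a standard Brownian motion; $\mathbb P_f$ is the law of the data. $\|\cdot\|_\infty$ is the supremum norm on $[0,1]$. Wavelet basis: $\varphi,\psi$ are the scaling function and wavelet of an orthonormal multiresolution analysis of $L^2(\mathbb R)$ such that, for some $K,N\in\mathbb N$: $\varphi,\psi$ are supported in $[1-K,K]$; $\int x^i\psi(x)\,dx=0$ for $i=0,\dots,N-1$; $\varphi$ is twice continuously differentiable. Moreover the 1-periodic function $\sigma_\varphi^2(t):=\sum_{k\in\mathbb Z}\varphi(t-k)^2$ attains its maximum at a unique point $t_0\in[0,1)$, and $(\sigma_\varphi^2)''(t_0)<0$. From these, the Cohen–Daubechies–Vial boundary-corrected construction gives an orthonormal basis of $L^2([0,1])$ consisting of $\varphi_{j_0,k}$, $0\le k<2^{j_0}$, and $\psi_{j,k}$, $j\ge j_0$, $0\le k<2^j$, for a suitable fixed coarsest level $j_0>0$. For $k\in[N,2^j-N)$ the functions are $\varphi_{j_0,k}(x)=2^{j_0/2}\varphi(2^{j_0}x-k)$ and $\psi_{j,k}(x)=2^{j/2}\psi(2^jx-k)$; for the other $k$ they are the boundary functions of that construction. For $f=\sum_k\alpha_k\varphi_{j_0,k}+\sum_{j\ge j_0}\sum_k\beta_{j,k}\psi_{j,k}\in L^2([0,1])$ and $s\in(0,N)$ put $\|f\|_{C^s}:=\max\big(\sup_k|\alpha_k|,\ \sup_{j,k}2^{j(s+1/2)}|\beta_{j,k}|\big)$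 and $C^s(M):=\{f\in L^2([0,1]):\|f\|_{C^s}\le M\}$. Such $f$ are continuous (after modification on a null set). Set $f_{i,j}:=\sum_{l=i}^j\sum_k\beta_{l,k}\psi_{l,k}$ for $i>j_0$, and $f_{j_0,j}:=\sum_k\alpha_k\varphi_{j_0,k}+\sum_{l=j_0}^j\sum_k\beta_{l,k}\psi_{l,k}$. Self-similar functions: fix $s_{\max}\in(0,N)$, $\varepsilon\in(0,1)$, $\rho\in\mathbb N$. For $s\in(0,s_{\max})$, $M>0$, $C^s_0(M)=C^s_0(M,\varepsilon,\rho)$ is the set of $f\in C^s(M)$ with $\|f_{j,\rho j}\|_{C^s}\ge\varepsilon M$ for all $j\ge j_0$. For $s=s_{\max}$, $C^{s_{\max}}_0(M)$ is the set of $f\in C^{s_{\max}}(M)$ for which this inequality holds for $j=j_0$ only. *)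

(* Defs.v *)
From HB Require Import structures.
From mathcomp Require Import all_boot all_order all_algebra.
From mathcomp Require Import all_classical all_reals all_analysis.

Set Implicit Arguments.
Unset Strict Implicit.
Unset Printing Implicit Defensive.

Import Order.TTheory GRing.Theory Num.Theory.
Import numFieldNormedType.Exports.

Local Open Scope classical_set_scope.
Local Open Scope ring_scope.

(* ** L^2 spaces over a set D of reals.  Elements are honest functions R -> R;
   all notions below depend only on their restriction to D, up to null sets. *)

Definition in_L2 (R : realType) (D : set R) (f : R -> R) : Prop :=
  measurable_fun D f /\
  (\int[@lebesgue_measure R]_(x in D) ((f x) ^+ 2)%:E < +oo)%E.

Definition ip (R : realType) (D : set R) (f g : R -> R) : R :=
  \int[@lebesgue_measure R]_(x in D) (f x * g x).

Definition orthonormal (R : realType) (D : set R) (J : eqType) (I : set J)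
    (e : J -> R -> R) : Prop :=
  (forall i, I i -> in_L2 D (e i)) /\
  (forall i j, I i -> I j -> ip D (e i) (e j) = (i == j)%:R).

Definition in_closed_span (R : realType) (D : set R) (J : eqType) (I : set J)
    (e : J -> R -> R) (f : R -> R) : Prop :=
  in_L2 D f /\
  forall delta : R, 0 < delta ->
    exists s : seq (R * J), (forall p, p \in s -> I p.2) /\
      (\int[@lebesgue_measure R]_(x in D)
         ((f x - \sum_(p <- s) p.1 * e p.2 x) ^+ 2)%:E < delta%:E)%E.

Definition orthonormal_basis (R : realType) (D : set R) (J : eqType)
    (I : set J) (e : J -> R -> R) : Prop :=
  orthonormal D I e /\ forall f, in_L2 D f -> in_closed_span D I e f.

(* ** Multiresolution analysis of L^2(R) *)

Definition translates (R : realType) (phi : R -> R) (k : int) : R -> R :=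
  fun x => phi (x - k%:~R).

(* V_j, the closed span of the functions phi(2^j x - k), k an integer *)
Definition mra_space (R : realType) (phi : R -> R) (j : int) :
    (R -> R) -> Prop :=
  in_closed_span setT setT (fun (k : int) x => translates phi k (2 ^ j * x)).

Definition is_scaling_function (R : realType) (phi : R -> R) : Prop :=
  [/\ orthonormal setT setT (translates phi),
      (forall (j : int) f, mra_space phi j f -> mra_space phi (j + 1) f),
      (forall f, in_L2 setT f -> forall delta : R, 0 < delta ->
         exists j g, mra_space phi j g /\
         (\int[@lebesgue_measure R]_x ((f x - g x) ^+ 2)%:E < delta%:E)%E) &
      (forall f, (forall j : int, mra_space phi j f) ->
         {ae @lebesgue_measure R, forall x, f x = 0})].

(* W_0, the orthogonal complement of V_0 in V_1 *)
Definition mra_detail (R : realType) (phi f : R -> R) : Prop :=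
  mra_space phi 1 f /\ forall k : int, ip setT f (translates phi k) = 0.

Definition is_wavelet (R : realType) (phi psi : R -> R) : Prop :=
  [/\ orthonormal setT setT (translates psi),
      (forall k : int, mra_detail phi (translates psi k)) &
      (forall f, mra_detail phi f ->
         in_closed_span setT setT (translates psi) f)].

Definition supported_in (R : realType) (a b : R) (f : R -> R) : Prop :=
  forall x, x \notin `[a, b] -> f x = 0.

Definition twice_continuously_differentiable (R : realType) (f : R -> R) :
    Prop :=
  [/\ forall x, derivable f x 1,
      forall x, derivable (derive1 f) x 1 &
      continuous (derive1n 2 f)].

Definition sigma2 (R : realType) (phi : R -> R) (t : R) : R :=
  fine (\esum_(k in [set: int]) ((phi (t - k%:~R)) ^+ 2)%:E).

Definition wavelet_assumption (R : realType) (K N : nat) (phi psi : R -> R) :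
    Prop :=
  [/\ is_scaling_function phi /\ is_wavelet phi psi,
      supported_in (1 - K%:R) K%:R phi /\ supported_in (1 - K%:R) K%:R psi,
      (forall i, (i < N)%N ->
         \int[@lebesgue_measure R]_x (x ^+ i * psi x) = 0),
      twice_continuously_differentiable phi &
      exists t0 : R, [/\ 0 <= t0 < 1,
        (forall t, 0 <= t < 1 -> t != t0 -> sigma2 phi t < sigma2 phi t0) &
        derive1n 2 (sigma2 phi) t0 < 0]].

(* ** The Cohen-Daubechies-Vial boundary functions.
   They are built on the half line [0, +oo[, for the left end point; the right
   end point is obtained by the reflection x -> 1 - x.  Index ranges are those
   of the original construction, with phi supported in [1 - K, K] and N edge
   functions replacing the translates phi(x - m), m < N, that meet the half
   line. *)

Definition half_line (R : realType) : set R := [set x : R | 0 <= x].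

(* \tilde phi^k (x) = sum_{n = k}^{N + K - 2} C(n, k) phi(x + n - N + 1),
   0 <= k < N; these reproduce polynomials of degree < N up to the edge. *)
Definition edge_generator (R : realType) (K N : nat) (phi : R -> R) (k : nat)
    (x : R) : R :=
  \sum_(k <= n < (N + K).-1) 'C(n, k)%:R * phi (x + n%:R - N%:R + 1).

(* Gram-Schmidt orthonormalisation of \tilde phi^{N-1}, ..., \tilde phi^0, in
   this order (the signs, which are immaterial, are left free). *)
Definition is_edge_scaling (R : realType) (K N : nat) (phi : R -> R)
    (e : nat -> R -> R) : Prop :=
  orthonormal (@half_line R) `I_N e /\
  forall k, (k < N)%N -> exists c : nat -> R, forall x, 0 <= x ->
    e k x = \sum_(i < k.+1) c i * edge_generator K N phi (N.-1 - i) x.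

(* \tilde psi^k = sqrt 2 e_k(2 x) minus its projection on the e_m, m < N *)
Definition edge_detail (R : realType) (N : nat) (e : nat -> R -> R) (k : nat)
    (x : R) : R :=
  let u := fun y => Num.sqrt 2 * e k (2 * y) in
  u x - \sum_(m < N) ip (@half_line R) u (e m) * e m x.

(* An orthonormal basis of the span of the \tilde psi^k, with the staggered
   supports [0, K + k]. *)
Definition is_edge_wavelet (R : realType) (K N : nat) (e d : nat -> R -> R) :
    Prop :=
  orthonormal (@half_line R) `I_N d /\
  forall k, (k < N)%N ->
    (exists c : nat -> R, forall x, 0 <= x ->
       d k x = \sum_(i < N) c i * edge_detail N e i x) /\
    (forall x, K%:R + k%:R < x -> d k x = 0).

Record wavelet_system (R : realType) := WaveletSystem {
  supp_bound : nat;
  moments : nat;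
  coarsest : nat;
  father : R -> R;
  mother : R -> R;
  father_left : nat -> R -> R;
  father_right : nat -> R -> R;
  mother_left : nat -> R -> R;
  mother_right : nat -> R -> R }.

Definition boundary_corrected (R : realType) (N : nat) (g : R -> R)
    (l r : nat -> R -> R) (j k : nat) (x : R) : R :=
  let p : R := (2 ^ j)%N%:R in
  2 `^ (j%:R / 2) *
  (if (k < N)%N then l k (p * x)
   else if (k < 2 ^ j - N)%N then g (p * x - k%:R)
   else r (2 ^ j - k.+1)%N (p * (1 - x))).

Definition phi_ (R : realType) (W : wavelet_system R) (k : nat) : R -> R :=
  boundary_corrected (moments W) (father W) (father_left W) (father_right W)
    (coarsest W) k.

Definition psi_ (R : realType) (W : wavelet_system R) (j k : nat) : R -> R :=
  boundary_corrected (moments W) (mother W) (mother_left W) (mother_right W)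
    j k.

(* (None, k) indexes phi_{j0,k} and (Some j, k) indexes psi_{j,k}. *)
Definition basis_index (R : realType) (W : wavelet_system R) :
    set (option nat * nat) :=
  [set i | match i.1 with
           | None => (i.2 < 2 ^ coarsest W)%N
           | Some j => (coarsest W <= j)%N /\ (i.2 < 2 ^ j)%N
           end].

Definition basis_function (R : realType) (W : wavelet_system R)
    (i : option nat * nat) : R -> R :=
  match i.1 with None => phi_ W i.2 | Some j => psi_ W j i.2 end.

(* The last two clauses say that the coarsest level is a suitable one. *)
Definition cdv_wavelet_basis (R : realType) (W : wavelet_system R) : Prop :=
  let K := supp_bound W in
  let N := moments W in
  let mirror (g : R -> R) := fun x => g (1 - x) in
  [/\ wavelet_assumption K N (father W) (mother W),
      is_edge_scaling K N (father W) (father_left W) /\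
      is_edge_wavelet K N (father_left W) (mother_left W),
      is_edge_scaling K N (mirror (father W)) (father_right W) /\
      is_edge_wavelet K N (father_right W) (mother_right W),
      (0 < coarsest W)%N /\ (2 * N <= 2 ^ coarsest W)%N &
      orthonormal_basis `[0, 1] (basis_index W) (basis_function W)].

(* ** Hoelder-type classes and self-similar functions *)

Definition alpha (R : realType) (W : wavelet_system R) (f : R -> R)
    (k : nat) : R :=
  ip `[0, 1] f (phi_ W k).

Definition beta (R : realType) (W : wavelet_system R) (f : R -> R)
    (j k : nat) : R :=
  ip `[0, 1] f (psi_ W j k).

Definition Cs_norm (R : realType) (W : wavelet_system R) (s : R)
    (f : R -> R) : \bar R :=
  maxe
    (ereal_sup [set `|alpha W f k|%:E | k in `I_(2 ^ coarsest W)])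
    (ereal_sup [set (2 `^ (jk.1%:R * (s + 2^-1)) * `|beta W f jk.1 jk.2|)%:E |
       jk in [set jk : nat * nat |
         (coarsest W <= jk.1)%N /\ (jk.2 < 2 ^ jk.1)%N]]).

Definition Cs_ball (R : realType) (W : wavelet_system R) (s M : R) :
    set (R -> R) :=
  [set f | in_L2 `[0, 1] f /\ (Cs_norm W s f <= M%:E)%E].

Definition wavelet_block (R : realType) (W : wavelet_system R) (f : R -> R)
    (i j : nat) (x : R) : R :=
  (if i == coarsest W
   then \sum_(k < 2 ^ coarsest W) alpha W f k * phi_ W k x else 0) +
  \sum_(i <= l < j.+1) \sum_(k < 2 ^ l) beta W f l k * psi_ W l k x.

Definition self_similar (R : realType) (W : wavelet_system R)
    (smax eps : R) (rho : nat) (s M : R) : set (R -> R) :=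
  [set f | Cs_ball W s M f /\
     forall j, (if s == smax then j == coarsest W else (coarsest W <= j)%N) ->
       ((eps * M)%:E <= Cs_norm W s (wavelet_block W f j (rho * j)))%E].

Definition self_similar_union (R : realType) (W : wavelet_system R)
    (smin smax eps : R) (rho : nat) : set (R -> R) :=
  [set f | exists s M : R, [/\ smin <= s <= smax, 0 < M &
     self_similar W smax eps rho s M f]].

(* ** The white noise model *)

(* Only the values B t, t in [0, 1], matter. *)
Definition standard_brownian_motion (R : realType) (d : measure_display)
    (T : measurableType d) (P : probability T R) (B : R -> {RV P >-> R}) :
    Prop :=
  [/\ {ae P, forall w, B 0 w = 0},
      {ae P, forall w, {within `[0, 1], continuous (fun t => B t w)}},
      (forall s t : R, 0 <= s -> s < t -> t <= 1 ->
         forall A : set R, measurable A ->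
         P [set w | A (B t w - B s w)] =
         normal_prob 0 (Num.sqrt (t - s)) A) &
      (forall (m : nat) (t : nat -> R) (A : nat -> set R),
         0 <= t 0%N -> t m <= 1 -> (forall i, (i < m)%N -> t i <= t i.+1) ->
         (forall i, measurable (A i)) ->
         P [set w | forall i, (i < m)%N -> A i (B (t i.+1) w - B (t i) w)] =
         (\prod_(i < m) P [set w | A i (B (t i.+1) w - B (t i) w)%R])%E)].

(* Paths of the observed process, with the sigma-algebra generated by the
   evaluations at the times in [0, 1]. *)
Definition path_cylinders (R : realType) : set (set (R -> R)) :=
  [set C | exists t : R, t \in `[0, 1] /\
     exists A : set R, measurable A /\ C = [set y | A (y t)]].

Definition path_space (R : realType) :=
  g_sigma_algebraType (@path_cylinders R).

Definition observation (R : realType) (d : measure_display)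
    (T : measurableType d) (P : probability T R) (B : R -> {RV P >-> R})
    (n : nat) (f : R -> R) (w : T) : path_space R :=
  fun t => \int[@lebesgue_measure R]_(u in `[0, t]) f u +
           (Num.sqrt n%:R)^-1 * B t w.

(* P_f, a set function on the path space *)
Definition data_law (R : realType) (d : measure_display)
    (T : measurableType d) (P : probability T R) (B : R -> {RV P >-> R})
    (n : nat) (f : R -> R) : set (path_space R) -> \bar R :=
  pushforward P (observation B n f).

(* ** Confidence bands *)

Definition sup_norm (R : realType) (g : R -> R) : \bar R :=
  ereal_sup [set `|g x|%:E | x in `[0, 1]].

Definition C01 (R : realType) : set (R -> R) :=
  [set g : R -> R | {within `[0, 1], continuous g}].

Definition band (R : realType) (centre : R -> R) (radius : R) :
    set (R -> R) :=
  [set g | C01 g /\ (sup_norm (g \- centre)%R <= radius%:E)%E].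

(* f belongs to C if C contains the continuous modification of f on [0, 1]. *)
Definition in_band (R : realType) (f : R -> R) (C : set (R -> R)) : Prop :=
  exists g : R -> R, [/\ C01 g,
    {ae @lebesgue_measure R, forall x, x \in `[0, 1] -> g x = f x} & C g].

(* Centre and radius are measurable functions of the observed path. *)
Definition is_band_procedure (R : realType)
    (fhat : nat -> path_space R -> R -> R) (rad : nat -> path_space R -> R) :
    Prop :=
  forall n,
  [/\ (forall y, C01 (fhat n y)),
      (forall t : R, t \in `[0, 1] ->
         measurable_fun setT (fun y => fhat n y t)),
      (forall y, 0 <= rad n y) &
      measurable_fun setT (rad n)].

Definition rate (R : realType) (n : nat) (s : R) : R :=
  (n%:R / ln n%:R) `^ (- s / (2 * s + 1)) * ln n%:R.

(* sup_{f in F} |h n f| -> 0; since an empty supremum is -oo in \bar R, the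
   convergence is spelled out so that it also makes sense for F empty. *)
Definition sup_tends_to_0 (R : realType) (F : set (R -> R))
    (h : nat -> (R -> R) -> \bar R) : Prop :=
  forall delta : R, 0 < delta ->
    \forall n \near \oo,
      (ereal_sup [set `|h n f| | f in F] <= delta%:E)%E.

(* Main.v *)
(** The wavelet coefficients of f are estimated by the discretised stochastic
    integrals of the basis functions against the observed path, sampled on a
    dyadic grid finer than n^-10.  Outside an event of probability O(1/n), every
    dyadic increment of the Brownian path at scale 2^-l is at most
    11 (log n) 2^(-l/2), so all coefficients up to level 4 log2 n are estimated
    within delta = O(log n / sqrt n).

    Self-similarity makes s and M visible in the data: the coarse block of
    coefficients determines M up to constants and, unless s = s_max, a block at
    a level proportional to log n contains a coefficient of size about
    M 2^(-l(s+1/2)), which determines M 2^(-J(s+1/2)) / delta up to constants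
    for every J of order log n.  The least J for which this ratio is bounded,
    with s_max in place of s as a floor, balances bias and noise; a projection
    estimate at that level is then within
    R = O(2^(J/2) delta) of f in supremum norm, with probability tending to 1.
    The constant in R is paid for by the factor (log n)^(1 - s/(2s+1)) in the
    rate, which exceeds the power of log n that is needed, so L = 1 works.

    The band of radius R around the estimate has coverage tending to 1.  To make
    the error probability tend to gamma uniformly, the centre is moved by
    3 R + 1, which loses f, whenever the fractional part of n (Y_1 - Y_0) is
    less than gamma: this variable is Gaussian with variance n, so its
    fractional part is asymptotically uniform whatever f is. *)

Require Import Defs.
From HB Require Import structures.
From mathcomp Require Import all_boot all_order all_algebra.
From mathcomp Require Import all_classical all_reals all_analysis.
From mathcomp Require Import measurable_realfun.
From mathcomp Require Import ring lra zify.

Set Implicit Arguments.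
Unset Strict Implicit.
Unset Printing Implicit Defensive.

Import Order.TTheory GRing.Theory Num.Theory.
Import numFieldNormedType.Exports.

Local Open Scope classical_set_scope.
Local Open Scope ring_scope.

(** * Lebesgue integrals and almost everywhere statements *)

(** Three obstacles shape the details. Regularity of the mother wavelet is available only up to a
    null set, whereas the estimator samples basis functions at grid points; so [mother W] is
    replaced by an almost everywhere equal finite combination of the functions phi(2x - k), which is
    Lipschitz.

    M is unbounded over the class, and the discretisation error of the drift is proportional to M.
    When the estimate of M exceeds n, the band is centred at 0 with a radius that covers every
    function of that size; otherwise n bounds M and the drift error disappears in the noise level.

    Finally, s is never estimated. The size of a coefficient at level l and the desired inequality
    at level J are raised to the powers J and l, which eliminates s between them. Constants enter to
    the power J and leave through an l-th root; they stay bounded because J / l is bounded, which is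
    why the high block must start at a level proportional to log n.

    No stochastic integral is formed: one bound on the dyadic increments of a path controls all its
    estimated coefficients, so estimation errors are treated path by path. *)

Lemma integrable_addr (R : realType) (D : set R) (f g : R -> R) : measurable D ->
  lebesgue_measure.-integrable D (EFin \o f) ->
  lebesgue_measure.-integrable D (EFin \o g) ->
  lebesgue_measure.-integrable D (EFin \o (fun x => f x + g x)).
Proof.
move=> mD fi gi.
exact: (@integrableD _ _ _ lebesgue_measure D mD (EFin \o f) (EFin \o g)).
Qed.

Lemma integrable_scaler (R : realType) (D : set R) (k : R) (f : R -> R) :
  measurable D ->
  lebesgue_measure.-integrable D (EFin \o f) ->
  lebesgue_measure.-integrable D (EFin \o (fun x => k * f x)).
Proof.
move=> mD fi.
exact: (@integrableZl _ _ _ lebesgue_measure D mD k (EFin \o f)).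
Qed.

Lemma integrable_subr (R : realType) (D : set R) (f g : R -> R) : measurable D ->
  lebesgue_measure.-integrable D (EFin \o f) ->
  lebesgue_measure.-integrable D (EFin \o g) ->
  lebesgue_measure.-integrable D (EFin \o (fun x => f x - g x)).
Proof.
move=> mD fi gi.
have := integrable_addr mD fi (integrable_scaler (-1) mD gi).
by apply: eq_integrable => // x _ /=; rewrite mulN1r.
Qed.

Lemma integrable_bounded (R : realType) (D : set R) (k : R) (f : R -> R) :
  measurable D -> (lebesgue_measure D < +oo)%E -> measurable_fun D f ->
  (forall x, D x -> `|f x| <= k) ->
  lebesgue_measure.-integrable D (EFin \o f).
Proof.
move=> mD Dfin mf fk; apply: measurable_bounded_integrable => //.
exists k; split; [exact: num_real|move=> x xk y Dy].
by apply: le_trans (fk _ Dy) _; exact: ltW.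
Qed.

Lemma integrable_sumr (R : realType) (D : set R) (I : eqType) (s : seq I)
    (f : I -> R -> R) : measurable D ->
  (forall i, i \in s -> lebesgue_measure.-integrable D (EFin \o f i)) ->
  lebesgue_measure.-integrable D (EFin \o (fun x => \sum_(i <- s) f i x)).
Proof.
move=> mD; elim: s => [|a s IH] fi.
  under [X in EFin \o X]eq_fun do rewrite big_nil.
  exact: integrable0.
under [X in EFin \o X]eq_fun do rewrite big_cons.
apply: integrable_addr => //; first by apply: fi; rewrite mem_head.
by apply: IH => i si; apply: fi; rewrite in_cons si orbT.
Qed.

Lemma Rintegral_sum (R : realType) (D : set R) (I : eqType) (s : seq I)
    (f : I -> R -> R) : measurable D ->
  (forall i, i \in s -> lebesgue_measure.-integrable D (EFin \o f i)) ->
  \int[lebesgue_measure]_(x in D) (\sum_(i <- s) f i x) =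
  \sum_(i <- s) \int[lebesgue_measure]_(x in D) f i x.
Proof.
move=> mD; elim: s => [|a s IH] fi.
  rewrite big_nil; under eq_Rintegral do rewrite big_nil.
  by rewrite Rintegral_cst// mul0r.
rewrite big_cons -IH; last by move=> i si; apply: fi; rewrite in_cons si orbT.
under eq_Rintegral do rewrite big_cons.
rewrite RintegralD//; first by apply: fi; rewrite mem_head.
by apply: integrable_sumr => // i si; apply: fi; rewrite in_cons si orbT.
Qed.

Lemma le_normr_Rintegral_itv (R : realType) (a b : R) b0 b1 (k : R) (f : R -> R) :
  a <= b ->
  lebesgue_measure.-integrable [set` Interval (BSide b0 a) (BSide b1 b)] (EFin \o f) ->
  (forall x, x \in Interval (BSide b0 a) (BSide b1 b) -> `|f x| <= k) ->
  `|\int[lebesgue_measure]_(x in [set` Interval (BSide b0 a) (BSide b1 b)]) f x|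
    <= k * (b - a).
Proof.
move=> ab fi fk; apply: le_trans (le_normr_Rintegral _ fi) _ => //.
have E : lebesgue_measure [set` Interval (BSide b0 a) (BSide b1 b)] = (b - a)%:E.
  rewrite lebesgue_measure_itv/= lte_fin; case: ltP => [_|ba]; first by rewrite EFinB.
  have -> : b = a by apply/eqP; rewrite eq_le ba ab.
  by rewrite subrr.
apply: (@le_trans _ _ (\int[lebesgue_measure]_(x in [set` Interval (BSide b0 a) (BSide b1 b)]) (cst k x))).
  apply: le_Rintegral => //; first exact: integrable_norm fi.
  apply: (integrable_bounded (k := `|k|)) => //.
  by rewrite E ltry.
by rewrite Rintegral_cst//= E.
Qed.

Lemma EFin_Rintegral (R : realType) (D : set R) (f : R -> R) : measurable D ->
  lebesgue_measure.-integrable D (EFin \o f) ->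
  (\int[lebesgue_measure]_(x in D) (f x)%:E)%E =
  (\int[lebesgue_measure]_(x in D) f x)%:E.
Proof.
by move=> mD fi; rewrite /Rintegral fineK//; apply: integrable_fin_num fi.
Qed.

Lemma ae_lebesgueS (R : realType) (P Q : R -> Prop) :
  (forall x, P x -> Q x) -> {ae @lebesgue_measure R, forall x, P x} ->
  {ae @lebesgue_measure R, forall x, Q x}.
Proof.
by move=> PQ; apply: filterS => //; exact: (ae_filter_ringOfSetsType lebesgue_measure).
Qed.

(** The pushforward of Lebesgue measure under the affine map, multiplied by [p], gives every
    interval its length, so it is Lebesgue measure and preimages of null sets are null. This carries
    an almost everywhere identity for the mother wavelet to all its dilates and translates. *)
Lemma ae_lebesgue_affine (R : realType) (p b : R) (P : R -> Prop) : 0 < p ->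
  {ae @lebesgue_measure R, forall x, P x} ->
  {ae @lebesgue_measure R, forall x, P (p * x + b)}.
Proof.
move=> p0 [A [mA A0 PA]].
pose f (x : measurableTypeR R) : measurableTypeR R := p * x + b.
have mf : measurable_fun setT f.
  by apply: measurable_funD => //; apply: measurable_funM.
have mfA : measurable (f @^-1` A).
  by rewrite -[X in measurable X]setTI; exact: mf.
pose nu : {measure set (measurableTypeR R) -> \bar R} := mscale (NngNum (ltW p0)) (measure_function_pushforward__canonical__measure_function_Measure lebesgue_measure mf).
exists (f @^-1` A); split.
- exact: mfA.
- have : lebesgue_measure A = nu A.
    apply: lebesgue_measure_unique => // _ [[a c] /= _ <-].
    rewrite /nu /mscale /= /pushforward.
    rewrite (_ : f @^-1` _ = `](a - b) / p, (c - b) / p]%classic); last first.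
      apply/seteqP; split => x; rewrite /= !in_itv/= /f ltr_pdivrMr// ler_pdivlMr// (mulrC x) => /andP[? ?]; apply/andP; split; lra.
    rewrite !lebesgue_measure_itv/= !lte_fin ltr_pM2r ?invr_gt0// ltrD2r.
    case: ifPn => _; last by rewrite mule0.
    by rewrite -!EFinD -EFinM; congr (_%:E); field; rewrite gt_eqF.
  rewrite A0 /nu /mscale /= => /esym/eqP; rewrite mule_eq0 eqe gt_eqF//= => /eqP.
  by [].
- by move=> x /= /PA.
Qed.

(** * Gaussian tails and fractional parts *)

(** Exponential tilting by one standard deviation: the ratio of the densities with means 0 and [s]
    is exp(1/2 - z/s). The tail obtained this way is only exponential, which suffices at deviations
    of order log n. *)
Lemma normal_pdf_exp_shift (R : realType) (s x z : R) : 0 < s -> x * s < z ->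
  normal_pdf 0 s z <= expR (2^-1 - x) * normal_pdf s s z.
Proof.
move=> s0 xz; rewrite /normal_pdf gt_eqF//.
rewrite mulrCA ler_wpM2l ?normal_peak_ge0// /normal_fun -expRD ler_expR.
have xzs : x <= z / s by rewrite ler_pdivlMr// ltW.
have -> : 2^-1 - x + - (z - s) ^+ 2 / (s ^+ 2 *+ 2) =
    - (z - 0) ^+ 2 / (s ^+ 2 *+ 2) + (z / s - x).
  by field; rewrite gt_eqF//= mulrn_eq0 /= sqrf_eq0 gt_eqF.
by rewrite lerDl subr_ge0.
Qed.

Lemma normal_pdf_opp (R : realType) (m s z : R) :
  normal_pdf (- m) s (- z) = normal_pdf m s z :> R \/ s = 0.
Proof.
have [->|s0] := eqVneq s 0; [by right|left].
by rewrite /normal_pdf (negbTE s0) /normal_fun -opprD sqrrN.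
Qed.

Lemma normal_tail (R : realType) (s x : R) : 0 < s ->
  (normal_prob 0 s [set z | x * s < `|z|]%R <= (2 * expR (2^-1 - x))%:E)%E.
Proof.
move=> s0; rewrite /normal_prob.
have mS : measurable [set z : R | x * s < `|z|].
  rewrite (_ : [set _ | _] = Num.norm @^-1` `]x * s, +oo[); last first.
    by apply/seteqP; split => z /=; rewrite in_itv/= andbT.
  rewrite -[_ @^-1` _]setTI; apply: (_ : measurable_fun setT (@Num.norm R R)) => //; exact: measurable_itv.
have mp D (m : R) : measurable_fun D (normal_pdf m s).
  by apply: measurable_funTS; exact: measurable_normal_pdf.
(* The two shifted densities dominate the two tails; each has total mass one, whence the factor
   2. *)
pose g z : R := expR (2^-1 - x) * (normal_pdf s s z + normal_pdf (- s) s z).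
have g0 z : 0 <= g z.
  by rewrite mulr_ge0 ?expR_ge0// addr_ge0// normal_pdf_ge0.
have mg D : measurable_fun D g.
  by apply: measurable_funM => //; apply: measurable_funD.
apply: (@le_trans _ _ (\int[lebesgue_measure]_z (g z)%:E)%E).
  apply: (@le_trans _ _ (\int[lebesgue_measure]_(z in [set z : R | x * s < `|z|]%R) (g z)%:E)%E).
    apply: ge0_le_integral => //.
    - by move=> z _; rewrite lee_fin normal_pdf_ge0.
    - by apply/measurable_EFinP; exact: mp.
    - by apply/measurable_EFinP; exact: mg.
    - move=> z /= xz; rewrite lee_fin /g.
      have e0 := expR_ge0 (2^-1 - x).
      have [z0|z0] := leP 0 z.
        apply: le_trans (normal_pdf_exp_shift s0 (x := x) _) _.
          by rewrite -[z]ger0_norm.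
        by rewrite ler_wpM2l// lerDl normal_pdf_ge0.
      have [<-|/eqP] := normal_pdf_opp 0 s z; last by rewrite gt_eqF.
      have [<-|/eqP] := normal_pdf_opp (- s) s z; last by rewrite gt_eqF.
      rewrite oppr0 opprK; apply: le_trans (normal_pdf_exp_shift s0 (x := x) _) _.
          by rewrite -[- z]gtr0_norm ?oppr_gt0// normrN.
      by rewrite ler_wpM2l// lerDr normal_pdf_ge0.
  apply: ge0_subset_integral => //.
  - by apply/measurable_EFinP; exact: mg.
  - by move=> z _; rewrite lee_fin.
have ip m : lebesgue_measure.-integrable [set: R] (EFin \o normal_pdf m s).
  exact: integrable_normal_pdf.
have R1 m : \int[lebesgue_measure]_z (normal_pdf m s z) = 1 :> R.
  by rewrite /Rintegral integral_normal_pdf.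
rewrite -[leLHS]fineK; last first.
  apply: integrable_fin_num => //; apply: (@integrableZl _ _ _ lebesgue_measure setT _ _ (EFin \o (normal_pdf s s \+ normal_pdf (- s) s))) => //.
  exact: (@integrableD _ _ _ lebesgue_measure setT _ (EFin \o _) (EFin \o _)).
rewrite lee_fin -[leLHS]/(\int[lebesgue_measure]_z g z) RintegralZl//; last first.
  exact: (@integrableD _ _ _ lebesgue_measure setT _ (EFin \o _) (EFin \o _)).
by rewrite RintegralD// !R1 mulrC.
Qed.

Lemma normal_pdf01E (R : realType) (z : R) :
  normal_pdf 0 1 z = normal_peak 1 * expR (- (z ^+ 2 / 2)).
Proof.
by rewrite /normal_pdf oner_eq0 /normal_fun subr0 expr1n mulNr.
Qed.

Lemma normal_peak1_le1 (R : realType) : normal_peak (1 : R) <= 1.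
Proof.
have h : 1 <= 1 ^+ 2 * pi *+ 2 :> R.
  by rewrite expr1n mul1r mulr2n; have := pi_ge2 R; lra.
rewrite /normal_peak invf_le1; last by rewrite sqrtr_gt0 (lt_le_trans _ h).
by rewrite -[X in X <= _]sqrtr1 ler_wsqrtr.
Qed.

(** With |a| <= |b| the difference is at most exp(-a^2/2) (b^2 - a^2)/2, and |a - b| <= 1 bounds b^2
    - a^2 by |a - b| (2|a| + 1). The exponential absorbs the linear factor because |a| + 1/2 <= 1 +
    a^2/2. *)
Lemma normal_pdf_lipschitz (R : realType) (a b : R) : `|a - b| <= 1 ->
  `|normal_pdf 0 1 a - normal_pdf 0 1 b| <= `|a - b|.
Proof.
wlog ab : a b / `|a| <= `|b|.
  move=> H; have [|/ltW] := leP `|a| `|b|; first exact: H.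
  by rewrite (distrC a) (distrC (normal_pdf _ _ a)); exact: H.
move=> ab1; rewrite !normal_pdf01E -mulrBr normrM ger0_norm ?normal_peak_ge0//.
apply: le_trans (_ : `|expR (- (a ^+ 2 / 2)) - expR (- (b ^+ 2 / 2))| <= _).
  by rewrite ler_piMl// normal_peak1_le1.
have e0 := expR_gt0 (- (a ^+ 2 / 2)).
have ab2 : a ^+ 2 <= b ^+ 2 by rewrite -[a ^+ 2]real_normK ?num_real// -[b ^+ 2]real_normK ?num_real// lerXn2r ?nnegrE.
rewrite ger0_norm; last by rewrite subr_ge0 ler_expR lerN2; lra.
have -> : expR (- (b ^+ 2 / 2)) = expR (- (a ^+ 2 / 2)) * expR ((a ^+ 2 - b ^+ 2) / 2).
  by rewrite -expRD; congr expR; lra.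
rewrite -[X in X - _]mulr1 -mulrBr.
have := expR_ge1Dx ((a ^+ 2 - b ^+ 2) / 2) => h.
have b1 : `|b| <= `|a| + 1.
  by rewrite -[b](subrKC a) (le_trans (ler_normD _ _))// lerD2l distrC.
have sq : b ^+ 2 - a ^+ 2 <= `|a - b| * (2 * `|a| + 1).
  rewrite subr_sqr [leLHS]mulrC (le_trans (ler_norm _))// normrM mulrC distrC ler_wpM2l//.
  by rewrite (le_trans (ler_normD _ _))//; lra.
have ea : expR (- (a ^+ 2 / 2)) * (`|a| + 2^-1) <= 1.
  rewrite expRN mulrC ler_pdivrMr ?expR_gt0// mul1r.
  apply: le_trans (expR_ge1Dx _).
  have : 0 <= (`|a| - 1) ^+ 2 by exact: sqr_ge0.
  by rewrite sqrrB1 real_normK ?num_real//; lra.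
apply: le_trans (_ : expR (- (a ^+ 2 / 2)) * (`|a - b| * (`|a| + 2^-1)) <= _).
  by rewrite ler_wpM2l ?expR_ge0//; lra.
by rewrite mulrCA ler_piMr.
Qed.

Lemma normal_prob_itv (R : realType) (c w : R) : 0 <= w <= 1 ->
  `|fine (normal_prob 0 1 `[c, (c + w)[) - w * normal_pdf 0 1 c| <= w ^+ 2.
Proof.
move=> /andP[w0 w1]; rewrite /normal_prob.
have -> : w * normal_pdf 0 1 c = \int[lebesgue_measure]_(x in `[c, (c + w)[) (normal_pdf 0 1 c).
  rewrite Rintegral_cst//= lebesgue_measure_itv/= lte_fin.
  case: ifPn => [_|]; first by rewrite /= addrAC subrr add0r mulrC.
  rewrite -leNgt /= => h. have w0E : w = 0 by lra. rewrite w0E. by rewrite mulr0 mul0r.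
pose I : set R := `[c, (c + w)[%classic.
have mI : measurable I by exact: measurable_itv.
have mu_lty : (lebesgue_measure I < +oo)%E.
  rewrite /I lebesgue_measure_itv/=; case: ifP => _; rewrite ?ltry//.
have ipp : lebesgue_measure.-integrable I (EFin \o normal_pdf 0 1).
  by apply: integrableS (integrable_normal_pdf 0 1).
have ipc : lebesgue_measure.-integrable I (EFin \o (fun=> normal_pdf 0 1 c)).
  by apply: (integrable_bounded (k := `|normal_pdf 0 1 c|)).
rewrite -[fine _]/(\int[lebesgue_measure]_(x in I) normal_pdf 0 1 x) -/I -RintegralB//.
have := @le_normr_Rintegral_itv R c (c + w) true true w (fun x => normal_pdf 0 1 x - normal_pdf 0 1 c).
rewrite lerDl addrAC subrr add0r expr2; apply => //.
  exact: integrable_subr.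
move=> x; rewrite in_itv/= => /andP[cx xc].
have xc0 : `|x - c| <= w by rewrite ger0_norm; lra.
by rewrite (le_trans (normal_pdf_lipschitz _))// (le_trans xc0).
Qed.

(** For 0 <= g <= 1 these are the reals whose fractional part is below [g]. *)
Definition periodic_set (R : realType) (g : R) : set R :=
  \bigcup_(k : int) `[k%:~R, (k%:~R + g)[%classic.

Lemma measurable_periodic_set (R : realType) (g : R) :
  measurable (periodic_set g).
Proof.
rewrite (_ : periodic_set g = \bigcup_(n : nat) (`[(Posz n)%:~R, (Posz n)%:~R + g[%classic `|`
    `[(Negz n)%:~R, (Negz n)%:~R + g[%classic)).
  apply: bigcupT_measurable => n; apply: measurableU; exact: measurable_itv.
apply/seteqP; split => x.
  by move=> [[n|n] _ xn]; exists n => //; [left|right].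
by move=> [n _ [|] xn]; [exists (Posz n)|exists (Negz n)].
Qed.

(** Both probabilities are compared with length times the density at the same left end [c]; the main
    terms cancel and only errors quadratic in the lengths remain. *)
Lemma normal_cell (R : realType) (g h c : R) : 0 <= g <= 1 -> 0 <= h <= 1 ->
  `|fine (normal_prob 0 1 `[c, (c + h * g)[) -
    g * fine (normal_prob 0 1 `[c, (c + h)[)| <= 2 * h ^+ 2.
Proof.
move=> /andP[g0 g1] /andP[h0 h1].
have hg : 0 <= h * g <= 1 by rewrite mulr_ge0//= mulr_ile1.
have H1 := normal_prob_itv c hg.
have H2 : `|fine (normal_prob 0 1 `[c, (c + h)[) - h * normal_pdf 0 1 c| <= h ^+ 2.
  by apply: normal_prob_itv; rewrite h0.
set A := fine _ in H1 *; set B := fine _ in H2 *; set p := normal_pdf _ _ _ in H1 H2.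
have -> : A - g * B = (A - h * g * p) - g * (B - h * p) by ring.
apply: le_trans (ler_normB _ _) _; rewrite normrM (ger0_norm g0) mulr2n mulrDl mul1r.
apply: lerD.
  by apply: le_trans H1 _; rewrite exprMn ler_piMr ?sqr_ge0// exprn_ile1.
by apply: le_trans H2; rewrite ler_piMl.
Qed.

Lemma fine_probabilityU d (T : measurableType d) (R : realType)
    (P : probability T R) (A B : set T) : measurable A -> measurable B ->
  A `&` B = set0 -> fine (P (A `|` B)) = fine (P A) + fine (P B).
Proof.
by move=> mA mB AB; rewrite measureU// fineD ?fin_num_measure.
Qed.

Lemma fine_probability_setC d (T : measurableType d) (R : realType)
    (P : probability T R) (A : set T) : measurable A ->
  fine (P (~` A)) = 1 - fine (P A).
Proof. by move=> mA; rewrite probability_setC// fineB ?fin_num_measure. Qed.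

Lemma normal_cells (R : realType) (g h b : R) (m : nat) : 0 <= g <= 1 -> 0 <= h <= 1 ->
  `|fine (normal_prob 0 1 (\bigcup_(k < m) `[b + h * k%:R, (b + h * k%:R + h * g)[%classic)) -
    g * fine (normal_prob 0 1 `[b, (b + h * m%:R)[)| <= (2 * h ^+ 2) *+ m.
Proof.
move=> g01 h01; move: (g01) (h01) => /andP[g0 g1] /andP[h0 h1].
elim: m => [|m IH].
  rewrite II0 bigcup_set0 mulr0 addr0 mulr0n set_itvco0.
  by rewrite measure0 mulr0 subr0 normr0.
pose U := \bigcup_(k < m) `[b + h * k%:R, (b + h * k%:R + h * g)[%classic.
have mU : measurable U by apply: bigcup_measurable.
rewrite IIS bigcup_setU bigcup_set1 -/U.
have hg : h * g <= h by rewrite ler_piMr.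
rewrite fine_probabilityU//; first last.
- apply/seteqP; split => // x [[k /= km]]; rewrite /= !in_itv/= => /andP[_ xk] /andP[mx _].
  have : h * k.+1%:R <= h * m%:R by rewrite ler_wpM2l// ler_nat.
  by rewrite -natr1 mulrDr mulr1; lra.
have -> : `[b, b + h * m.+1%:R[%classic = `[b, b + h * m%:R[%classic `|` `[b + h * m%:R, b + h * m%:R + h[%classic.
  rewrite -natr1 mulrDr mulr1 addrA -itv_bndbnd_setU// bnd_simp ?lerDl ?mulr_ge0//.
rewrite [X in _ - g * X]fine_probabilityU//; last first.
  by apply/seteqP; split => // x [] /=; rewrite !in_itv/= => /andP[_ h2] /andP[h3 _]; lra.
have := normal_cell (b + h * m%:R) g01 h01.
move: IH; rewrite -/U [_ *+ m.+1]mulrSr.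
set A := fine _; set B := fine _; set C := fine _; set D := fine _ => H1 H2.
have -> : A + C - g * (B + D) = (A - g * B) + (C - g * D) by ring.
by apply: le_trans (ler_normD _ _) _; apply: lerD.
Qed.

(** In the variable z the set fills the fraction [g] of each cell of width 1/s. A bounded window
    contains O(s) cells, each with an error O(1/s^2), whatever the offset [m]; outside the window
    the Gaussian mass is small. That [m] is arbitrary gives uniformity in the unknown function
    later. *)
Lemma normal_periodic (R : realType) (g : R) : 0 <= g <= 1 ->
  forall e : R, 0 < e -> exists s0 : R, forall s m : R, s0 <= s ->
    `|fine (normal_prob 0 1 [set z | periodic_set g (m + s * z)]) - g| <= e.
Proof.
move=> g01 e e0.
have [Z Z1 HZ] : exists2 Z : R, 1 <= Z & 2 * expR (2^-1 - Z) <= e / 4.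
  exists (Num.max 1 (2^-1 - ln (e / 8))); first by rewrite le_max lexx.
  set Z := Num.max _ _.
  have hZ : 2^-1 - ln (e / 8) <= Z by rewrite le_max lexx orbT.
  have : expR (2^-1 - Z) <= expR (ln (e / 8)) by rewrite ler_expR; lra.
  by rewrite lnK ?posrE ?divr_gt0//; lra.
(* The cell errors add up to at most 2 h^2 (2 s Z + 2) <= 4 h (Z + 1) with h = 1/s <= 1, so this
   threshold makes them at most e/4. *)
exists (Num.max 1 (16 * (Z + 1) / e)) => s m; rewrite ge_max => /andP[s1 sZ].
have s0 : 0 < s by lra.
pose h := s^-1.
have h01 : 0 <= h <= 1 by rewrite invr_ge0 ltW//= invf_le1.
(* Cells are aligned with the integers in the variable m + s z. The first begins at [k0], that is at
   or below -Z in the variable z, and the two extra cells in [M] make the last one end beyond Z. *)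
pose k0 := Num.floor (m - s * Z).
have [k0l k0u] : k0%:~R <= m - s * Z /\ m - s * Z < k0%:~R + 1.
  by have /andP[? ?] := floor_itv (m - s * Z); split => //; rewrite -[1]/(1%:~R) -intrD.
pose b := h * (k0%:~R - m).
pose M := (Num.truncn (2 * s * Z)).+2.
have sZ0 : 0 <= 2 * s * Z by rewrite !mulr_ge0//; lra.
have [Ml Mu] : 2 * s * Z + 1 <= M%:R /\ M%:R <= 2 * s * Z + 2.
  have := truncn_itv sZ0; rewrite /M; move: (Num.truncn _) => t /andP[t1].
  by rewrite -(natr1 t) -(natr1 t.+1) -(natr1 t) => t2; split; lra.
have bZ : b <= - Z.
  rewrite /b mulrC ler_pdivrMr//; lra.
have bMZ : Z < b + h * M%:R.
  rewrite /b -mulrDr mulrC ltr_pdivlMr//; lra.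
set E := [set z | _]; set J : set R := `[b, (b + h * M%:R)[%classic.
have mE : measurable E.
  rewrite -[E]setTI; apply: (_ : measurable_fun setT (fun z : R => m + s * z)) => //.
    by apply: measurable_funD => //; apply: measurable_funM.
  exact: measurable_periodic_set.
have mJ : measurable J by exact: measurable_itv.
have EJ : E `&` J = \bigcup_(k < M) `[b + h * k%:R, (b + h * k%:R + h * g)[%classic.
  have key (k : nat) z : (b + h * k%:R <= z) = ((k0%:~R + k%:R) <= m + s * z).
    rewrite /b -mulrDr mulrC ler_pdivrMr//; apply/idP/idP => H; lra.
  have key2 (k : nat) z : (z < b + h * k%:R + h * g) = (m + s * z < k0%:~R + k%:R + g).
    rewrite /b -!mulrDr mulrC ltr_pdivlMr//; apply/idP/idP => H; lra.
  apply/seteqP; split => z.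
    move=> [[k _ /=]]; rewrite in_itv/= => /andP[kz zk]; rewrite /J/= in_itv/= => /andP[bz zb].
    have g1 : g <= 1 by case/andP: g01.
    have := key 0%N z; rewrite mulr0 !addr0 bz => /esym k0z.
    have := key M z; rewrite leNgt zb /= => /esym/negbT; rewrite -ltNge => zM.
    have k0k : k0 <= k by rewrite -ltzD1 -(ltr_int R) intrD; lra.
    have kM : k < k0 + M%:Z by rewrite -(ltr_int R) intrD; lra.
    exists `|k - k0|%N.
      by rewrite /= -ltz_nat gez0_abs ?subr_ge0// ltrBlDl.
    have kk : k0%:~R + (`|k - k0|%N)%:R = k%:~R :> R.
      by rewrite -[X in _ + X]/((Posz _)%:~R) gez0_abs ?subr_ge0// -intrD subrKC.
    by rewrite /= in_itv/= key key2 kk kz zk.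
  move=> [k /= kM]; rewrite in_itv/= => /andP[kz zk].
  split.
    exists (k0 + k%:Z) => //=.
    by rewrite in_itv/= intrD -key -key2 kz zk.
  rewrite /J /= in_itv/=; apply/andP; split.
    by apply: le_trans kz; rewrite lerDl mulr_ge0//; case/andP: h01.
  apply: lt_le_trans zk _; rewrite -addrA lerD2l -mulrDr ler_wpM2l//.
    by case/andP: h01.
  case/andP: g01 => _ g1; apply: (@le_trans _ _ (k.+1)%:R); first by rewrite -natr1 lerD2l.
  by rewrite ler_nat.
have PC : (normal_prob 0 1 (~` J) <= (e / 4)%:E)%E.
  apply: (@le_trans _ _ (2 * expR (2^-1 - Z))%:E); last by rewrite lee_fin.
  apply: le_trans (normal_tail Z ltr01).
  apply: le_measure; rewrite ?inE.
  - exact: measurableC.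
  - rewrite (_ : [set z : R | _] = Num.norm @^-1` `]Z * 1, +oo[%classic); last first.
      by apply/seteqP; split => z /=; rewrite in_itv/= andbT.
    rewrite -[_ @^-1` _]setTI; apply: (_ : measurable_fun setT (@Num.norm R R)) => //; exact: measurable_itv.
  - move=> z /= /negP; rewrite in_itv/= negb_and -ltNge -leNgt mulr1 => /orP[zb|zb].
      by rewrite ltr0_norm; lra.
    by rewrite gtr0_norm; lra.
have PCr : 0 <= fine (normal_prob 0 1 (~` J)) <= e / 4.
  rewrite fine_ge0//= -lee_fin fineK//; apply: fin_num_measure; exact: measurableC.
have PJ : fine (normal_prob 0 1 J) = 1 - fine (normal_prob 0 1 (~` J)).
  by rewrite fine_probability_setC// subKr.
have PE : fine (normal_prob 0 1 E) = fine (normal_prob 0 1 (E `\` J)) + fine (normal_prob 0 1 (E `&` J)).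
  rewrite -fine_probabilityU; [by rewrite setUC setUIDK|exact: measurableD|exact: measurableI|].
  by rewrite setDE setIACA setICl setI0.
have PEJ : 0 <= fine (normal_prob 0 1 (E `\` J)) <= e / 4.
  rewrite fine_ge0//=; apply: (@le_trans _ _ (fine (normal_prob 0 1 (~` J)))); last by case/andP: PCr.
  apply: fine_le; rewrite ?fin_num_measure//; [exact: measurableD|exact: measurableC|].
  apply: le_measure; rewrite ?inE; [exact: measurableD|exact: measurableC|].
  by move=> z [].
have := normal_cells b M g01 h01; rewrite -EJ -/J => HM.
have hM : (2 * h ^+ 2) *+ M <= e / 4.
  rewrite -mulr_natr; apply: (@le_trans _ _ (2 * h ^+ 2 * (2 * s * Z + 2))).
    by rewrite ler_wpM2l// mulr_ge0// sqr_ge0.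
  have hs : h * s = 1 by rewrite /h mulVf// gt_eqF.
  have -> : 2 * h ^+ 2 * (2 * s * Z + 2) = 4 * (h * s) * h * Z + 4 * h * h by ring.
  rewrite hs; move: sZ; rewrite ler_pdivrMr// => sZ.
  have h1 : 16 * (Z + 1) * h <= e.
    apply: le_trans (_ : s * e * h <= _); first by rewrite ler_wpM2r//; case/andP: h01.
    by rewrite mulrC mulrA hs mul1r.
  case/andP: h01 => h0 hle1.
  have : h * h <= h by rewrite ler_piMl.
  lra.
case/andP: g01 => g0 g1; case/andP: PCr => PC0 PC1; case/andP: PEJ => PE0 PE1.
rewrite PE; move: HM; rewrite PJ; set x := fine _ in PE0 PE1 *; set y := fine _; set c := fine _ in PC0 PC1 *.
have gc : 0 <= g * c <= e / 4.
  by rewrite mulr_ge0//=; apply: le_trans PC1; rewrite ler_piMl.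
case/andP: gc => gc0 gc1.
rewrite !ler_norml mulrBr mulr1 => /andP[H1 H2]; apply/andP; split; lra.
Qed.

(** * Square-integrable functions *)

Section L2.
Context (R : realType) (D : set R).
Hypothesis mD : measurable D.
Implicit Types f g h : R -> R.
Local Notation mu := lebesgue_measure.

Lemma in_L2P f : in_L2 D f <->
  measurable_fun D f /\ mu.-integrable D (EFin \o (fun x => f x ^+ 2)).
Proof.
split=> [[mf fi]|[mf /integrableP[_ fi]]]; split => //.
  apply/integrableP; split.
    by apply/measurable_EFinP; exact: measurable_funX.
  by under eq_integral do rewrite /= ger0_norm ?sqr_ge0//.
by under eq_integral do rewrite -[(_ ^+ 2)%R]ger0_norm ?sqr_ge0//.
Qed.

Lemma in_L2_integrable_mul f g : in_L2 D f -> in_L2 D g ->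
  mu.-integrable D (EFin \o (fun x => f x * g x)).
Proof.
move=> /in_L2P[mf fi] /in_L2P[mg gi].
apply: le_integrable (integrable_addr mD fi gi) => //.
  by apply/measurable_EFinP; exact: measurable_funM.
move=> x Dx /=; rewrite lee_fin [leRHS]ger0_norm ?addr_ge0 ?sqr_ge0//.
rewrite normrM -[f x ^+ 2]real_normK ?num_real// -[g x ^+ 2]real_normK ?num_real//.
have := sqr_ge0 (`|f x| - `|g x|); rewrite sqrrB.
have : 0 <= `|f x| * `|g x| by rewrite mulr_ge0.
by rewrite mulr2n; lra.
Qed.

Lemma in_L2_scale k f : in_L2 D f -> in_L2 D (fun x => k * f x).
Proof.
move=> /in_L2P[mf fi]; apply/in_L2P; split; first exact: measurable_funM.
under [X in EFin \o X]eq_fun do rewrite exprMn.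
exact: integrable_scaler.
Qed.

Lemma in_L2_add f g : in_L2 D f -> in_L2 D g -> in_L2 D (fun x => f x + g x).
Proof.
move=> Lf Lg; have [mf fi] := (in_L2P f).1 Lf; have [mg gi] := (in_L2P g).1 Lg.
apply/in_L2P; split; first exact: measurable_funD.
under [X in EFin \o X]eq_fun do rewrite sqrrD -mulr_natl.
apply: integrable_addr => //; apply: integrable_addr => //.
by apply: integrable_scaler => //; exact: in_L2_integrable_mul.
Qed.

Lemma in_L2_sub f g : in_L2 D f -> in_L2 D g -> in_L2 D (fun x => f x - g x).
Proof.
move=> Lf Lg; under eq_fun do rewrite -mulN1r.
by apply: in_L2_add => //; exact: in_L2_scale.
Qed.

Lemma in_L2_0 : in_L2 D (fun=> 0).
Proof.
apply/in_L2P; split => //.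
under [X in EFin \o X]eq_fun do rewrite expr0n.
exact: integrable0.
Qed.

Lemma in_L2_sum (J : eqType) (s : seq J) (u : J -> R -> R) :
  (forall i, i \in s -> in_L2 D (u i)) -> in_L2 D (fun x => \sum_(i <- s) u i x).
Proof.
elim: s => [|a s IH] Lu.
  by under eq_fun do rewrite big_nil; exact: in_L2_0.
under eq_fun do rewrite big_cons.
apply: in_L2_add; first by apply: Lu; rewrite mem_head.
by apply: IH => i si; apply: Lu; rewrite in_cons si orbT.
Qed.

Lemma ipC f g : ip D f g = ip D g f.
Proof. by rewrite /ip; apply: eq_Rintegral => x _; rewrite mulrC. Qed.

Lemma ip_subl f g h : in_L2 D f -> in_L2 D g -> in_L2 D h ->
  ip D (fun x => f x - g x) h = ip D f h - ip D g h.
Proof.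
move=> Lf Lg Lh; rewrite /ip -RintegralB//; try exact: in_L2_integrable_mul.
by apply: eq_Rintegral => x _; rewrite mulrBl.
Qed.

Lemma ip_suml (J : eqType) (s : seq J) (c : J -> R) (u : J -> R -> R) h :
  (forall i, i \in s -> in_L2 D (u i)) -> in_L2 D h ->
  ip D (fun x => \sum_(i <- s) c i * u i x) h = \sum_(i <- s) c i * ip D (u i) h.
Proof.
move=> Lu Lh; rewrite /ip.
under eq_Rintegral do rewrite mulr_suml.
rewrite Rintegral_sum//; last first.
  by move=> i si; apply: in_L2_integrable_mul => //; apply: in_L2_scale; exact: Lu.
rewrite [LHS]big_seq [RHS]big_seq; apply: eq_bigr => i si.
rewrite -RintegralZl//; last by apply: in_L2_integrable_mul => //; exact: Lu.
by apply: eq_Rintegral => x _; rewrite mulrA.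
Qed.

Lemma orthonormal_ip_sum (J : eqType) (I : set J) (e : J -> R -> R) (F : seq J)
    (c : J -> R) i : Defs.orthonormal D I e -> uniq F -> (forall i, i \in F -> I i) ->
  I i -> ip D (fun x => \sum_(i <- F) c i * e i x) (e i) = if i \in F then c i else 0.
Proof.
move=> [Le eij] uF FI Ii; rewrite ip_suml//; [|by move=> j /FI /Le|exact: Le].
case: ifPn => iF.
  rewrite (bigD1_seq i)//= eij// eqxx mulr1 big_seq_cond big1 ?addr0// => j /andP[jF ji].
  by rewrite eij ?(negbTE ji) ?mulr0//; exact: FI.
rewrite big_seq big1// => j jF; rewrite eij//; last exact: FI.
by case: eqP => [ji|_]; [rewrite -ji jF in iF|rewrite mulr0].
Qed.

(* Pythagoras: f - Pf is orthogonal to every combination of the e i, i in F. *)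
Lemma best_approximation (J : eqType) (I : set J) (e : J -> R -> R) (F : seq J)
    (s : seq (R * J)) f :
  Defs.orthonormal D I e -> in_L2 D f -> uniq F -> (forall i, i \in F -> I i) ->
  (forall p, p \in s -> p.2 \in F) ->
  \int[mu]_(x in D) ((f x - \sum_(i <- F) ip D f (e i) * e i x) ^+ 2) <=
  \int[mu]_(x in D) ((f x - \sum_(p <- s) p.1 * e p.2 x) ^+ 2).
Proof.
move=> oe Lf uF FI sF; have [Le _] := oe.
have LF : in_L2 D (fun x => \sum_(i <- F) ip D f (e i) * e i x).
  by apply: in_L2_sum => i /FI Ii; apply: in_L2_scale; exact: Le.
have Ls : in_L2 D (fun x => \sum_(p <- s) p.1 * e p.2 x).
  by apply: in_L2_sum => p /sF /FI Ii; apply: in_L2_scale; exact: Le.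
pose g x := f x - \sum_(i <- F) ip D f (e i) * e i x.
pose h x := \sum_(i <- F) ip D f (e i) * e i x - \sum_(p <- s) p.1 * e p.2 x.
have Lg : in_L2 D g by exact: in_L2_sub.
have Lh : in_L2 D h by exact: in_L2_sub.
have gF i : i \in F -> ip D g (e i) = 0.
  move=> iF; rewrite ip_subl//; last by apply: Le; exact: FI.
  by rewrite (orthonormal_ip_sum _ oe)// ?iF ?subrr//; exact: FI.
have gh : ip D h g = 0.
  rewrite ip_subl// !ip_suml//; try by move=> i /sF /FI /Le || by move=> i /FI /Le.
  rewrite big_seq big1 ?sub0r => [|i iF]; last by rewrite (ipC _ g) gF// mulr0.
  by rewrite big_seq big1 ?oppr0// => p /sF pF; rewrite (ipC _ g) gF// mulr0.
have [_ gi] := (in_L2P g).1 Lg; have [_ hi] := (in_L2P h).1 Lh.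
have ghi := in_L2_integrable_mul Lh Lg.
have -> : \int[mu]_(x in D) ((f x - \sum_(p <- s) p.1 * e p.2 x) ^+ 2) =
  \int[mu]_(x in D) (g x ^+ 2) + (2 * ip D h g + \int[mu]_(x in D) (h x ^+ 2)).
  rewrite /ip -RintegralZl// -!RintegralD//; first last.
  - exact: integrable_scaler.
  - by apply: integrable_addr => //; exact: integrable_scaler.
  by apply: eq_Rintegral => x _; rewrite /g /h; ring.
rewrite gh mulr0 add0r lerDl; apply: Rintegral_ge0 => x _; exact: sqr_ge0.
Qed.

Lemma Rintegral_sqr_eq0_ae f : in_L2 D f -> \int[mu]_(x in D) (f x ^+ 2) = 0 ->
  {ae mu, forall x, D x -> f x = 0}.
Proof.
move=> /in_L2P[mf fi] f0.
have : (\int[mu]_(x in D) `|((f x) ^+ 2)%:E| = 0)%E.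
  under eq_integral do rewrite gee0_abs ?lee_fin ?sqr_ge0//.
  by rewrite EFin_Rintegral// f0.
move=> /(@ae_eq_integral_abs _ _ _ mu D mD _ (measurable_int _ fi)).
by apply: ae_lebesgueS => x /= h Dx; have /eqP := h Dx; rewrite eqe sqrf_eq0 => /eqP.
Qed.

Lemma Rintegral_lt f (delta : R) : in_L2 D f ->
  (\int[mu]_(x in D) ((f x) ^+ 2)%:E < delta%:E)%E = (\int[mu]_(x in D) (f x ^+ 2) < delta).
Proof.
move=> /in_L2P[mf fi].
by rewrite EFin_Rintegral// lte_fin.
Qed.

(** If the squared distance from f to its projection on F were positive, some finite combination
    would come strictly closer. Adding its indices to F does not change the projection, since the
    new coefficients vanish, and this contradicts best approximation. *)
Lemma in_closed_span_finite (J : eqType) (I : set J) (e : J -> R -> R) (F : seq J) f :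
  Defs.orthonormal D I e -> in_closed_span D I e f -> uniq F -> (forall i, i \in F -> I i) ->
  (forall i, I i -> i \notin F -> ip D f (e i) = 0) ->
  {ae mu, forall x, D x -> f x = \sum_(i <- F) ip D f (e i) * e i x}.
Proof.
move=> oe [Lf fspan] uF FI f0; have [Le _] := oe.
have LF : in_L2 D (fun x => \sum_(i <- F) ip D f (e i) * e i x).
  by apply: in_L2_sum => i /FI Ii; apply: in_L2_scale; exact: Le.
have : {ae mu, forall x, D x -> f x - \sum_(i <- F) ip D f (e i) * e i x = 0}.
  apply: Rintegral_sqr_eq0_ae; first exact: in_L2_sub.
  apply/eqP; rewrite eq_le [X in _ && X]Rintegral_ge0 ?andbT; last by move=> x _; exact: sqr_ge0.
  rewrite leNgt; apply/negP => d0.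
  have [s [sI]] := fspan _ d0.
  have Ls : in_L2 D (fun x => \sum_(p <- s) p.1 * e p.2 x).
    by apply: in_L2_sum => p /sI Ii; apply: in_L2_scale; exact: Le.
  rewrite (Rintegral_lt _ (in_L2_sub Lf Ls)) ltNge => /negP; apply.
  pose F' := undup (F ++ map snd s).
  have F'I i : i \in F' -> I i.
    by rewrite mem_undup mem_cat => /orP[/FI//|/mapP[p ps ->]]; exact: sI.
  rewrite (_ : (fun x => _) = fun x => (f x - \sum_(i <- F') ip D f (e i) * e i x) ^+ 2); last first.
    apply/funext => x; congr ((_ - _) ^+ 2).
    rewrite -(big_rmcond_in (fun i => i \in F) (r := F')); last first.
      by move=> i iF' iF; rewrite f0// ?mul0r//; exact: F'I.
    rewrite -big_filter; apply: perm_big; apply: uniq_perm; rewrite ?filter_uniq ?undup_uniq//.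
    by move=> i; rewrite mem_filter mem_undup mem_cat; case: (i \in F).
  apply: (best_approximation oe Lf) => //; first exact: undup_uniq.
  by move=> p ps; rewrite mem_undup mem_cat; apply/orP; right; apply/mapP; exists p.
by apply: ae_lebesgueS => x h Dx; apply/eqP; rewrite -subr_eq0 h.
Qed.

End L2.

(** * Regularity of the wavelet basis *)

(** One constant serves as bound, Lipschitz constant and radius of the support, so that finite sums
    and dilations only enlarge it. The set [D] is needed because the edge functions are controlled
    on the half line only. *)
Definition regular_on (R : realType) (D : set R) (C : R) (g : R -> R) :=
  [/\ forall x, D x -> `|g x| <= C,
      forall x y, D x -> D y -> `|g x - g y| <= C * `|x - y| &
      forall x, D x -> C < `|x| -> g x = 0].

Lemma regular_on_le (R : realType) (D : set R) C C' (g : R -> R) :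
  C <= C' -> regular_on D C g -> regular_on D C' g.
Proof.
move=> CC' [g1 g2 g3]; split => [x Dx|x y Dx Dy|x Dx Cx].
- exact: le_trans (g1 _ Dx) _.
- by apply: le_trans (g2 _ _ Dx Dy) _; rewrite ler_wpM2r.
- by apply: g3 => //; exact: le_lt_trans Cx.
Qed.

Lemma regular_on_ext (R : realType) (D : set R) C (g g' : R -> R) :
  (forall x, D x -> g x = g' x) -> regular_on D C g -> regular_on D C g'.
Proof.
move=> gg' [g1 g2 g3]; split => [x Dx|x y Dx Dy|x Dx Cx].
- by rewrite -gg'//; exact: g1.
- by rewrite -!gg'//; exact: g2.
- by rewrite -gg'//; exact: g3.
Qed.

Lemma regular_on_add (R : realType) (D : set R) C C' (g g' : R -> R) :
  0 <= C -> 0 <= C' ->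
  regular_on D C g -> regular_on D C' g' ->
  regular_on D (C + C') (fun x => g x + g' x).
Proof.
move=> C0 C0' [g1 g2 g3] [g1' g2' g3']; split => [x Dx|x y Dx Dy|x Dx Cx].
- by rewrite (le_trans (ler_normD _ _))// lerD ?g1 ?g1'.
- rewrite opprD addrACA mulrDl (le_trans (ler_normD _ _))// lerD ?g2 ?g2'//.
- by rewrite g3 ?g3' ?addr0// (le_lt_trans _ Cx)// ?lerDl ?lerDr.
Qed.

Lemma regular_on_scale (R : realType) (D : set R) C k (g : R -> R) :
  0 <= C -> regular_on D C g ->
  regular_on D (C * (1 + `|k|)) (fun x => k * g x).
Proof.
move=> C0 [g1 g2 g3]; split => [x Dx|x y Dx Dy|x Dx Cx].
- rewrite normrM mulrC ler_pM// ?g1 // lerDr//.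
- rewrite -mulrBr normrM mulrC mulrAC ler_pM// ?mulr_ge0// ?g2//.
  by rewrite lerDr.
- rewrite g3 ?mulr0//; apply: le_lt_trans Cx.
  by rewrite ler_peMr// lerDl.
Qed.

(** Expansion by |a| >= 1 enlarges neither the sup norm nor, apart from the shift, the support. The
    dilations to which it is applied have factors 1, -1 and 2. *)
Lemma regular_on_affine (R : realType) (D D' : set R) C a b (g : R -> R) :
  0 <= C -> 1 <= `|a| -> (forall x, D' x -> D (a * x + b)) -> regular_on D C g ->
  regular_on D' (C * `|a| + `|b|) (fun x => g (a * x + b)).
Proof.
move=> C0 a1 DD [g1 g2 g3]; split => [x Dx|x y Dx Dy|x Dx Cx].
- apply: le_trans (g1 _ (DD _ Dx)) _.
  by rewrite -[leLHS]addr0 lerD// ler_peMr.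
- apply: le_trans (g2 _ _ (DD _ Dx) (DD _ Dy)) _.
  have -> : a * x + b - (a * y + b) = a * (x - y) by ring.
  by rewrite normrM mulrA ler_wpM2r// lerDl.
- apply: g3; first exact: DD.
  have : `|a * x| <= `|a * x + b| + `|b|.
    by rewrite -{1}[a * x](addrK b) ler_normB.
  rewrite normrM => h.
  have : (C * `|a| + `|b|) * 1 <= (C * `|a| + `|b|) * `|a|.
    by rewrite ler_wpM2l// addr_ge0// mulr_ge0.
  have : (C * `|a| + `|b|) * `|a| < `|x| * `|a| by rewrite ltr_pM2r//; lra.
  have : C * 1 <= C * `|a| by rewrite ler_wpM2l.
  by lra.
Qed.

Definition regular (R : realType) (D : set R) (g : R -> R) :=
  exists2 C : R, 0 <= C & regular_on D C g.

Section regular.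
Context (R : realType) (D : set R).
Implicit Types g : R -> R.

Lemma regular_ext g g' :
  (forall x, D x -> g x = g' x) -> regular D g -> regular D g'.
Proof. by move=> gg' [C C0 gC]; exists C => //; exact: regular_on_ext gC. Qed.

Lemma regular_add g g' : regular D g -> regular D g' ->
  regular D (fun x => g x + g' x).
Proof.
move=> [C C0 gC] [C' C0' gC']; exists (C + C'); first exact: addr_ge0.
exact: regular_on_add.
Qed.

Lemma regular_scale k g : regular D g -> regular D (fun x => k * g x).
Proof.
move=> [C C0 gC]; exists (C * (1 + `|k|)); first by rewrite mulr_ge0// addr_ge0.
exact: regular_on_scale.
Qed.

Lemma regular_sum (I : Type) (s : seq I) (P : pred I) (u : I -> R -> R) :
  (forall i, P i -> regular D (u i)) -> regular D (fun x => \sum_(i <- s | P i) u i x).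
Proof.
move=> Hu; elim: s => [|a s IH].
  exists 0 => //; split => [x _|x y _ _|x _ _]; rewrite !big_nil ?normr0//.
  by rewrite subrr normr0 mul0r.
case Pa : (P a); under eq_fun do rewrite big_cons Pa.
  by apply: regular_add => //; exact: Hu.
exact: IH.
Qed.

Lemma regular_affine (D' : set R) a b g : 1 <= `|a| ->
  (forall x, D' x -> D (a * x + b)) -> regular D g ->
  regular D' (fun x => g (a * x + b)).
Proof.
move=> a1 DD [C C0 gC]; exists (C * `|a| + `|b|); first by rewrite addr_ge0// mulr_ge0.
exact: regular_on_affine gC.
Qed.

End regular.

Lemma regular_subset (R : realType) (D D' : set R) (g : R -> R) :
  D' `<=` D -> regular D g -> regular D' g.
Proof.
move=> DD [C C0 [g1 g2 g3]]; exists C => //.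
split => [x /DD|x y /DD Dx /DD|x /DD]; [exact: g1|exact: g2|exact: g3].
Qed.

Lemma regular_uniform (R : realType) (D : set R) (N : nat) (u : nat -> R -> R) :
  (forall k, (k < N)%N -> regular D (u k)) ->
  exists2 C : R, 0 <= C & forall k, (k < N)%N -> regular_on D C (u k).
Proof.
elim: N => [|N IH] Hu; first by exists 0.
have [|C C0 HC] := IH; first by move=> k kN; apply: Hu; rewrite ltnS ltnW.
have [C' C0' HC'] := Hu N (ltnSn N).
exists (C + C'); first exact: addr_ge0.
move=> k; rewrite ltnS leq_eqVlt => /predU1P[->|kN].
  by apply: regular_on_le HC'; rewrite lerDr.
by apply: regular_on_le (HC _ kN); rewrite lerDl.
Qed.

Lemma regular_continuous (R : realType) (g : R -> R) : regular setT g -> continuous g.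
Proof.
move=> [C C0 [_ g2 _]] x; apply/cvgrPdist_lt => e e0.
near=> y; apply: le_lt_trans (g2 x y I I) _.
apply: (@le_lt_trans _ _ ((C + 1) * `|x - y|)); first by rewrite ler_wpM2r// lerDl.
rewrite mulrC -ltr_pdivlMr; last by lra.
near: y; apply: cvgr_dist_lt => //; rewrite divr_gt0//; lra.
Unshelve. all: by end_near. Qed.

(** Compactness of an interval containing the support bounds g and its derivative; the mean value
    theorem turns the latter into a Lipschitz bound. *)
Lemma C2_regular (R : realType) (a b : R) (g : R -> R) :
  supported_in a b g -> twice_continuously_differentiable g -> regular setT g.
Proof.
move=> gs [dg ddg _].
pose B := `|a| + `|b| + 1.
have B1 : 1 <= B by rewrite /B lerDr addr_ge0.
have gB x : B <= `|x| -> g x = 0.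
  move=> Bx; apply: gs; rewrite in_itv/=; apply/negP => /andP[ax xb].
  move: Bx; rewrite /B leNgt => /negP; apply.
  have := ler_norm b; have := ler_norm (- a); rewrite normrN => ha hb.
  by have := normr_ge0 a; have := normr_ge0 b; rewrite ltr_norml => ? ?; apply/andP; split; lra.
have cg : continuous g by move=> x; apply/differentiable_continuous/derivable1_diffP.
have cdg : continuous (derive1 g) by move=> x; apply/differentiable_continuous/derivable1_diffP.
have BB : - B <= B by lra.
have [c _ cmax] := @EVT_max R (fun x => `|g x|) (- B) B BB
  (continuous_subspaceT (fun x => continuous_comp (cg x) (@norm_continuous _ _ _))).
have [d _ dmax] := @EVT_max R (fun x => `|derive1 g x|) (- B) B BB
  (continuous_subspaceT (fun x => continuous_comp (cdg x) (@norm_continuous _ _ _))).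
(* Clamping to [-B, B] leaves g unchanged, because g vanishes at -B, at B and beyond. The clamp is
   1-Lipschitz, so the mean value theorem is needed only inside [-B, B], where the derivative is
   bounded by its maximum. *)
pose cl x := Num.max (- B) (Num.min B x).
have gcl x : g x = g (cl x).
  rewrite /cl; case: (ltP B x) => Bx.
    rewrite max_r// !gB// ger0_norm; lra.
  by case: leP => // xB; rewrite !gB// ?ler0_norm; lra.
have clB x : - B <= cl x <= B.
  by rewrite le_max lexx/= ge_max BB ge_min lexx.
have clP x : [\/ x < - B /\ cl x = - B, B < x /\ cl x = B | - B <= x <= B /\ cl x = x].
  rewrite /cl; case: (ltP B x) => Bx.
    by apply: Or32; split => //; rewrite max_r//; lra.
  by case: leP => ?; [apply: Or33; split => //; lra|apply: Or31].
have clL x y : `|cl x - cl y| <= `|x - y|.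
  wlog xy : x y / x <= y.
    move=> H; have [|/ltW] := leP x y; first exact: H.
    by rewrite (distrC x) (distrC (cl x)); exact: H.
  have [cxy cxy'] : cl x <= cl y /\ cl y - cl x <= y - x.
    move: (clP x) (clP y); move: (cl x) (cl y) => u v; clear -xy BB.
    by case=> -[? ->]; case=> -[? ->]; split; lra.
  by rewrite !ler0_norm; lra.
exists (`|g c| + `|derive1 g d| + B); first by rewrite !addr_ge0//; lra.
have g0 := normr_ge0 (g c); have d0 := normr_ge0 (derive1 g d).
split => [x _|x y _ _|x _ Bx].
- have : cl x \in `[- B, B] by rewrite in_itv/= clB.
  by rewrite gcl => /cmax; lra.
- wlog xy : x y / cl x <= cl y.
    move=> H; have [|/ltW] := leP (cl x) (cl y); first exact: H.
    by rewrite (distrC x) (distrC (g x)); exact: H.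
  have [| |z zi E] := @MVT_segment R g (derive1 g) (cl x) (cl y) xy.
  - by move=> z _; apply: DeriveDef => //; rewrite derive1E.
  - exact: continuous_subspaceT.
  rewrite gcl (gcl y) distrC E normrM.
  have : `|derive1 g z| <= `|derive1 g d|.
    apply: dmax; move: zi; rewrite !in_itv/= => /andP[xz zy].
    case/andP: (clB x) => h1 h2; case/andP: (clB y) => h3 h4.
    by apply/andP; split; lra.
  move=> h; apply: (@le_trans _ _ (`|derive1 g d| * `|x - y|)).
    by rewrite ler_pM// distrC.
  by rewrite ler_wpM2r//; lra.
- apply: gB; lra.
Qed.

(** * Dilation by two and regularity of the mother wavelet *)

Lemma integral_dilation2 (R : realType) (h : R -> R) :
  continuous h -> (forall x, 0 <= h x) ->
  (\int[lebesgue_measure]_x (h x)%:E = \int[lebesgue_measure]_x (2 * h (2 * x))%:E)%E.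
Proof.
move=> ch h0.
have dF : (fun x : R => 2 * x)^`()%classic = cst 2.
  apply/funext => x; rewrite derive1E deriveM// derive_cst derive_id.
  by rewrite scaler0 addr0 /GRing.scale/= mulr1.
rewrite (@increasing_ge0_integration_by_substitutionT R (fun x => 2 * x) h) ?dF//.
- by apply: eq_integral => x _ /=; rewrite mulrC.
- by move=> x y xy; rewrite ltr_pM2l.
- by move=> x; exact: cvg_cst.
- exact: is_cvg_cst.
- exact: is_cvg_cst.
- exact/gt0_cvgMrNy.
- exact/gt0_cvgMry.
Qed.

Section dilation.
Context (R : realType) (phi : R -> R).
Local Notation mu := (@lebesgue_measure R).

Definition dilate (k : int) (x : R) : R := Num.sqrt 2 * translates phi k (2 * x).

Hypothesis rphi : regular setT phi.
Hypothesis ophi : Defs.orthonormal setT setT (translates phi).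

Lemma regular_translates k : regular setT (translates phi k).
Proof.
have := @regular_affine R setT setT 1 (- k%:~R) phi.
by rewrite normr1 /translates => H; under eq_fun do rewrite -[X in X - _]mul1r; exact: H.
Qed.

Lemma regular_dilate k : regular setT (dilate k).
Proof.
apply: regular_scale.
have := @regular_affine R setT setT 2 (- k%:~R) phi.
by apply => //; rewrite ger0_norm//; lra.
Qed.

Lemma continuous_sqr (f : R -> R) : continuous f -> continuous (fun x => f x ^+ 2).
Proof.
move=> cf x; under eq_fun do rewrite expr2; apply: cvgM; exact: cf.
Qed.

Lemma Rintegral_dilate_sqr (c d : R) k l :
  \int[mu]_x ((c * dilate k x + d * dilate l x) ^+ 2) =
  \int[mu]_x ((c * translates phi k x + d * translates phi l x) ^+ 2).
Proof.
rewrite /Rintegral (integral_dilation2 (h := fun x => (c * translates phi k x + d * translates phi l x) ^+ 2)).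
- congr fine; apply: eq_integral => x _; congr (_%:E).
  have s2 : Num.sqrt (2 : R) ^+ 2 = 2 by rewrite sqr_sqrtr.
  transitivity (Num.sqrt 2 ^+ 2 * (c * translates phi k (2 * x) + d * translates phi l (2 * x)) ^+ 2).
    by rewrite /dilate -exprMn; congr (_ ^+ 2); ring.
  by rewrite s2.
- apply: continuous_sqr; apply: regular_continuous.
  by apply: regular_add; apply: regular_scale; exact: regular_translates.
- by move=> x; exact: sqr_ge0.
Qed.

Lemma in_L2_dilate k : in_L2 setT (dilate k).
Proof.
split; first exact: continuous_measurable_fun (regular_continuous (regular_dilate k)).
have [_] := ophi.1 k I; apply: le_lt_trans.
rewrite [leRHS](integral_dilation2 (h := fun x => translates phi k x ^+ 2)).
- rewrite le_eqVlt; apply/orP; left; apply/eqP; apply: eq_integral => x _; congr (_%:E).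
  by rewrite /dilate exprMn sqr_sqrtr.
- apply: continuous_sqr; apply: regular_continuous; exact: regular_translates.
- by move=> x; exact: sqr_ge0.
Qed.

(** Change of variables is at hand for non-negative continuous integrands; polarisation expresses an
    inner product through integrals of squares, to which it applies. *)
Lemma ip_polarisation (D : set R) f g : measurable D -> in_L2 D f -> in_L2 D g ->
  ip D f g = (\int[mu]_(x in D) ((1 * f x + 1 * g x) ^+ 2) -
              \int[mu]_(x in D) ((1 * f x + -1 * g x) ^+ 2)) / 4.
Proof.
move=> mD Lf Lg.
have L1 c d : in_L2 D (fun x => c * f x + d * g x).
  by apply: in_L2_add => //; exact: in_L2_scale.
have [_ i1] := (in_L2P _ _).1 (L1 1 1).
have [_ i2] := (in_L2P _ _).1 (L1 1 (-1)).
have Li := in_L2_integrable_mul mD Lf Lg.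
rewrite -RintegralB// /ip.
transitivity ((4 * \int[mu]_(x in D) (f x * g x)) / 4); first by field.
rewrite -RintegralZl//; congr (_ / _); apply: eq_Rintegral => x _; ring.
Qed.

Lemma orthonormal_dilate : Defs.orthonormal setT setT dilate.
Proof.
split=> [k _|k l _ _]; first exact: in_L2_dilate.
have [Lphi ophi'] := ophi.
rewrite -(ophi' k l)// !ip_polarisation//; try exact: in_L2_dilate; try exact: Lphi.
by rewrite !Rintegral_dilate_sqr.
Qed.

Lemma mra_space1_dilate f : mra_space phi 1 f -> in_closed_span setT setT dilate f.
Proof.
move=> [Lf H]; split => // delta /H [s [_ Hs]].
exists [seq (p.1 / Num.sqrt 2, p.2) | p <- s]; split => //.
congr (_ < _)%E : Hs; apply: eq_integral => x _; congr ((_ - _) ^+ 2)%:E.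
rewrite big_map; apply: eq_bigr => p _ /=.
by rewrite /dilate expr1z mulrA divfK// gt_eqF// sqrtr_gt0.
Qed.

(* psi lies in V_1 and has compact support, hence is almost everywhere a finite
   combination of the functions phi(2x - k). *)
Lemma wavelet_regular (K : nat) (psi : R -> R) :
  supported_in (1 - K%:R) K%:R phi ->
  supported_in (1 - K%:R) K%:R psi -> mra_detail phi (translates psi 0) ->
  exists g, regular setT g /\ {ae mu, forall x, psi x = g x}.
Proof.
move=> sphi spsi; rewrite (_ : translates psi 0 = psi); last first.
  by apply/funext => x; rewrite /translates subr0.
move=> [/mra_space1_dilate psiV _].
(* The integers from -3K to 3K - 1. If x and 2x - k both lie in [1 - K, K], then 2 - 3K <= k <= 3K -
   1, so all other coefficients of psi vanish. *)
pose F : seq int := [seq (i%:Z - (3 * K)%:Z) | i <- iota 0 (6 * K)].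
have uF : uniq F by rewrite map_inj_uniq ?iota_uniq// => i j /addIr [].
have F0 (k : int) : k \notin F -> ip setT psi (dilate k) = 0.
  move=> kF; rewrite /ip (_ : (fun x => _) = fun=> 0) ?Rintegral_cst ?mul0r//.
  apply/funext => x; apply/eqP; rewrite mulf_eq0; apply/orP.
  have [xK|/spsi->] := boolP (x \in `[1 - K%:R, K%:R]); last by left.
  right; rewrite mulf_eq0; apply/orP; right; apply/eqP; apply: sphi.
  apply: contra kF; move: xK; rewrite !in_itv/= => /andP[x1 x2] /andP[x3 x4].
  apply/mapP; exists (absz (k + (3 * K)%:Z)%R).
    have k0 : 0 <= k + (3 * K)%:Z.
      by rewrite -(ler_int R) intrD -pmulrn natrM; lra.
    rewrite mem_iota/= add0n -ltz_nat gez0_abs// -(ltr_int R) intrD -!pmulrn !natrM.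
    lra.
  rewrite gez0_abs ?addrK//.
  by rewrite -(ler_int R) intrD -pmulrn natrM; lra.
exists (fun x => \sum_(i <- F) ip setT psi (dilate i) * dilate i x); split.
  by apply: regular_sum => i _; apply: regular_scale; exact: regular_dilate.
have := in_closed_span_finite (measurableT : measurable [set: R]) orthonormal_dilate psiV uF (fun _ _ => I) (fun i _ => F0 i).
by apply: ae_lebesgueS => x; exact.
Qed.

End dilation.

(** * Localisation of the basis functions at scale 2^-j *)

Lemma powR2_half (R : realType) : (2 `^ 2^-1) ^+ 2 = 2 :> R.
Proof. by rewrite -powR_mulrn ?powR_ge0// -powRrM mulVf// powRr1. Qed.

Lemma powR2_halfE (R : realType) (j : nat) : 2 `^ (j%:R / 2) = (2 `^ 2^-1) ^+ j :> R.
Proof. by rewrite -powR_mulrn ?powR_ge0// -powRrM mulrC. Qed.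

Definition localized (R : realType) (C : R) (j k : nat) (u : R -> R) :=
  [/\ forall x, x \in `[0, 1] -> `|u x| <= C * (2 `^ 2^-1) ^+ j,
      forall x y, x \in `[0, 1] -> y \in `[0, 1] ->
        `|u x - u y| <= C * (2 `^ 2^-1) ^+ j * 2 ^+ j * `|x - y| &
      forall x, x \in `[0, 1] -> C < `|2 ^+ j * x - k%:R| -> u x = 0].

Lemma localized_le (R : realType) (C C' : R) j k u :
  C <= C' -> localized C j k u -> localized C' j k u.
Proof.
move=> CC' [u1 u2 u3]; split=> [x x01|x y x01 y01|x x01 Cx].
- by apply: le_trans (u1 _ x01) _; rewrite ler_wpM2r ?exprn_ge0 ?powR_ge0.
- by apply: le_trans (u2 _ _ x01 y01) _; rewrite -!mulrA ler_wpM2r ?mulr_ge0 ?exprn_ge0 ?powR_ge0.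
- by apply: u3 => //; exact: le_lt_trans Cx.
Qed.

Lemma boundary_corrected_localized (R : realType) (N : nat) (g : R -> R) (l r : nat -> R -> R) :
  regular setT g ->
  (forall k, (k < N)%N -> regular (@half_line R) (l k)) ->
  (forall k, (k < N)%N -> regular (@half_line R) (r k)) ->
  exists2 C : R, 0 <= C & forall j k, (k < 2 ^ j)%N ->
    localized C j k (boundary_corrected N g l r j k).
Proof.
move=> [Cg Cg0 gC] /regular_uniform[Cl Cl0 lC] /regular_uniform[Cr Cr0 rC].
have N0 : (0 : R) <= N%:R by [].
exists (Cg + Cl + Cr + N%:R); first by rewrite !addr_ge0.
set C := _ + N%:R.
move=> j k kj.
pose p : R := 2 ^+ j.
have p0 : 0 < p by rewrite exprn_gt0.
have pE : (2 ^ j)%N%:R = p by rewrite natrX.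
have q0 : 0 <= (2 `^ 2^-1) ^+ j :> R by rewrite exprn_ge0// powR_ge0.
(* All three branches have the argument [p * (a * x) + b] with a = 1 or -1. Edge functions are
   centred at an end point of the interval rather than at k 2^-j; in units of 2^-j this moves the
   centre by at most N, whence the summand [N%:R] in the constant. *)
have gen (D : set R) (v : R -> R) (a b C' : R) : `|a| = 1 -> 0 <= C' -> C' + N%:R <= C ->
    (forall x, 0 <= x <= 1 -> `|p * x - k%:R| <= `|p * (a * x) + b| + N%:R) ->
    (forall x, 0 <= x <= 1 -> D (p * (a * x) + b)) -> regular_on D C' v ->
    localized C j k (fun x => (2 `^ 2^-1) ^+ j * v (p * (a * x) + b)).
  move=> a1 C0' C'C near DD [v1 v2 v3]; split.
  - move=> x; rewrite in_itv/= => x01; rewrite normrM ger0_norm// mulrC ler_wpM2r//.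
    by apply: le_trans (v1 _ (DD _ x01)) _; lra.
  - move=> x y; rewrite !in_itv/= => x01 y01; rewrite -mulrBr normrM ger0_norm//.
    rewrite [leRHS](_ : _ = (2 `^ 2^-1) ^+ j * (C * (p * `|x - y|))); last by rewrite /p; ring.
    rewrite ler_wpM2l//; apply: le_trans (v2 _ _ (DD _ x01) (DD _ y01)) _.
    rewrite (_ : _ + b - _ = p * (a * (x - y))); last by ring.
    rewrite !normrM a1 mul1r (gtr0_norm p0) ler_wpM2r ?mulr_ge0 ?(ltW p0)//; lra.
  - move=> x; rewrite in_itv/= => x01 Cx; rewrite v3 ?mulr0//; first exact: DD.
    by have := near _ x01; rewrite -/p in Cx; lra.
have bE x : 2 `^ (j%:R / 2) = (2 `^ 2^-1) ^+ j :> R := powR2_halfE R j.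
rewrite /boundary_corrected pE; under eq_fun do rewrite powR2_halfE.
case: (ltnP k N) => Nk; [|case: (ltnP k (2 ^ j - N)) => kN].
- under eq_fun => x do rewrite -[p * x]addr0 -{1}[x]mul1r.
  apply: (gen (@half_line R) _ 1 0 Cl) => //; rewrite ?normr1 /C//; first by lra.
  + move=> x x01; rewrite mul1r addr0; apply: le_trans (ler_normB _ _) _.
    by rewrite lerD2l ger0_norm// ler_nat ltnW.
  + by move=> x /andP[x0 _]; rewrite /half_line/= mul1r addr0 mulr_ge0// ltW.
  + exact: lC.
- under eq_fun => x do rewrite -{1}[x]mul1r.
  apply: (gen setT _ 1 (- k%:R) Cg) => //; rewrite ?normr1 /C//; first by lra.
  by move=> x x01; rewrite mul1r lerDl.
- have kN' : (2 ^ j - k.+1 < N)%N.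
    rewrite ltn_subLR//; move: kN; rewrite leq_subLR; lia.
  rewrite (_ : (fun x => _) = (fun x => (2 `^ 2^-1) ^+ j * r (2 ^ j - k.+1)%N (p * (-1 * x) + p))); last first.
    by apply/funext => x; congr (_ * r _ _); ring.
  apply: (gen (@half_line R) _ (-1) p Cr) => //; rewrite ?normrN1 /C//; first by lra.
  + move=> x x01; rewrite (_ : p * (-1 * x) + p = - (p * x - p)) ?normrN; last by ring.
    rewrite (_ : p * x - k%:R = (p * x - p) + (p - k%:R)); last by ring.
    apply: le_trans (ler_normD _ _) _; rewrite lerD2l -pE -natrB ?(ltnW kj)// ger0_norm// ler_nat.
    by move: kN; rewrite leq_subLR; lia.
  + move=> x /andP[x0 x1]; rewrite /half_line/= (_ : _ + p = p * (1 - x)); last by ring.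
    by apply: mulr_ge0; [exact: ltW|rewrite subr_ge0].
  + exact: rC.
Qed.

Lemma regular_edge_generator (R : realType) (K N : nat) (phi : R -> R) (k : nat) :
  regular setT phi -> regular (@half_line R) (edge_generator K N phi k).
Proof.
move=> rphi; apply: (@regular_subset _ setT) => //.
apply: regular_sum => n _; apply: regular_scale.
have H : regular setT (fun x => phi (1 * x + (n%:R - N%:R + 1))).
  by apply: (@regular_affine R setT) => //; rewrite normr1.
by apply: regular_ext H => x _; rewrite mul1r !addrA.
Qed.

Lemma regular_edge_scaling (R : realType) (K N : nat) (phi : R -> R) (e : nat -> R -> R) :
  regular setT phi -> is_edge_scaling K N phi e ->
  forall k, (k < N)%N -> regular (@half_line R) (e k).
Proof.
move=> rphi [_ eE] k /eE [c ec].
apply: (@regular_ext _ _ (fun x => \sum_(i < k.+1) c i * edge_generator K N phi (N.-1 - i) x)).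
  by move=> x x0; rewrite ec.
by apply: regular_sum => i _; apply: regular_scale; exact: regular_edge_generator.
Qed.

Lemma regular_edge_wavelet (R : realType) (K N : nat) (e d : nat -> R -> R) :
  (forall k, (k < N)%N -> regular (@half_line R) (e k)) -> is_edge_wavelet K N e d ->
  forall k, (k < N)%N -> regular (@half_line R) (d k).
Proof.
move=> re [_ dE] k /dE [[c dc] _].
apply: (@regular_ext _ _ (fun x => \sum_(i < N) c i * edge_detail N e i x)).
  by move=> x x0; rewrite dc.
apply: regular_sum => i _; apply: regular_scale; rewrite /edge_detail.
apply: regular_add.
  apply: regular_scale; have := @regular_affine R (@half_line R) (@half_line R) 2 0 (e i).
  under eq_fun do rewrite addr0; apply; [by rewrite ger0_norm//; lra| |exact: re].
  by move=> x; rewrite /half_line/= addr0 => x0; rewrite mulr_ge0.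
under eq_fun do rewrite -mulN1r; apply: regular_scale.
apply: regular_sum => m _; apply: regular_scale; exact: re.
Qed.

Lemma ae_lebesgueI (R : realType) (P Q : R -> Prop) :
  {ae @lebesgue_measure R, forall x, P x} -> {ae @lebesgue_measure R, forall x, Q x} ->
  {ae @lebesgue_measure R, forall x, P x /\ Q x}.
Proof.
by move=> p q; apply: (@filterI _ _ (ae_filter_ringOfSetsType lebesgue_measure)).
Qed.

Lemma ae_lebesgue_all (R : realType) (P : R -> Prop) :
  (forall x, P x) -> {ae @lebesgue_measure R, forall x, P x}.
Proof. by move=> p; apply: aeW. Qed.

Lemma ae_eq_integral_EFin (R : realType) (D : set R) (f g : R -> R) :
  measurable D -> measurable_fun D f -> measurable_fun D g ->
  {ae @lebesgue_measure R, forall x, D x -> f x = g x} ->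
  (\int[lebesgue_measure]_(x in D) (f x)%:E = \int[lebesgue_measure]_(x in D) (g x)%:E)%E.
Proof.
move=> mD mf mg fg; apply: (@ae_eq_integral _ _ _ lebesgue_measure D) => //.
- exact/measurable_EFinP.
- exact/measurable_EFinP.
- by move: fg; apply: ae_lebesgueS => x h Dx; rewrite h.
Qed.

Lemma orthonormal_basis_ae (R : realType) (D : set R) (J : eqType) (I : set J)
    (e u : J -> R -> R) : measurable D ->
  (forall i, I i -> measurable_fun D (u i)) ->
  (forall i, I i -> {ae @lebesgue_measure R, forall x, D x -> e i x = u i x}) ->
  orthonormal_basis D I e ->
  orthonormal_basis D I u /\
  forall f i, in_L2 D f -> I i -> ip D f (e i) = ip D f (u i).
Proof.
move=> mD mu eu [[Le oe] spe].
have ipE f i : measurable_fun D f -> I i -> ip D f (e i) = ip D f (u i).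
  move=> mf Ii; rewrite /ip /Rintegral (@ae_eq_integral_EFin _ _ _ (fun x => f x * u i x))//.
  - by apply: measurable_funM => //; case: (Le _ Ii).
  - by apply: measurable_funM => //; exact: mu.
  - by apply: ae_lebesgueS (eu _ Ii) => x h Dx; rewrite h.
split; last by move=> f i [mf _]; exact: ipE.
split; first split.
- move=> i Ii; split; first exact: mu.
  rewrite -(@ae_eq_integral_EFin _ _ (fun x => e i x ^+ 2))//; first by case: (Le _ Ii).
  + by apply: measurable_funX; case: (Le _ Ii).
  + by apply: measurable_funX; exact: mu.
  + by apply: ae_lebesgueS (eu _ Ii) => x h Dx; rewrite h.
- move=> i j Ii Ij; rewrite -oe// -ipE//; last exact: mu.
  by rewrite ipC// [RHS]ipC// ipE//; case: (Le _ Ij).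
move=> f Lf; have [_ H] := spe f Lf; split => // delta /H [s [sI Hs]].
exists s; split => //; apply: le_lt_trans Hs; rewrite le_eqVlt; apply/orP; left; apply/eqP.
have msum (v : J -> R -> R) : (forall i, I i -> measurable_fun D (v i)) ->
    measurable_fun D (fun x => (f x - \sum_(p <- s) p.1 * v p.2 x) ^+ 2).
  move=> mv; apply: measurable_funX; apply: measurable_funB; first by case: Lf.
  elim: s sI => [|p s IH] sI.
    by under eq_fun do rewrite big_nil; exact: measurable_cst.
  under eq_fun do rewrite big_cons.
  apply: measurable_funD.
    by apply: measurable_funM => //; apply: mv; apply: sI; rewrite mem_head.
  by apply: IH => q qs; apply: sI; rewrite in_cons qs orbT.
apply: ae_eq_integral_EFin => //; first exact: msum.
  by apply: msum => i /Le [].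
have : {ae @lebesgue_measure R, forall x, D x -> \sum_(p <- s) p.1 * e p.2 x = \sum_(p <- s) p.1 * u p.2 x}.
  elim: s sI {msum} => [|p s IH] sI.
    by apply: ae_lebesgue_all => x _; rewrite !big_nil.
  have Hp := eu p.2 (sI _ (mem_head _ _)).
  have Hs : {ae @lebesgue_measure R, forall x, D x -> \sum_(p <- s) p.1 * e p.2 x = \sum_(p <- s) p.1 * u p.2 x}.
    by apply: IH => q qs; apply: sI; rewrite in_cons qs orbT.
  apply: ae_lebesgueS (ae_lebesgueI Hp Hs) => x [h1 h2] Dx.
  by rewrite !big_cons h1// h2.
by apply: ae_lebesgueS => x h Dx; rewrite h.
Qed.

Definition index_level (R : realType) (W : wavelet_system R) (i : option nat * nat) : nat :=
  if i.1 is Some j then j else coarsest W.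

Lemma index_bound (R : realType) (W : wavelet_system R) i :
  basis_index W i -> (coarsest W <= index_level W i)%N /\ (i.2 < 2 ^ index_level W i)%N.
Proof. by case: i => [[j|] k]. Qed.

Lemma localized_continuous (R : realType) (C : R) j k u : localized C j k u ->
  {within `[0, 1], continuous u}.
Proof.
move=> [_ u2 _].
pose L := Num.max 1 (C * (2 `^ 2^-1) ^+ j * 2 ^+ j).
have L0 : 0 < L by rewrite lt_max ltr01.
apply/subspace_continuousP => x x01; apply/cvgrPdist_lt => e e0.
apply/nbhs_ballP; exists (e / L) => /=; first by rewrite divr_gt0.
move=> y; rewrite /ball/= => xy y01; apply: le_lt_trans (u2 _ _ x01 y01) _.
apply: (@le_lt_trans _ _ (L * `|x - y|)); first by rewrite ler_wpM2r// le_max lexx orbT.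
by rewrite mulrC -ltr_pdivlMr.
Qed.

(** The basis that the estimator samples. Only the mother wavelet is exchanged, for its Lipschitz
    version; the father and edge functions are already regular. The exchange happens on null sets,
    so the coefficients, and with them the function classes, are unchanged. *)
Lemma cdv_regular_basis (R : realType) (W : wavelet_system R) :
  cdv_wavelet_basis W ->
  exists (C : R) (u : option nat * nat -> R -> R), [/\ 0 <= C,
    forall i, basis_index W i -> localized C (index_level W i) i.2 (u i),
    orthonormal_basis `[0, 1] (basis_index W) u,
    forall f k, in_L2 `[0, 1] f -> (k < 2 ^ coarsest W)%N ->
      alpha W f k = ip `[0, 1] f (u (None, k)) &
    forall f j k, in_L2 `[0, 1] f -> (coarsest W <= j)%N -> (k < 2 ^ j)%N ->
      beta W f j k = ip `[0, 1] f (u (Some j, k))].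
Proof.
set K := supp_bound W; set N := moments W.
move=> [[[scal wav] [sphi spsi] _ C2 _] [escl ewl] [escr ewr] _ basis].
have rphi := C2_regular sphi C2.
have rphi' : regular setT (fun x => father W (1 - x)).
  have H : regular setT (fun x => father W (-1 * x + 1)).
    by apply: (@regular_affine R setT) => //; rewrite normrN1.
  by apply: regular_ext H => x _; congr (father W _); ring.
have rl := regular_edge_scaling rphi escl; have rr := regular_edge_scaling rphi' escr.
have rdl := regular_edge_wavelet rl ewl; have rdr := regular_edge_wavelet rr ewr.
have [ophi _ _ _] := scal; have [_ wdet _] := wav.
have [g [rg psig]] := wavelet_regular rphi ophi sphi spsi (wdet 0).
have [C1 C10 loc1] := boundary_corrected_localized rphi rl rr.
have [C2' C20 loc2] := boundary_corrected_localized rg rdl rdr.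
pose u (i : option nat * nat) : R -> R := if i.1 is Some j
  then boundary_corrected N g (mother_left W) (mother_right W) j i.2 else phi_ W i.2.
have loc i : basis_index W i -> localized (C1 + C2') (index_level W i) i.2 (u i).
  move=> /index_bound [_]; case: i => [[j|] k] /= kj.
    by apply: localized_le (loc2 _ _ kj); rewrite lerDr.
  by apply: localized_le (loc1 _ _ kj); rewrite lerDl.
have mu i : basis_index W i -> measurable_fun (`[0, 1]%classic : set R) (u i).
  move=> /loc /localized_continuous; exact: subspace_continuous_measurable_fun.
have ae_u i : basis_index W i -> {ae @lebesgue_measure R, forall x,
    (`[0, 1]%classic : set R) x -> basis_function W i x = u i x}.
  move=> Ii; case: i Ii => [[j|] k] Ii; last exact: ae_lebesgue_all.
  have p0 : 0 < (2 ^ j)%N%:R :> R by rewrite ltr0n expn_gt0.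
  have := ae_lebesgue_affine (- k%:R) p0 psig; apply: ae_lebesgueS => x h _.
  by rewrite /basis_function /u /= /psi_ /boundary_corrected h.
have [obu ipu] := orthonormal_basis_ae (measurable_itv _) mu ae_u basis.
exists (C1 + C2'), u; split => //.
- exact: addr_ge0.
- by move=> f j k Lf j0 kj; exact: (ipu f (Some j, k)).
Qed.

(** * Wavelet expansions *)

(** At most 2C + 1 integers lie within C of z, so boundedly many wavelets of one level overlap at a
    point. *)
Lemma sum_near_le (R : realType) (F : nat -> R) (z C A : R) (n : nat) :
  0 <= C -> 0 <= A -> (forall k, (k < n)%N -> 0 <= F k <= A) ->
  (forall k, (k < n)%N -> C < `|z - k%:R| -> F k = 0) ->
  \sum_(k < n) F k <= (2 * C + 1) * A.
Proof.
move=> C0 A0 FA F0.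
(* The second bound, which counts the integers of [z - C, n), is what the induction propagates; the
   first follows from it at every n that itself lies within C of z. *)
suff [] : \sum_(k < n) F k <= (2 * C + 1) * A /\
    \sum_(k < n) F k <= Num.max 0 (n%:R - z + C) * A by [].
elim: n FA F0 => [|n IH] FA F0.
  by rewrite big_ord0 !mulr_ge0// ?le_max ?lexx//; lra.
have [IH1 IH2] : \sum_(k < n) F k <= (2 * C + 1) * A /\
    \sum_(k < n) F k <= Num.max 0 (n%:R - z + C) * A.
  by apply: IH => k kn; [apply: FA|apply: F0]; rewrite ltnS ltnW.
rewrite big_ord_recr/=; have [Cz|zC] := ltP C `|z - n%:R|.
  rewrite (F0 n)// addr0; split => //; apply: le_trans IH2 _.
  rewrite ler_wpM2r// -natr1 ge_max !le_max lexx/=; apply/orP; right; lra.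
have /andP[_ Fn] := FA n (ltnSn n).
move: zC; rewrite ler_norml => /andP[z1 z2].
have E : Num.max 0 (n%:R - z + C) = n%:R - z + C by apply: max_r; lra.
rewrite E in IH2.
have H : \sum_(k < n) F k + F n <= (n%:R - z + C + 1) * A.
  by rewrite mulrDl mul1r lerD.
split; apply: le_trans H _; rewrite ler_wpM2r//; first lra.
by rewrite le_max -natr1; apply/orP; right; lra.
Qed.

Definition lipschitz01 (R : realType) (g : R -> R) :=
  exists2 L : R, 0 <= L & forall x y, x \in `[0, 1] -> y \in `[0, 1] ->
    `|g x - g y| <= L * `|x - y|.

Lemma lipschitz01_add (R : realType) (f g : R -> R) :
  lipschitz01 f -> lipschitz01 g -> lipschitz01 (fun x => f x + g x).
Proof.
move=> [L L0 fL] [L' L0' gL]; exists (L + L'); first exact: addr_ge0.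
move=> x y x01 y01; rewrite opprD addrACA mulrDl.
by apply: le_trans (ler_normD _ _) _; rewrite lerD ?fL ?gL.
Qed.

Lemma lipschitz01_scale (R : realType) (k : R) (f : R -> R) :
  lipschitz01 f -> lipschitz01 (fun x => k * f x).
Proof.
move=> [L L0 fL]; exists (`|k| * L); first exact: mulr_ge0.
by move=> x y x01 y01; rewrite -mulrBr normrM -mulrA ler_wpM2l ?fL.
Qed.

Lemma lipschitz01_cst (R : realType) (k : R) : lipschitz01 (fun=> k).
Proof. by exists 0 => // x y _ _; rewrite subrr normr0 mul0r. Qed.

Lemma lipschitz01_sum (R : realType) (I : eqType) (s : seq I) (f : I -> R -> R) :
  (forall i, i \in s -> lipschitz01 (f i)) -> lipschitz01 (fun x => \sum_(i <- s) f i x).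
Proof.
elim: s => [|a s IH] H.
  by under eq_fun do rewrite big_nil; exact: lipschitz01_cst.
under eq_fun do rewrite big_cons.
apply: lipschitz01_add; first by apply: H; rewrite mem_head.
by apply: IH => i si; apply: H; rewrite in_cons si orbT.
Qed.

Lemma lipschitz01_continuous (R : realType) (g : R -> R) :
  lipschitz01 g -> {within `[0, 1], continuous g}.
Proof.
move=> [L0 L00 gL]; pose L := Num.max 1 L0.
have Lp : 0 < L by rewrite lt_max ltr01.
apply/subspace_continuousP => x x01; apply/cvgrPdist_lt => e e0.
apply/nbhs_ballP; exists (e / L) => /=; first by rewrite divr_gt0.
move=> y; rewrite /ball/= => xy y01; apply: le_lt_trans (gL _ _ x01 y01) _.
apply: (@le_lt_trans _ _ (L * `|x - y|)); first by rewrite ler_wpM2r// le_max lexx orbT.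
by rewrite mulrC -ltr_pdivlMr.
Qed.

Lemma localized_lipschitz01 (R : realType) (C : R) j k u : 0 <= C ->
  localized C j k u -> lipschitz01 u.
Proof.
move=> C0 [_ u2 _]; exists (C * (2 `^ 2^-1) ^+ j * 2 ^+ j) => //.
by rewrite !mulr_ge0// exprn_ge0// powR_ge0.
Qed.

Section indices.
Context (R : realType) (W : wavelet_system R).
Local Notation j0 := (coarsest W).

Definition base_indices : seq (option nat * nat) :=
  [seq (None, k) | k <- iota 0 (2 ^ j0)].

Definition level_indices (l : nat) : seq (option nat * nat) :=
  [seq (Some l, k) | k <- iota 0 (2 ^ l)].

Definition indices_upto (J : nat) : seq (option nat * nat) :=
  base_indices ++ flatten [seq level_indices l | l <- index_iota j0 J.+1].

Lemma mem_base_indices i : (i \in base_indices) = (i.1 == None) && (i.2 < 2 ^ j0)%N.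
Proof.
apply/mapP/andP => [[k]|[]]; first by rewrite mem_iota => kn ->.
by case: i => [[|] k] //= _ kn; exists k => //; rewrite mem_iota.
Qed.

Lemma mem_level_indices l i : (i \in level_indices l) = (i.1 == Some l) && (i.2 < 2 ^ l)%N.
Proof.
apply/mapP/andP => [[k]|[]]; first by rewrite mem_iota => kn ->.
by case: i => [a k] /= /eqP -> kn; exists k => //; rewrite mem_iota.
Qed.

Lemma mem_indices_upto J i : i \in indices_upto J <->
  basis_index W i /\ (if i.1 is Some l then l <= J else true)%N.
Proof.
rewrite mem_cat mem_base_indices; split.
  case/orP => [/andP[/eqP i1 i2]|/flatten_mapP[l]].
    by rewrite /basis_index/= i1.
  rewrite mem_index_iota ltnS => /andP[jl lJ]; rewrite mem_level_indices => /andP[/eqP i1 i2].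
  by rewrite /basis_index/= i1.
case: i => [[l|] k] [Ii lJ]; last by rewrite Ii.
move: Ii; rewrite /basis_index/= => -[jl kl].
by apply/flatten_mapP; exists l; rewrite ?mem_index_iota ?ltnS ?jl// mem_level_indices eqxx.
Qed.

Lemma uniq_level_indices l : uniq (level_indices l).
Proof. by rewrite map_inj_uniq ?iota_uniq// => k k' []. Qed.

Lemma uniq_indices_upto J : uniq (indices_upto J).
Proof.
rewrite cat_uniq map_inj_uniq ?iota_uniq /=; last by move=> k k' [].
apply/andP; split.
  apply/hasPn => i /flatten_mapP[l _]; rewrite mem_level_indices mem_base_indices.
  by move=> /andP[/eqP -> _].
have : uniq (index_iota j0 J.+1) by exact: iota_uniq.
elim: (index_iota _ _) => //= l s IH /andP[ls us].
rewrite cat_uniq uniq_level_indices IH// andbT; apply/hasPn => i /flatten_mapP[l' l's].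
rewrite !mem_level_indices => /andP[/eqP -> _]; apply/negP => /andP[/eqP [E] _].
by rewrite -E l's in ls.
Qed.

Lemma sum_indices_upto (F : option nat * nat -> R) J :
  \sum_(i <- indices_upto J) F i =
  \sum_(i <- base_indices) F i + \sum_(j0 <= l < J.+1) \sum_(i <- level_indices l) F i.
Proof. by rewrite big_cat/= big_flatten/= big_map. Qed.

Variables (C : R) (u : option nat * nat -> R -> R).
Hypothesis C0 : 0 <= C.
Hypothesis locu : forall i, basis_index W i -> localized C (index_level W i) i.2 (u i).
Local Notation q := (2 `^ 2^-1 : R).

Lemma sum_level_le (c : option nat * nat -> R) (A : R) l x : 0 <= A -> (j0 <= l)%N ->
  (forall i, i \in level_indices l -> `|c i| <= A) -> x \in `[0, 1] ->
  `|\sum_(i <- level_indices l) c i * u i x| <= A * ((2 * C + 1) * C) * q ^+ l.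
Proof.
move=> A0 jl cA x01; apply: le_trans (ler_norm_sum _ _ _) _.
rewrite /level_indices big_map (_ : iota 0 _ = index_iota 0 (2 ^ l)%N) ?big_mkord; last by rewrite /index_iota subn0.
have q0 : 0 <= q ^+ l by rewrite exprn_ge0// powR_ge0.
have -> : A * ((2 * C + 1) * C) * q ^+ l = (2 * C + 1) * (A * (C * q ^+ l)) by ring.
apply: (@sum_near_le _ (fun k => `|c (Some l, k) * u (Some l, k) x|) (2 ^+ l * x)) => //.
- by rewrite !mulr_ge0.
- move=> k kl; rewrite normr_ge0 normrM ler_pM//.
    by apply: cA; rewrite mem_level_indices eqxx.
  by have [u1 _ _] := locu (i := (Some l, k)) (conj jl kl); exact: u1.
- move=> k kl near; have [_ _ u3] := locu (i := (Some l, k)) (conj jl kl).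
  by rewrite u3// mulr0 normr0.
Qed.

Lemma sum_base_le (c : option nat * nat -> R) (A : R) x : 0 <= A ->
  (forall i, i \in base_indices -> `|c i| <= A) -> x \in `[0, 1] ->
  `|\sum_(i <- base_indices) c i * u i x| <= A * ((2 * C + 1) * C) * q ^+ j0.
Proof.
move=> A0 cA x01; apply: le_trans (ler_norm_sum _ _ _) _.
rewrite /base_indices big_map (_ : iota 0 _ = index_iota 0 (2 ^ j0)%N) ?big_mkord; last by rewrite /index_iota subn0.
have q0 : 0 <= q ^+ j0 by rewrite exprn_ge0// powR_ge0.
have -> : A * ((2 * C + 1) * C) * q ^+ j0 = (2 * C + 1) * (A * (C * q ^+ j0)) by ring.
apply: (@sum_near_le _ (fun k => `|c (None, k) * u (None, k) x|) (2 ^+ j0 * x)) => //.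
- by rewrite !mulr_ge0.
- move=> k kl; rewrite normr_ge0 normrM ler_pM//.
    by apply: cA; rewrite mem_base_indices eqxx.
  by have [u1 _ _] := locu (i := (None, k)) kl; exact: u1.
- move=> k kl near; have [_ _ u3] := locu (i := (None, k)) kl.
  by rewrite u3// mulr0 normr0.
Qed.

Lemma lipschitz01_partial (c : option nat * nat -> R) J :
  lipschitz01 (fun x => \sum_(i <- indices_upto J) c i * u i x).
Proof.
apply: lipschitz01_sum => i /mem_indices_upto [Ii _]; apply: lipschitz01_scale.
exact: localized_lipschitz01 (locu Ii).
Qed.

End indices.

Lemma geometric_tail (R : realType) (a : nat -> R) (B r : R) :
  0 <= r -> r < 1 -> (forall l, `|a l| <= B * r ^+ l) ->
  forall n, `|limn (series a) - series a n| <= B * r ^+ n / (1 - r).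
Proof.
move=> r0 r1 aB n.
have B0 : 0 <= B by have := aB 0%N; rewrite expr0 mulr1; exact: le_trans.
have ca : cvgn (series a).
  apply: normed_cvg.
  apply: (@series_le_cvg _ _ (geometric B r)) => [k|k|k|].
  - exact: normr_ge0.
  - by rewrite /geometric/= mulr_ge0// exprn_ge0.
  - exact: aB.
  - by apply: is_cvg_geometric_series; rewrite ger0_norm.
have tail m : `|series a (n + m)%N - series a n| <= B * r ^+ n / (1 - r) * (1 - r ^+ m).
  elim: m => [|m IH]; first by rewrite addn0 !subrr mulr0 normr0.
  have -> : series a (n + m.+1)%N - series a n = (series a (n + m)%N - series a n) + a (n + m)%N.
    by rewrite addnS seriesSr; ring.
  apply: le_trans (ler_normD _ _) _; apply: le_trans (lerD IH (aB _)) _.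
  rewrite exprS exprD; rewrite le_eqVlt; apply/orP; left; apply/eqP; field; lra.
have cn : `|series a m - series a n| @[m --> \oo] --> `|limn (series a) - series a n|.
  by apply: cvg_norm; apply: cvgB => //; exact: cvg_cst.
rewrite -(cvg_lim _ cn)//; apply: limr_le; first by apply: cvgP; exact: cn.
near=> m; have nm : (n <= m)%N by near: m; exact: nbhs_infty_ge.
rewrite -(subnKC nm); apply: le_trans (tail _) _.
rewrite ler_piMr// ?gerBl ?exprn_ge0// divr_ge0 ?mulr_ge0 ?exprn_ge0//; lra.
Unshelve. all: by end_near. Qed.

Lemma uniform_limit01 (R : realType) (S : nat -> R -> R) (g : R -> R) :
  (forall J, lipschitz01 (S J)) ->
  (forall e : R, 0 < e -> exists J, forall x, x \in `[0, 1] -> `|g x - S J x| <= e) ->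
  {within `[0, 1], continuous g}.
Proof.
move=> SL H; apply/subspace_continuousP => x x01; apply/cvgrPdist_le => e e0.
have [J HJ] := H (e / 3) (divr_gt0 e0 (ltr0Sn _ 2)).
have := lipschitz01_continuous (SL J) => /subspace_continuousP /(_ x x01).
move=> /cvgrPdist_le /(_ (e / 3) (divr_gt0 e0 (ltr0Sn _ 2))).
rewrite !near_withinE; apply: filter_app; near=> y => + y01 => /(_ y01) h3.
rewrite /from_subspace in h3 *.
have -> : g x - g y = (g x - S J x) + (S J x - S J y) + (S J y - g y) by ring.
have h1 := HJ _ x01; have h2 := HJ _ y01; rewrite distrC in h2.
by rewrite (le_trans (ler_normD _ _))// (le_trans (lerD (ler_normD _ _) (lexx _)))//; lra.
Unshelve. all: by end_near. Qed.

Section expansion.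
Context (R : realType) (W : wavelet_system R).
Local Notation j0 := (coarsest W).
Local Notation q := (2 `^ 2^-1 : R).
Local Notation I01 := (`[0, 1]%classic : set R).
Variables (C : R) (u : option nat * nat -> R -> R).
Hypothesis C0 : 0 <= C.
Hypothesis locu : forall i, basis_index W i -> localized C (index_level W i) i.2 (u i).
Hypothesis basis_u : orthonormal_basis I01 (basis_index W) u.
Let D := (2 * C + 1) * C.

Variables (M r : R) (f : R -> R).
Hypothesis M0 : 0 <= M.
Hypothesis r01 : 0 <= r < 1.
Hypothesis Lf : in_L2 I01 f.
Local Notation c i := (ip I01 f (u i)).
Hypothesis c_base : forall k, (k < 2 ^ j0)%N -> `|c (None, k)| <= M.
Hypothesis c_level : forall l k, (j0 <= l)%N -> (k < 2 ^ l)%N ->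
  `|c (Some l, k)| * q ^+ l <= M * r ^+ l.

(** Overlap bounds the sum over level l by M D r^l, so the expansion converges uniformly to a
    continuous g. It is a version of f because the integral of (f - g)^2 is at most 2 (f - S_J)^2
    integrated plus 2 sup (g - S_J)^2, for every partial sum S_J. It is applied with r = 2^(-s). *)
Lemma wavelet_expansion : exists g : R -> R, [/\
  {within `[0, 1], continuous g},
  {ae @lebesgue_measure R, forall x, x \in `[0, 1] -> g x = f x},
  forall J x, x \in `[0, 1] ->
    `|g x - \sum_(i <- indices_upto W J) c i * u i x| <= M * D / (1 - r) * r ^+ J &
  forall x, x \in `[0, 1] -> `|g x| <= M * D * (q ^+ j0 + (1 - r)^-1)].
Proof.
case/andP: r01 => r0 r1.
have q0 : 0 < q by rewrite powR_gt0.
have D0 : 0 <= D by rewrite /D mulr_ge0// addr_ge0// mulr_ge0.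
have B0 : 0 <= M * D / (1 - r) by rewrite divr_ge0 ?subr_ge0 ?(ltW r1)// mulr_ge0.
pose gl x l := if (j0 <= l)%N then \sum_(i <- level_indices l) c i * u i x else 0.
have glB x : x \in `[0, 1] -> forall l, `|gl x l| <= M * D * r ^+ l.
  move=> x01 l; rewrite /gl; case: ifPn => [jl|_]; last first.
    by rewrite normr0 mulr_ge0 ?exprn_ge0// mulr_ge0.
  apply: le_trans (sum_level_le C0 locu (c := fun i => c i) (A := M * r ^+ l / q ^+ l) _ jl _ x01) _.
  - by rewrite divr_ge0 ?mulr_ge0 ?exprn_ge0 ?(ltW q0).
  - move=> [a k]; rewrite mem_level_indices => /andP[/= /eqP -> kl].
    by rewrite ler_pdivlMr ?exprn_gt0// c_level.
  - rewrite -/D; rewrite le_eqVlt; apply/orP; left; apply/eqP; field.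
    by rewrite expf_neq0// gt_eqF.
pose g x := \sum_(i <- base_indices W) c i * u i x + limn (series (gl x)).
have SE J x : \sum_(i <- indices_upto W J) c i * u i x =
    \sum_(i <- base_indices W) c i * u i x + series (gl x) J.+1.
  rewrite sum_indices_upto; congr (_ + _).
  rewrite /series/=; case: (leqP j0 J.+1) => jJ.
    have z : \sum_(0 <= i < j0) gl x i = 0.
      rewrite big_nat_cond big1// => l /andP[/andP[_ lj] _]; rewrite /gl; case: ifPn => // jl.
      by rewrite ltnNge jl in lj.
    rewrite [in RHS](@big_cat_nat _ _ _ j0)//= z add0r.
    by rewrite big_nat_cond [RHS]big_nat_cond; apply: eq_bigr => l /andP[/andP[jl _] _]; rewrite /gl jl.
  rewrite big_geq ?(ltnW jJ)// big_nat_cond big1// => l /andP[/andP[_ lj] _].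
  by rewrite /gl; case: ifPn => // jl; have := leq_trans lj (ltnW jJ); rewrite ltnNge jl.
have tail J x : x \in `[0, 1] ->
    `|g x - \sum_(i <- indices_upto W J) c i * u i x| <= M * D / (1 - r) * r ^+ J.
  move=> x01; rewrite SE /g opprD addrACA subrr add0r.
  apply: le_trans (geometric_tail r0 r1 (glB _ x01) _) _.
  rewrite mulrAC ler_wpM2l//.
  by rewrite exprS ler_piMl ?exprn_ge0// ltW.
have contg : {within `[0, 1], continuous g}.
  apply: (uniform_limit01 (S := fun J x => \sum_(i <- indices_upto W J) c i * u i x)).
    by move=> J; exact: lipschitz01_partial C0 locu (fun i => c i) J.
  move=> e e0; set B := M * D / (1 - r) in B0.
  have : (r ^+ J @[J --> \oo] --> (0 : R)) by apply: cvg_expr; rewrite ger0_norm.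
  move=> /cvgrPdist_le /(_ (e / (B + 1)) _) [|J _ HJ]; first by rewrite divr_gt0//; lra.
  exists J => x x01; apply: le_trans (tail J x x01) _; rewrite -/B.
  have := HJ J (leqnn _); rewrite /= sub0r normrN ger0_norm ?exprn_ge0// => h.
  apply: (@le_trans _ _ ((B + 1) * r ^+ J)); first by rewrite ler_wpM2r ?exprn_ge0//; lra.
  by rewrite mulrC -ler_pdivlMr//; lra.
have mg : measurable_fun I01 g by exact: subspace_continuous_measurable_fun.
have mI : measurable I01 by exact: measurable_itv.
have muI : (lebesgue_measure I01 < +oo)%E by rewrite lebesgue_measure_itv/= lte_fin ltr01 ltry.
have gB x : x \in `[0, 1] -> `|g x| <= M * D * (q ^+ j0 + (1 - r)^-1).
  move=> x01; rewrite /g mulrDr; apply: le_trans (ler_normD _ _) _; apply: lerD.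
    rewrite -[M * D * _]/(M * _ * _).
    apply: (sum_base_le C0 locu (c := fun i => c i)) => // -[a k].
    by rewrite mem_base_indices => /andP[/= /eqP -> kl]; exact: c_base.
  have := geometric_tail r0 r1 (glB _ x01) 0.
  by rewrite /series/= big_geq// subr0 expr0 mulr1.
have Lg : in_L2 I01 g.
  apply/in_L2P; split => //.
  apply: (integrable_bounded (k := (M * D * (q ^+ j0 + (1 - r)^-1)) ^+ 2)) => //.
    exact: measurable_funX.
  move=> x x01; rewrite normrX lerXn2r ?nnegrE ?gB//.
  by apply: le_trans (gB _ x01).
exists g; split => //.
have [[Lu ou] spu] := basis_u.
have Lfg := in_L2_sub mI Lf Lg.
have : {ae @lebesgue_measure R, forall x, I01 x -> f x - g x = 0}.
  apply: (Rintegral_sqr_eq0_ae mI Lfg).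
  apply/eqP; rewrite eq_le [X in _ && X]Rintegral_ge0 ?andbT; last by move=> x _; exact: sqr_ge0.
  apply/ler_addgt0Pl => e e0; rewrite addr0.
  have [_ /(_ (e / 4) (divr_gt0 e0 (ltr0Sn _ 3)))[s [sI Hs]]] := spu f Lf.
  have Ls : in_L2 I01 (fun x => \sum_(p <- s) p.1 * u p.2 x).
    by apply: in_L2_sum => // p /sI Ip; apply: in_L2_scale => //; exact: Lu.
  rewrite (Rintegral_lt mI _ (in_L2_sub mI Lf Ls)) in Hs.
  (* From level [lev] on, the partial sum contains every index of the approximant [s]; being a
     projection, it is then at least as close to f as the approximant. *)
  pose lev := \max_(p <- s) index_level W p.2.
  set B := M * D / (1 - r) in B0 *.
  have [J levJ BJ] : exists2 J, (lev <= J)%N & (B * r ^+ J) ^+ 2 <= e / 4.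
    have : (r ^+ J @[J --> \oo] --> (0 : R)) by apply: cvg_expr; rewrite ger0_norm.
    move=> /cvgrPdist_le /(_ (Num.min 1 (e / 4) / (B + 1)) _) [|J _ HJ].
      rewrite divr_gt0//; last lra.
      by rewrite lt_min ltr01/= divr_gt0.
    exists (maxn lev J); first exact: leq_maxl.
    have := HJ (maxn lev J) (leq_maxr _ _); rewrite /= sub0r normrN ger0_norm ?exprn_ge0//.
    set t := r ^+ _; have t0 : 0 <= t by rewrite exprn_ge0.
    rewrite ler_pdivlMr; last lra.
    rewrite le_min => /andP[h1 h2].
    have Bt0 : 0 <= B * t by rewrite mulr_ge0.
    have Bt : B * t <= t * (B + 1) by rewrite mulrDr mulr1 mulrC lerDl.
    apply: (@le_trans _ _ (1 * (B * t))); last by lra.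
    by rewrite expr2 ler_wpM2r//; lra.
  have LSJ : in_L2 I01 (fun x => \sum_(i <- indices_upto W J) c i * u i x).
    by apply: in_L2_sum => // i /mem_indices_upto[Ii _]; apply: in_L2_scale => //; exact: Lu.
  have H := best_approximation mI (conj Lu ou) Lf (uniq_indices_upto W J) (s := s).
  have {}H := le_lt_trans (H _ _) Hs.
  have {}H : \int[lebesgue_measure]_(x in I01) ((f x - \sum_(i <- indices_upto W J) c i * u i x) ^+ 2) < e / 4.
    apply: H.
    - by move=> i /mem_indices_upto[].
    - move=> p ps; apply/mem_indices_upto; split; first exact: sI.
      have : (index_level W p.2 <= lev)%N by apply: leq_bigmax_seq.
    by rewrite /index_level; case: p.2.1 => // l /leq_trans; exact.
  have [_ i1] := (in_L2P _ _).1 (in_L2_sub mI Lf LSJ).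
  have [_ i2] := (in_L2P _ _).1 Lfg.
  have ic : lebesgue_measure.-integrable I01 (EFin \o cst ((B * r ^+ J) ^+ 2)).
    by apply: (integrable_bounded (k := (B * r ^+ J) ^+ 2)) => // x _; rewrite ger0_norm ?sqr_ge0.
  have i3 := integrable_addr mI i1 ic.
  apply: (@le_trans _ _ (\int[lebesgue_measure]_(x in I01)
     (2 * ((f x - \sum_(i <- indices_upto W J) c i * u i x) ^+ 2 + cst ((B * r ^+ J) ^+ 2) x)))).
    apply: le_Rintegral => //; first exact: integrable_scaler.
    move=> x x01; set S := \sum_(i <- _) _.
    have h : (g x - S) ^+ 2 <= (B * r ^+ J) ^+ 2.
      have h0 : `|g x - S| <= B * r ^+ J by exact: tail.
      by rewrite -real_normK ?num_real// lerXn2r ?nnegrE// (le_trans _ h0).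
    have -> : f x - g x = (f x - S) - (g x - S) by ring.
    move: h; move: (f x - S) (g x - S) => a b h.
    by have := sqr_ge0 (a + b); rewrite /cst sqrrB sqrrD; lra.
  have mu1 : fine (lebesgue_measure I01) = 1.
    by rewrite lebesgue_measure_itv/= lte_fin ltr01 /= subr0.
  by rewrite RintegralZl// RintegralD// Rintegral_cst//= mu1 mulr1; lra.
by apply: ae_lebesgueS => x h x01; apply/eqP; rewrite eq_sym -subr_eq0 h.
Qed.

End expansion.

(** * Coefficients of self-similar functions *)

Section class_coefficients.
Context (R : realType) (W : wavelet_system R).
Hypothesis hW : cdv_wavelet_basis W.
Local Notation j0 := (coarsest W).
Local Notation I01 := (`[0, 1]%classic : set R).

Lemma powR_level (s : R) (l : nat) : 2 `^ (l%:R * (s + 2^-1)) = (2 `^ (s + 2^-1)) ^+ l :> R.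
Proof. by rewrite -powR_mulrn ?powR_ge0// -powRrM mulrC. Qed.

Lemma Cs_ball_alpha s M f k : Cs_ball W s M f -> (k < 2 ^ j0)%N -> `|alpha W f k| <= M.
Proof.
move=> [_ H] kj; rewrite -lee_fin; apply: le_trans H; rewrite /Cs_norm le_max.
by apply/orP; left; apply: ereal_sup_ubound; exists k.
Qed.

Lemma Cs_ball_beta s M f l k : Cs_ball W s M f -> (j0 <= l)%N -> (k < 2 ^ l)%N ->
  (2 `^ (s + 2^-1)) ^+ l * `|beta W f l k| <= M.
Proof.
move=> [_ H] jl kl; rewrite -lee_fin; apply: le_trans H; rewrite /Cs_norm le_max.
by apply/orP; right; apply: ereal_sup_ubound; exists (l, k) => //=; rewrite powR_level.
Qed.

Definition block_indices (i j : nat) : seq (option nat * nat) :=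
  (if i == j0 then base_indices W else [::]) ++
  flatten [seq level_indices l | l <- index_iota i j.+1].

Lemma mem_block_indices i j a : (j0 <= i)%N -> a \in block_indices i j ->
  basis_index W a /\ (if a.1 is Some l then (i <= l <= j)%N else i = j0).
Proof.
move=> ji; rewrite mem_cat => /orP[|/flatten_mapP[l]].
  case: eqP => // ->; rewrite mem_base_indices => /andP[/eqP a1 a2].
  by rewrite /basis_index/= a1.
rewrite mem_index_iota ltnS => /andP[il lj]; rewrite mem_level_indices => /andP[/eqP a1 a2].
by rewrite /basis_index/= a1 (leq_trans ji il) il lj.
Qed.

Lemma uniq_block_indices i j : uniq (block_indices i j).
Proof.
rewrite cat_uniq; apply/and3P; split.
- case: ifP => // _; rewrite map_inj_uniq ?iota_uniq//; by move=> k k' [].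
- apply/hasPn => a /flatten_mapP[l _]; rewrite mem_level_indices.
  by case: ifP => // _; rewrite mem_base_indices => /andP[/eqP -> _].
- have : uniq (index_iota i j.+1) by exact: iota_uniq.
  elim: (index_iota _ _) => //= l s IH /andP[ls us].
  rewrite cat_uniq uniq_level_indices IH// andbT; apply/hasPn => a /flatten_mapP[l' l's].
  rewrite !mem_level_indices => /andP[/eqP -> _]; apply/negP => /andP[/eqP [E] _].
  by rewrite -E l's in ls.
Qed.

Lemma wavelet_blockE f i j :
  wavelet_block W f i j = fun x => \sum_(a <- block_indices i j)
    ip I01 f (basis_function W a) * basis_function W a x.
Proof.
apply/funext => x; rewrite /wavelet_block big_cat/=; congr (_ + _).
  case: ifP => _; last by rewrite big_nil.
  rewrite /base_indices big_map (_ : iota 0 _ = index_iota 0 (2 ^ j0)%N) ?big_mkord//.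
  by rewrite /index_iota subn0.
rewrite big_flatten/= big_map; apply: eq_bigr => l _.
rewrite /level_indices big_map (_ : iota 0 _ = index_iota 0 (2 ^ l)%N) ?big_mkord//.
by rewrite /index_iota subn0.
Qed.

Lemma block_coefficient f i j a : (j0 <= i)%N -> in_L2 I01 f -> basis_index W a ->
  ip I01 (wavelet_block W f i j) (basis_function W a) =
  if a \in block_indices i j then ip I01 f (basis_function W a) else 0.
Proof.
move=> ji Lf Ia; case: hW => _ _ _ _ [ob _]; rewrite wavelet_blockE.
apply: (orthonormal_ip_sum (measurable_itv _) _ ob) => //; first exact: uniq_block_indices.
by move=> b /(mem_block_indices ji) [].
Qed.

(* Passing from M to M / 2 yields a witness without discussing whether the
   supremum defining the norm is attained. *)
Lemma block_norm_witness (s M : R) f (i j : nat) : 0 < M -> (j0 <= i)%N -> in_L2 I01 f ->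
  (M%:E <= Cs_norm W s (wavelet_block W f i j))%E ->
  (i = j0 /\ exists2 k, (k < 2 ^ j0)%N & M / 2 < `|alpha W f k|) \/
  (exists l k, [/\ (i <= l <= j)%N, (k < 2 ^ l)%N &
     M / 2 < (2 `^ (s + 2^-1)) ^+ l * `|beta W f l k|]).
Proof.
move=> M0 ji Lf; have M2 : ((M / 2)%:E < M%:E)%E by rewrite lte_fin; lra.
have M20 : 0 < M / 2 by lra.
rewrite /Cs_norm le_max => /orP[|] /(lt_le_trans M2) /ereal_sup_gt [y].
  move=> [k kj <-]; rewrite lte_fin => h; left.
  have := block_coefficient (a := (None, k)) j ji Lf kj.
  rewrite -[LHS]/(alpha W _ k) => E; move: h; rewrite E; case: ifPn => [/(mem_block_indices ji)[_ /= ->]|_].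
    by move=> h; split => //; exists k.
  by rewrite normr0 => h; move: (lt_trans M20 h); rewrite ltxx.
move=> [[l k] /= [jl kl] <-]; rewrite lte_fin powR_level => h; right.
have := block_coefficient (a := (Some l, k)) j ji Lf (conj jl kl).
rewrite -[LHS]/(beta W _ l k) => E; move: h; rewrite E; case: ifPn => [/(mem_block_indices ji)[_ /= ilj]|_].
  by move=> h; exists l, k.
by rewrite normr0 mulr0 => h; move: (lt_trans M20 h); rewrite ltxx.
Qed.

End class_coefficients.

(** * Discretised stochastic integrals *)

Definition grid (R : realType) (m i : nat) : R := i%:R / 2 ^+ m.

Definition grid_sum (R : realType) (m : nat) (e y : R -> R) : R :=
  \sum_(0 <= i < 2 ^ m) e (grid R m i) * (y (grid R m i.+1) - y (grid R m i)).

Lemma grid01 (R : realType) m i : (i <= 2 ^ m)%N -> grid R m i \in `[0, 1].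
Proof.
move=> im; rewrite in_itv/= /grid divr_ge0// ler_pdivrMr// mul1r.
by rewrite -natrX ler_nat.
Qed.

Lemma big_nat_blocks (R : realType) (F : nat -> R) (p n : nat) :
  \sum_(0 <= i < n * p) F i = \sum_(k < n) \sum_(k * p <= i < k.+1 * p) F i.
Proof.
elim: n => [|n IH]; first by rewrite big_ord0 mul0n big_geq.
rewrite big_ord_recr/= -IH (@big_cat_nat _ _ _ (n * p))//=.
by rewrite leq_mul2r leqnSn orbT.
Qed.

(** A path property at all scales down to the grid: an increment over length 2^-l is at most [x] of
    its standard deviations. It is the only fact about the Brownian path used in estimating
    coefficients. *)
Definition dyadic_modulus (R : realType) (m : nat) (x : R) (B : R -> R) :=
  forall l k, (l <= m)%N -> (k < 2 ^ l)%N ->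
    `|B (grid R l k.+1) - B (grid R l k)| <= x * (2 `^ 2^-1) ^- l.

Section grid_noise.
Context (R : realType) (m : nat) (x : R) (B e : R -> R).
Local Notation q := (2 `^ 2^-1 : R).
Hypothesis x0 : 0 <= x.
Hypothesis modB : dyadic_modulus m x B.

Let q0 : 0 < q. Proof. exact: powR_gt0. Qed.
Let qge : 5 / 4 <= q.
Proof.
rewrite -(@ler_pXn2r _ 2)// ?nnegrE ?(ltW q0)//; rewrite powR2_half.
by rewrite expr_div_n; lra.
Qed.

(* Halving a dyadic interval replaces e(left end) * dB by two such terms; the
   error is the oscillation of e times the increment over the right half, and
   these errors form a geometric series since q^3 > 2. *)
Lemma dyadic_sum_approx (La : R) (l d k : nat) : 0 <= La ->
  (forall s t, s \in `[0, 1] -> t \in `[0, 1] -> `|e s - e t| <= La * `|s - t|) ->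
  (l + d)%N = m -> (k < 2 ^ l)%N ->
  `|\sum_(k * 2 ^ d <= i < k.+1 * 2 ^ d) e (grid R m i) * (B (grid R m i.+1) - B (grid R m i))
    - e (grid R l k) * (B (grid R l k.+1) - B (grid R l k))| <= 2 * La * x * q ^- (3 * l).
Proof.
move=> La0 eL; elim: d l k => [|d IH] l k.
  rewrite addn0 expn0 !muln1 big_nat1 => -> km; rewrite subrr normr0.
  by rewrite !mulr_ge0// invr_ge0 exprn_ge0// ltW.
move=> lm kl; have lm' : (l.+1 + d)%N = m by rewrite addSnnS.
have kl1 : (k.*2 < 2 ^ l.+1)%N by rewrite expnS -mul2n ltn_pmul2l.
have kl2 : (k.*2.+1 < 2 ^ l.+1)%N by rewrite expnS -mul2n; move: kl; lia.
have e1 : (k * 2 ^ d.+1)%N = (k.*2 * 2 ^ d)%N by rewrite expnS mulnA muln2.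
have e2 : (k.+1 * 2 ^ d.+1)%N = (k.*2.+2 * 2 ^ d)%N by rewrite expnS mulnA muln2 doubleS.
rewrite e1 e2 (@big_cat_nat _ _ _ (k.*2.+1 * 2 ^ d))/= ?leq_mul2r ?leqnSn ?orbT//.
have g1 : grid R l k = grid R l.+1 k.*2.
  by rewrite /grid -muln2 natrM exprS; field; rewrite expf_neq0.
have g2 : grid R l k.+1 = grid R l.+1 k.*2.+2.
  by rewrite /grid -doubleS -muln2 natrM exprS; field; rewrite expf_neq0.
have H1 := IH l.+1 k.*2 lm' kl1; have H2 := IH l.+1 k.*2.+1 lm' kl2.
have osc : `|e (grid R l.+1 k.*2.+1) - e (grid R l.+1 k.*2)| <= La * 2 ^- l.+1.
  apply: le_trans (eL _ _ _ _) _; [exact: grid01 (ltnW kl2)|exact: grid01 (ltnW kl1)|].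
  rewrite ler_wpM2l// /grid -mulrBl -natr1 addrAC subrr add0r mul1r ger0_norm//.
have lm1 : (l.+1 <= m)%N by rewrite -lm' leq_addr.
have incr := modB lm1 kl2.
set z := q ^- l.+1 in incr.
have z0 : 0 < z by rewrite invr_gt0 exprn_gt0.
have E3 : q ^- (3 * l.+1) = z ^+ 3 by rewrite mulnC exprM exprVn.
have E2 : 2 ^- l.+1 = z ^+ 2 by rewrite -powR2_half -exprM mulnC exprM exprVn.
have E0 : q ^- (3 * l) = z ^+ 3 * (2 * q).
  have -> : z ^+ 3 * (2 * q) = z ^+ 3 * (q ^+ 2 * q) by rewrite powR2_half.
  have p0 := negbT (gt_eqF q0); have a0 := expf_neq0 l p0.
  rewrite /z (exprS _ l) mulnC exprM; move: (q ^+ l) a0 => a a0; move: (q) p0 => p p0.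
  by field; rewrite p0 a0.
rewrite E3 in H1 H2; rewrite E2 in osc; rewrite E0 g1 g2.
set T1 := \sum_(_ <= _ < _) _ in H1 *; set T2 := \sum_(_ <= _ < _) _ in H2 *.
move: H1 H2 osc incr.
set b0 := B (grid R l.+1 k.*2); set b1 := B (grid R l.+1 k.*2.+1).
set b2 := B (grid R l.+1 k.*2.+2); set e0 := e (grid R l.+1 k.*2).
set e1' := e (grid R l.+1 k.*2.+1).
move=> H1 H2 osc incr.
have -> : T1 + T2 - e0 * (b2 - b0) = (T1 - e0 * (b1 - b0)) + (T2 - e1' * (b2 - b1)) + (e1' - e0) * (b2 - b1) by ring.
have H3 : `|(e1' - e0) * (b2 - b1)| <= La * z ^+ 2 * (x * z) by rewrite normrM ler_pM.
apply: le_trans (ler_normD _ _) _.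
apply: le_trans (lerD (ler_normD _ _) (lexx _)) _.
have P0 : 0 <= La * x * z ^+ 3 by rewrite mulr_ge0 ?exprn_ge0 ?(ltW z0)// mulr_ge0.
(* With P = La x z^3, the two halves contribute 2 P each and the oscillation term P, while the
   claimed bound is 4 q P; so 5/4 <= q closes the induction. *)
have : La * x * z ^+ 3 * (5 / 4) <= La * x * z ^+ 3 * q by rewrite ler_wpM2l.
have -> : 2 * La * x * (z ^+ 3 * (2 * q)) = 4 * (La * x * z ^+ 3 * q) by ring.
have E4 : La * z ^+ 2 * (x * z) = La * x * z ^+ 3 by ring.
have E5 : 2 * La * x * z ^+ 3 = 2 * (La * x * z ^+ 3) by ring.
by rewrite E4 in H3; rewrite E5 in H1 H2; lra.
Qed.

(** Blocks of length 2^-j are compared with single increments. Each left-end term is at most C q^j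
    times x q^-j, and the comparison costs 2 C x, since the Lipschitz constant is C q^(3j) for q^2 =
    2. Only 2(C + 1) + 1 blocks can meet the support, so the bound depends neither on j nor on the
    grid. *)
Lemma grid_sum_noise (C : R) (j k : nat) : 0 <= C -> (j <= m)%N ->
  localized C j k e ->
  `|grid_sum m e B| <= (2 * C + 3) * (3 * C) * x.
Proof.
move=> C0 jm [e1 e2 e3].
have E : (2 ^ m = 2 ^ j * 2 ^ (m - j))%N by rewrite -expnD subnKC.
rewrite /grid_sum E big_nat_blocks.
apply: le_trans (ler_norm_sum _ _ _) _.
set La := C * q ^+ j * 2 ^+ j.
have qj0 : 0 < q ^+ j by rewrite exprn_gt0.
have La0 : 0 <= La by rewrite !mulr_ge0// ltW.
have -> : (2 * C + 3) * (3 * C) * x = (2 * (C + 1) + 1) * (3 * C * x) by ring.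
apply: (@sum_near_le _ (fun i => `|\sum_(i * 2 ^ (m - j) <= i0 < i.+1 * 2 ^ (m - j))
   e (grid R m i0) * (B (grid R m i0.+1) - B (grid R m i0))|) k%:R); first by rewrite addr_ge0.
- by rewrite !mulr_ge0.
- move=> i ij; rewrite normr_ge0 /=.
  have H := dyadic_sum_approx La0 e2 (subnKC jm) ij.
  rewrite -[X in `|X|](subrK (e (grid R j i) * (B (grid R j i.+1) - B (grid R j i)))).
  apply: le_trans (ler_normD _ _) _; apply: le_trans (lerD H (lexx _)) _.
  have H2 : `|e (grid R j i) * (B (grid R j i.+1) - B (grid R j i))| <= C * q ^+ j * (x * q ^- j).
    by rewrite normrM ler_pM// ?modB// e1// grid01// ltnW.
  apply: le_trans (lerD (lexx _) H2) _.
  have E2 : 2 ^+ j = (q ^+ j) ^+ 2 by rewrite -[X in X ^+ j = _]powR2_half -!exprM mulnC.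
  rewrite le_eqVlt; apply/orP; left; apply/eqP.
  by rewrite /La E2 mulnC exprM; move: (q ^+ j) (gt_eqF qj0) => p p0; field; rewrite p0.
- move=> i ij near; apply/eqP; rewrite normr_eq0; apply/eqP.
  rewrite big_nat_cond big1// => i0 /andP[/andP[h1 h2] _].
  rewrite e3 ?mul0r//; first by apply: grid01; rewrite E (leq_trans (ltnW h2))// leq_mul2r ij orbT.
  have p0 : 0 < 2 ^+ (m - j) :> R by rewrite exprn_gt0.
  have g : 2 ^+ j * grid R m i0 = i0%:R / 2 ^+ (m - j).
    by rewrite /grid -{1}(subnKC jm) exprD; field; rewrite !expf_neq0.
  have g1 : i%:R <= 2 ^+ j * grid R m i0.
    by rewrite g ler_pdivlMr// -natrX -natrM ler_nat.
  have g2 : 2 ^+ j * grid R m i0 <= i%:R + 1.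
    by rewrite g ler_pdivrMr// natr1 -natrX -natrM ler_nat ltnW.
  move: near; rewrite -(distrC i%:R).
  have -> : i%:R - k%:R = (i%:R - 2 ^+ j * grid R m i0) + (2 ^+ j * grid R m i0 - k%:R) by ring.
  move=> near; have := ler_normD (i%:R - 2 ^+ j * grid R m i0) (2 ^+ j * grid R m i0 - k%:R).
  have : `|i%:R - 2 ^+ j * grid R m i0| <= 1 by rewrite ler_norml; apply/andP; split; lra.
  lra.
Qed.

End grid_noise.

(** In each of the 2^m cells [e] oscillates by at most La / 2^m and the integral of |g| is at most G
    / 2^m. *)
Lemma grid_sum_drift (R : realType) (m : nat) (La G : R) (e g : R -> R) :
  0 <= La -> 0 <= G ->
  (forall s t, s \in `[0, 1] -> t \in `[0, 1] -> `|e s - e t| <= La * `|s - t|) ->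
  measurable_fun (`[0, 1]%classic : set R) g ->
  (forall t, t \in `[0, 1] -> `|g t| <= G) ->
  `|grid_sum m e (fun t => \int[lebesgue_measure]_(v in `[0, t]) g v) - ip `[0, 1] g e|
    <= La * G / 2 ^+ m.
Proof.
move=> La0 G0 eL mg gG; pose I01 : set R := `[0, 1]%classic.
have ce : {within `[0, 1], continuous e}.
  apply: (@lipschitz01_continuous R e). by exists La.
have mI : measurable I01 by exact: measurable_itv.
have me : measurable_fun I01 e by exact: subspace_continuous_measurable_fun.
have muI : (lebesgue_measure I01 < +oo)%E by rewrite lebesgue_measure_itv/= lte_fin ltr01 ltry.
have ig : lebesgue_measure.-integrable I01 (EFin \o g) by exact: integrable_bounded mg gG.
have zero01 : (0 : R) \in `[0, 1] by rewrite in_itv/= lexx ler01.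
have eB t : t \in `[0, 1] -> `|e t| <= `|e 0| + La.
  move=> t01; rewrite -[e t](subrKC (e 0)) (le_trans (ler_normD _ _))// lerD2l.
  apply: le_trans (eL _ _ t01 zero01) _; rewrite subr0 ler_piMr//.
  by move: t01; rewrite in_itv/= => /andP[t0 t1]; rewrite ger0_norm.
have ige : lebesgue_measure.-integrable I01 (EFin \o (fun t => g t * e t)).
  apply: (integrable_bounded (k := G * (`|e 0| + La))) => //; first exact: measurable_funM.
  by move=> t t01; rewrite normrM ler_pM// ?gG// eB.
have p0 : 0 < 2 ^+ m :> R by rewrite exprn_gt0.
suff H n : (n <= 2 ^ m)%N ->
  `|\sum_(0 <= i < n) e (grid R m i) * (\int[lebesgue_measure]_(v in `[0, grid R m i.+1]) g v
      - \int[lebesgue_measure]_(v in `[0, grid R m i]) g v)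
    - \int[lebesgue_measure]_(v in `[0, grid R m n]) (g v * e v)| <= n%:R * (La * G / 2 ^+ m / 2 ^+ m).
  have := H _ (leqnn _); rewrite natrX [2 ^+ m * _]mulrC divfK ?gt_eqF// /ip.
  by rewrite {4}/grid natrX divff ?gt_eqF.
elim: n => [_|n IH nm].
  rewrite big_geq// mul0r sub0r normrN /grid mul0r set_itv1 Rintegral_set1 normr0//.
have n1m := ltnW nm.
have t01 := grid01 R n1m; have t01' := grid01 R nm.
set t := grid R m n in t01 *; set t' := grid R m n.+1 in t01' *.
have tt' : t <= t' by rewrite /t /t' /grid ler_pM2r ?invr_gt0// ler_nat.
have dt : t' - t = (2 ^+ m)^-1 by rewrite /t /t' /grid -mulrBl -natr1 addrAC subrr add0r mul1r.
have [t0 t1] : 0 <= t /\ t' <= 1.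
  by move: t01 t01'; rewrite !in_itv/= => /andP[? _] /andP[_ ?].
have sub (h : R -> R) : lebesgue_measure.-integrable I01 (EFin \o h) ->
    \int[lebesgue_measure]_(v in `[0, t']) h v - \int[lebesgue_measure]_(v in `[0, t]) h v
    = \int[lebesgue_measure]_(v in `]t, t']) h v.
  move=> ih; apply: Rintegral_itvB; rewrite ?bnd_simp//.
  apply: integrableS ih => //; apply: subset_itv; rewrite bnd_simp//.
have subset_cell : (`]t, t']%classic : set R) `<=` I01.
  by apply: subset_itv; rewrite bnd_simp.
have igc : lebesgue_measure.-integrable (`]t, t']%classic : set R) (EFin \o g) by apply: integrableS ig.
have igec : lebesgue_measure.-integrable (`]t, t']%classic : set R) (EFin \o (fun v => g v * e v)) by apply: integrableS ige.
rewrite big_nat_recr//= sub//.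
set S := \sum_(0 <= i < n) _; pose J := \int[lebesgue_measure]_(v in `[0, t]) (g v * e v).
have -> : \int[lebesgue_measure]_(v in `[0, t']) (g v * e v) =
    J + \int[lebesgue_measure]_(v in `]t, t']) (g v * e v).
  by rewrite -sub// /J; ring.
have -> : S + e t * \int[lebesgue_measure]_(v in `]t, t']) g v -
   (J + \int[lebesgue_measure]_(v in `]t, t']) (g v * e v)) =
   (S - J) + \int[lebesgue_measure]_(v in `]t, t']) (e t * g v - g v * e v).
  by rewrite RintegralB//; [rewrite RintegralZl//; ring|exact: integrable_scaler].
rewrite -natr1 mulrDl mul1r; apply: le_trans (ler_normD _ _) _; apply: lerD.
  exact: IH.
rewrite -[X in _ <= _ * X]dt; apply: le_normr_Rintegral_itv => //.
  by apply: integrable_subr => //; exact: integrable_scaler.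
move=> v; rewrite in_itv/= => /andP[tv vt'].
have v01 : v \in `[0, 1] by rewrite in_itv/=; apply/andP; split; lra.
rewrite mulrC -mulrBr normrM [leRHS](_ : _ = G * (La * (2 ^+ m)^-1)); last by ring.
rewrite ler_pM// ?gG//; apply: le_trans (eL _ _ t01 v01) _.
by rewrite ler_wpM2l// -dt ler0_norm; lra.
Qed.

Lemma grid_sum_observation (R : realType) (C : R) (m j k : nat) (x G sn : R)
    (e f g B : R -> R) :
  0 <= C -> 0 <= x -> 0 <= G -> 0 <= sn -> (j <= m)%N -> localized C j k e ->
  dyadic_modulus m x B ->
  {within `[0, 1], continuous g} ->
  {ae @lebesgue_measure R, forall t, t \in `[0, 1] -> g t = f t} ->
  measurable_fun (`[0, 1]%classic : set R) f ->
  (forall t, t \in `[0, 1] -> `|g t| <= G) ->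
  `|grid_sum m e (fun t => \int[lebesgue_measure]_(v in `[0, t]) f v + sn * B t) - ip `[0, 1] f e|
  <= sn * ((2 * C + 3) * (3 * C) * x) + C * (2 `^ 2^-1) ^+ j * 2 ^+ j * G / 2 ^+ m.
Proof.
move=> C0 x0 G0 sn0 jm le_ modB cg gf mf gG.
have mg : measurable_fun (`[0, 1]%classic : set R) g by exact: subspace_continuous_measurable_fun.
have me : measurable_fun (`[0, 1]%classic : set R) e.
  by apply: subspace_continuous_measurable_fun => //; exact: localized_continuous le_.
have ipE : ip `[0, 1] f e = ip `[0, 1] g e.
  rewrite /ip /Rintegral; congr fine; apply: ae_eq_integral_EFin => //.
  - exact: measurable_funM.
  - exact: measurable_funM.
  - by apply: ae_lebesgueS gf => t h t01; rewrite h.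
have intE t : t \in `[0, 1] -> \int[lebesgue_measure]_(v in `[0, t]) f v = \int[lebesgue_measure]_(v in `[0, t]) g v.
  rewrite in_itv/= => /andP[t0 t1].
  have sub : (`[0, t]%classic : set R) `<=` `[0, 1]%classic by apply: subset_itv; rewrite bnd_simp.
  rewrite /Rintegral; congr fine; apply: ae_eq_integral_EFin => //.
  - exact: measurable_funS mf.
  - exact: measurable_funS mg.
  - by apply: ae_lebesgueS gf => v h /sub v01; rewrite h.
have -> : grid_sum m e (fun t => \int[lebesgue_measure]_(v in `[0, t]) f v + sn * B t) =
    grid_sum m e (fun t => \int[lebesgue_measure]_(v in `[0, t]) g v) + sn * grid_sum m e B.
  rewrite /grid_sum mulr_sumr -big_split/= big_nat_cond [RHS]big_nat_cond.
  apply: eq_bigr => i /andP[/andP[_ im] _].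
  by rewrite !intE ?grid01// ?(ltnW im)//; ring.
rewrite ipE addrAC addrC; apply: le_trans (ler_normD _ _) _; apply: lerD.
  by rewrite normrM ger0_norm// ler_wpM2l//; exact: grid_sum_noise modB _ _ _ C0 jm le_.
have [_ e2 _] := le_; apply: grid_sum_drift => //.
by rewrite !mulr_ge0// exprn_ge0// powR_ge0.
Qed.

(** * Selection of the resolution level *)

(** A bounded search; if no candidate passes, the value is [c + fuel], which has not been tested. *)
Fixpoint first_good (g : pred nat) (fuel c : nat) : nat :=
  if fuel is k.+1 then (if g c then c else first_good g k c.+1) else c.

Lemma first_good_bounds g fuel c : (c <= first_good g fuel c <= c + fuel)%N.
Proof.
elim: fuel c => [|k IH] c /=; first by rewrite addn0 leqnn.
case: ifP => _; first by rewrite leqnn leq_addr.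
by have /andP[h1 h2] := IH c.+1; rewrite (ltnW h1) -addSnnS.
Qed.

Lemma first_good_min (g : pred nat) fuel c J : (c <= J)%N -> g J -> (first_good g fuel c <= J)%N.
Proof.
elim: fuel c => [|k IH] c //= cJ gJ; case: ifPn => // gc; apply: IH => //.
by rewrite ltn_neqAle cJ andbT; apply: contraNneq gc => ->.
Qed.

Lemma first_good_good (g : pred nat) fuel c J : (c <= J < c + fuel)%N -> g J -> g (first_good g fuel c).
Proof.
elim: fuel c => [|k IH] c /=; first by rewrite addn0 ltnNge andbN.
move=> /andP[cJ Jc] gJ; case: ifPn => // gc; apply: IH => //.
by rewrite addSnnS Jc andbT ltn_neqAle cJ andbT; apply: contraNneq gc => ->.
Qed.

Lemma sum_le_size (R : realType) (I : eqType) (s : seq I) (F : I -> R) (x : R) :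
  (forall i, i \in s -> F i <= x) -> \sum_(i <- s) F i <= (size s)%:R * x.
Proof.
elim: s => [|a s IH] H; first by rewrite big_nil mul0r.
rewrite big_cons /= -natr1 mulrDl mul1r addrC lerD//.
  by apply: IH => i si; apply: H; rewrite in_cons si orbT.
by apply: H; rewrite mem_head.
Qed.

Section selection.
Context (R : realType) (W : wavelet_system R).
Local Notation j0 := (coarsest W).
Local Notation q := (2 `^ 2^-1 : R).
Local Notation I01 := (`[0, 1]%classic : set R).
Variables (smin smax eps : R) (rho : nat).
Hypothesis smin0 : 0 < smin.
Hypothesis smin_max : smin <= smax.
Hypothesis eps01 : 0 < eps < 1.

Definition theta (s : R) : R := 2 `^ (s + 2^-1).

Definition first_block := indices_upto W (rho * j0).
Definition detail_block (j : nat) : seq (option nat * nat) :=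
  flatten [seq level_indices l | l <- index_iota j (rho * j).+1].

(** Self-similarity at the coarsest level gives a coefficient of weighted size at least eps/2 M; the
    weight is at most [theta smax ^+ (rho * j0)], as all levels of the first block are at most rho
    j0 and s <= smax. *)
Definition c_low : R := eps / 2 * theta smax ^- (rho * j0).
Definition n_low : R := (size first_block)%:R.

(* The last two clauses are self-similarity at j = coarsest W and at larger j. *)
Definition class_coef (s M : R) (c : option nat * nat -> R) :=
  [/\ forall k, (k < 2 ^ j0)%N -> `|c (None, k)| <= M,
      forall l k, (j0 <= l)%N -> (k < 2 ^ l)%N -> theta s ^+ l * `|c (Some l, k)| <= M,
      exists2 i, i \in first_block & c_low * M <= `|c i| &
      s != smax -> forall j, (j0 < j)%N ->
        exists l k, [/\ (j <= l <= rho * j)%N, (k < 2 ^ l)%N &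
          eps / 2 * M <= theta s ^+ l * `|c (Some l, k)|]].

Lemma theta_gt0 s : 0 < theta s. Proof. exact: powR_gt0. Qed.

Lemma thetaE s : theta s * 2 `^ (- s) = q.
Proof.
rewrite /theta -powRD; last by apply/implyP => _; rewrite gt_eqF.
by rewrite addrAC subrr add0r.
Qed.

Lemma theta_ge1 s : 0 < s -> 1 <= theta s.
Proof.
move=> s0; rewrite /theta -[leLHS](powRr0 2) ler_powR//; lra.
Qed.

Lemma theta_le s s' : s <= s' -> theta s <= theta s'.
Proof. by move=> ss; rewrite /theta ler_powR ?ler1n// lerD2r. Qed.

Lemma c_low_gt0 : 0 < c_low.
Proof.
case/andP: eps01 => e0 _.
by rewrite /c_low mulr_gt0// ?divr_gt0// invr_gt0 exprn_gt0// theta_gt0.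
Qed.

Lemma n_low_ge1 : 1 <= n_low.
Proof.
rewrite /n_low ler1n /first_block /indices_upto size_cat /base_indices size_map size_iota.
by rewrite ltn_addr// expn_gt0.
Qed.

Lemma self_similar_class_coef (s M : R) f (u : option nat * nat -> R -> R) :
  cdv_wavelet_basis W -> smin <= s <= smax -> 0 < M ->
  self_similar W smax eps rho s M f ->
  (forall k, (k < 2 ^ j0)%N -> alpha W f k = ip I01 f (u (None, k))) ->
  (forall j k, (j0 <= j)%N -> (k < 2 ^ j)%N -> beta W f j k = ip I01 f (u (Some j, k))) ->
  class_coef s M (fun i => ip I01 f (u i)).
Proof.
move=> hW /andP[s1 s2] M0 [Hball Hss] Ha Hb.
have [Lf _] := Hball; case/andP: eps01 => e0 e1.
have s0 : 0 < s by exact: lt_le_trans s1.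
have eM0 : 0 < eps * M by rewrite mulr_gt0.
have th1 := theta_ge1 (lt_le_trans s0 s2).
have thp (l : nat) : 0 < theta smax ^+ l by rewrite exprn_gt0// theta_gt0.
split.
- by move=> k kj; rewrite -Ha//; exact: Cs_ball_alpha Hball kj.
- by move=> l k jl kl; rewrite -Hb//; exact: Cs_ball_beta Hball jl kl.
- have cond : if s == smax then j0 == j0 else (j0 <= j0)%N by rewrite eqxx leqnn if_same.
  have := block_norm_witness hW eM0 (leqnn j0) Lf (Hss j0 cond).
  case=> [[_ [k kj h]]|[l [k [/andP[jl lr] kl h]]]].
    exists (None, k); first by apply/mem_indices_upto.
    rewrite -Ha//; apply: le_trans (ltW h); rewrite /c_low.
    have -> : eps * M / 2 = eps / 2 * M by ring.
    rewrite ler_wpM2r ?(ltW M0)// ler_piMr ?divr_ge0 ?(ltW e0)//.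
    by rewrite invf_le1// exprn_ege1.
  exists (Some l, k); first by apply/mem_indices_upto.
  rewrite -Hb// /c_low mulrAC ler_pdivrMr// mulrC.
  have -> : M * (eps / 2) = eps * M / 2 by ring.
  apply: le_trans (ltW h) _; rewrite mulrC ler_wpM2l//.
  apply: (@le_trans _ _ (theta smax ^+ l)).
    by rewrite lerXn2r ?nnegrE ?(ltW (theta_gt0 _))// theta_le.
  by rewrite ler_weXn2l.
- move=> ss j jj.
  have := block_norm_witness hW eM0 (ltnW jj) Lf (Hss j _).
  rewrite (negbTE ss) (ltnW jj) => /(_ isT) [[jE _]|[l [k [/andP[jl lr] kl h]]]].
    by rewrite jE ltnn in jj.
  exists l, k; rewrite jl lr; split => //.
  rewrite -Hb//; last exact: leq_trans (ltnW jj) jl.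
  by apply: le_trans (ltW h); rewrite mulrAC.
Qed.

Definition amplitude (c : option nat * nat -> R) : R := \sum_(i <- first_block) `|c i|.
(** For the exact coefficients the amplitude lies between [c_low * M] and [n_low * M]. The factor 2
    in [M_upper] leaves room for an error proportional to M; the factor eps/2 in [M_lower] is the
    one in the self-similarity bound at the high block, with which [M_lower] is compared. *)
Definition M_upper (delta : R) (c : option nat * nat -> R) : R :=
  2 / c_low * (amplitude c + n_low * delta).
Definition M_lower (delta : R) (c : option nat * nat -> R) : R :=
  eps / (2 * n_low) * Num.max 0 (amplitude c - n_low * delta).

Definition level_of (i : option nat * nat) : nat := if i.1 is Some l then l else j0.

(* The level J is large enough for (s, M) as soon as theta s ^+ J >= M / delta.
   Either the smallest admissible s already ensures this, or all the s that are
   compatible with the coefficients of one high block do. *)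
Definition good_level (delta : R) (jn : nat) (c : option nat * nat -> R) (J : nat) : bool :=
  (M_upper delta c <= delta * theta smin ^+ J) ||
  ((M_upper delta c <= delta * theta smax ^+ J) &&
   all (fun i => (M_upper delta c / delta) ^+ level_of i * (`|c i| + delta) ^+ J
                 <= M_lower delta c ^+ J) (detail_block jn)).

Definition selected_level (delta : R) (jn Jtop : nat) (c : option nat * nat -> R) : nat :=
  first_good (good_level delta jn c) (Jtop - j0) j0.

Lemma amplitude_upper s M c : 0 < M -> 0 < s -> class_coef s M c ->
  forall i, i \in first_block -> `|c i| <= M.
Proof.
move=> M0 s0 [c1 c2 _ _] [[l|] k] /mem_indices_upto [Ii _]; last exact: c1.
case: Ii => jl kl; apply: le_trans (c2 l k jl kl).
by rewrite ler_peMl// exprn_ege1// theta_ge1.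
Qed.

Lemma amplitude_le (c c' : option nat * nat -> R) (e : R) :
  (forall i, i \in first_block -> `|c' i - c i| <= e) ->
  `|amplitude c' - amplitude c| <= n_low * e.
Proof.
move=> H; rewrite /amplitude -sumrB; apply: le_trans (ler_norm_sum _ _ _) _.
by apply: sum_le_size => i iF; exact: le_trans (ler_dist_dist _ _) (H i iF).
Qed.

Lemma amplitude_lower s M c : class_coef s M c -> c_low * M <= amplitude c.
Proof.
move=> [_ _ [i iF h] _]; apply: le_trans h _.
by rewrite /amplitude (bigD1_seq i)//= ?lerDl ?sumr_ge0// uniq_indices_upto.
Qed.

Lemma mem_detail_block j i : i \in detail_block j <->
  exists l k, [/\ (j <= l <= rho * j)%N, (k < 2 ^ l)%N & i = (Some l, k)].
Proof.
split=> [/flatten_mapP[l]|[l [k [ljr kl ->]]]].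
  rewrite mem_index_iota ltnS => jl; rewrite mem_level_indices => /andP[/eqP i1 i2].
  by exists l, i.2; split => //; case: i i1 {i2} => a k /= ->.
by apply/flatten_mapP; exists l; rewrite ?mem_index_iota ?ltnS// mem_level_indices eqxx.
Qed.

(** A level that passes the test is large enough. For s < s_max the block contains a coefficient b
    with [M_lower] <= theta^l (|b| + delta); inserting this in the test for b, the factor (|b| +
    delta)^J cancels and an l-th root remains. For s = s_max no such coefficient is guaranteed, and
    the floor with [theta smax] takes over. *)
Lemma good_level_theta s M c chat delta jn J :
  smin <= s <= smax -> 0 < M -> 0 < delta -> (j0 < jn)%N -> class_coef s M c ->
  (forall i, i \in first_block -> `|chat i - c i| <= delta) ->
  (forall i, i \in detail_block jn -> `|chat i - c i| <= delta) ->
  M <= M_upper delta chat -> good_level delta jn chat J ->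
  M <= delta * theta s ^+ J.
Proof.
move=> /andP[s1 s2] M0 d0 jj cc Hf Hd MM; have s0 : 0 < s by exact: lt_le_trans s1.
case/andP: eps01 => e0 e1; have n1 := n_low_ge1; have n0 : 0 < n_low by lra.
case/orP => [H|/andP[H /allP H2]].
  apply: le_trans MM (le_trans H _); rewrite ler_wpM2l ?(ltW d0)//.
  by rewrite lerXn2r ?nnegrE ?(ltW (theta_gt0 _))// theta_le.
have [sE|sN] := eqVneq s smax; first by rewrite sE; exact: le_trans MM H.
have [_ _ _ /(_ sN jn jj) [l [k [ljr kl h]]]] := cc.
have iD : (Some l, k) \in detail_block jn by apply/mem_detail_block; exists l, k.
have := H2 _ iD; rewrite /level_of /=; set b := chat _ => H3.
have bc : `|c (Some l, k)| <= `|b| + delta.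
  have := Hd _ iD; rewrite -/b distrC => h1.
  by rewrite -[c _](subrK b) (le_trans (ler_normD _ _))// addrC lerD2l.
have lowM : M_lower delta chat <= eps / 2 * M.
  rewrite /M_lower (_ : eps / (2 * n_low) = eps / 2 / n_low); last by field; lra.
  rewrite -mulrA ler_wpM2l ?divr_ge0 ?(ltW e0)// ler_pdivrMl// ge_max.
  rewrite mulr_ge0 ?(ltW n0) ?(ltW M0)//=.
  have := amplitude_le Hf; rewrite ler_norml => /andP[_ h1].
  have : amplitude c <= n_low * M.
    by apply: sum_le_size; exact: amplitude_upper cc.
  by lra.
have low0 : 0 <= M_lower delta chat.
  by rewrite /M_lower mulr_ge0 ?divr_ge0 ?(ltW e0) ?mulr_ge0 ?(ltW n0)// le_max lexx.
have b0 : 0 < `|b| + delta by rewrite ltr_wpDl.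
have lowb : M_lower delta chat <= theta s ^+ l * (`|b| + delta).
  apply: le_trans lowM (le_trans h _).
  by rewrite ler_wpM2l ?exprn_ge0 ?(ltW (theta_gt0 _)).
have {}H3 : (M_upper delta chat / delta) ^+ l <= (theta s ^+ J) ^+ l.
  have bJ : 0 < (`|b| + delta) ^+ J by rewrite exprn_gt0.
  rewrite -(ler_pM2r bJ); apply: le_trans H3 _.
  rewrite -exprM mulnC exprM -exprMn lerXn2r ?nnegrE// mulr_ge0 ?(ltW b0)//.
  by rewrite exprn_ge0 ?(ltW (theta_gt0 _)).
have l0 : (0 < l)%N by case/andP: ljr => h1 _; exact: leq_trans (leq_ltn_trans (leq0n _) jj) h1.
have Mu0 : 0 <= M_upper delta chat by apply: le_trans MM; exact: ltW.
rewrite ler_pXn2r ?nnegrE ?divr_ge0 ?(ltW d0) ?exprn_ge0 ?(ltW (theta_gt0 _))// in H3.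
by apply: le_trans MM _; rewrite mulrC -ler_pdivrMr.
Qed.

(** The part [eta * M] of the error comes from the drift. It may consume half of the amplitude
    [c_low * M], which the factor 2 in [M_upper] restores, so the bound holds however large M is. *)
Lemma M_upper_ge s M c chat delta d0 eta :
  0 < M -> class_coef s M c -> d0 <= delta ->
  (forall i, i \in first_block -> `|chat i - c i| <= d0 + eta * M) ->
  n_low * eta <= c_low / 2 -> M <= M_upper delta chat.
Proof.
move=> M0 cc dd H eta_small; have cl := c_low_gt0; have n1 := n_low_ge1.
have := amplitude_le H; rewrite ler_norml => /andP[h1 _].
have h2 := amplitude_lower cc.
rewrite /M_upper mulrAC ler_pdivlMr// mulrC.
have h3 : n_low * eta * M <= c_low / 2 * M by rewrite ler_wpM2r ?(ltW M0).
have h4 : n_low * d0 <= n_low * delta by rewrite ler_wpM2l//; lra.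
rewrite mulrDr mulrA in h1.
have h5 : c_low / 2 * M = c_low * M / 2 by ring.
lra.
Qed.

End selection.

Lemma powR2_half_ge (R : realType) : 4 / 3 <= 2 `^ 2^-1 :> R.
Proof.
rewrite -(@ler_pXn2r _ 2)// ?nnegrE ?powR_ge0//.
by rewrite powR2_half expr_div_n; lra.
Qed.

(** The ratio is at least 4/3, so the sum is at most 1 / (1 - 3/4) = 4 times its last term. *)
Lemma sum_powR2_half (R : realType) (a J : nat) : (a <= J)%N ->
  \sum_(a <= l < J.+1) (2 `^ 2^-1) ^+ l <= 4 * (2 `^ 2^-1) ^+ J :> R.
Proof.
have q43 := powR2_half_ge R; set q := 2 `^ 2^-1 in q43 *.
have q0 k : 0 < q ^+ k by rewrite exprn_gt0// powR_gt0.
move=> aJ; rewrite -(subnKC aJ); elim: (J - a)%N => [|n IH].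
  by rewrite addn0 big_nat1; have := q0 a; lra.
rewrite addnS big_nat_recr/=; last by rewrite leqW// leq_addr.
have : 4 * (q ^+ (a + n)) * 1 <= 3 * q ^+ (a + n).+1.
  rewrite exprS mulrA; have := q0 (a + n)%N => h.
  have : q ^+ (a + n) * (4 / 3) <= q ^+ (a + n) * q by rewrite ler_wpM2l// ltW.
  lra.
lra.
Qed.

Section band.
Context (R : realType) (W : wavelet_system R).
Local Notation j0 := (coarsest W).
Local Notation q := (2 `^ 2^-1 : R).
Variables (C : R) (u : option nat * nat -> R -> R).
Hypothesis C0 : 0 <= C.
Hypothesis locu : forall i, basis_index W i -> localized C (index_level W i) i.2 (u i).
Variables (smin smax eps : R) (rho : nat).
Hypothesis smin0 : 0 < smin.
Hypothesis smin_max : smin <= smax.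
Hypothesis eps01 : 0 < eps < 1.

Definition overlap_const : R := (2 * C + 1) * C.
Definition rate_min : R := 2 `^ (- smin).
Definition radius_const : R := 5 * overlap_const + overlap_const / (1 - rate_min).

Lemma overlap_const_ge0 : 0 <= overlap_const.
Proof. by rewrite /overlap_const mulr_ge0// addr_ge0// mulr_ge0. Qed.

Lemma rate_min01 : 0 < rate_min < 1.
Proof.
rewrite /rate_min powR_gt0//= powRN invf_lt1 ?powR_gt0//.
apply: (@le_lt_trans _ _ (1 `^ smin)); first by rewrite powR1.
by apply: gt0_ltr_powR; rewrite ?nnegrE ?ltr1n.
Qed.

Lemma rate_le s : smin <= s -> 0 < 2 `^ (- s) <= rate_min.
Proof. by move=> ss; rewrite powR_gt0//= /rate_min ler_powR ?ler1n// lerN2. Qed.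

Lemma radius_const_ge0 : 0 <= radius_const.
Proof.
have D0 := overlap_const_ge0; have /andP[r0 r1] := rate_min01.
apply: addr_ge0; first exact: mulr_ge0.
by apply: divr_ge0 => //; rewrite subr_ge0 ltW.
Qed.

Lemma estimate_error (s M delta : R) (c chat : option nat * nat -> R) (g : R -> R) J :
  smin <= s -> 0 <= M -> 0 < delta -> (j0 <= J)%N ->
  M <= delta * theta s ^+ J ->
  (forall i, i \in indices_upto W J -> `|chat i - c i| <= delta) ->
  (forall x, x \in `[0, 1] -> `|g x - \sum_(i <- indices_upto W J) c i * u i x|
     <= M * overlap_const / (1 - 2 `^ (- s)) * (2 `^ (- s)) ^+ J) ->
  forall x, x \in `[0, 1] ->
    `|g x - \sum_(i <- indices_upto W J) chat i * u i x| <= radius_const * (q ^+ J * delta).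
Proof.
move=> ss M0 d0 jJ MJ Hc tail x x01.
have D0 := overlap_const_ge0; have /andP[rm0 rm1] := rate_min01.
have /andP[r0 r1] := rate_le ss; set r := 2 `^ (- s) in r0 r1 tail.
have qJ0 : 0 < q ^+ J by rewrite exprn_gt0// powR_gt0.
rewrite -[X in `|X|](subrK (\sum_(i <- indices_upto W J) c i * u i x)) addrAC.
have -> : forall a b d : R, a - b + d - d = (a - d) + (d - b) by move=> *; ring.
apply: le_trans (ler_normD _ _) _.
rewrite /radius_const mulrDl addrC; apply: lerD; last first.
  apply: le_trans (tail _ x01) _.
  have E : theta s ^+ J * r ^+ J = q ^+ J by rewrite -exprMn thetaE.
  apply: (@le_trans _ _ (overlap_const / (1 - r) * (q ^+ J * delta))).
    have -> : M * overlap_const / (1 - r) * r ^+ J = overlap_const / (1 - r) * (M * r ^+ J) by ring.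
    rewrite ler_wpM2l ?divr_ge0 ?subr_ge0 ?(le_trans r1 (ltW rm1))//.
    by rewrite -E mulrAC -[X in _ <= X * _]mulrC ler_wpM2r// exprn_ge0// ltW.
  rewrite ler_wpM2r ?mulr_ge0 ?(ltW qJ0) ?(ltW d0)// ler_wpM2l//.
  by rewrite lef_pV2 ?posrE; lra.
rewrite -sumrB (eq_bigr (fun i => (c i - chat i) * u i x)); last by move=> i _; rewrite mulrBl.
rewrite sum_indices_upto.
have D1 : overlap_const = (2 * C + 1) * C by [].
have Hd i : i \in indices_upto W J -> `|c i - chat i| <= delta by move=> /Hc; rewrite distrC.
have dD : 0 <= delta * overlap_const by apply: mulr_ge0 => //; exact: ltW.
have B1 : `|\sum_(i <- base_indices W) (c i - chat i) * u i x| <= delta * overlap_const * q ^+ J.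
  apply: le_trans (sum_base_le C0 locu (c := fun i => c i - chat i) (A := delta) (ltW d0) _ x01) _.
    move=> i; rewrite mem_base_indices => /andP[/eqP i1 i2]; apply: Hd.
    by apply/mem_indices_upto; rewrite /basis_index/= i1.
  rewrite -D1; apply: ler_wpM2l => //; rewrite ler_weXn2l//.
  by have := powR2_half_ge R; lra.
have B2 : `|\sum_(j0 <= l < J.+1) \sum_(i <- level_indices l) (c i - chat i) * u i x| <=
    delta * overlap_const * (4 * q ^+ J).
  apply: le_trans (ler_norm_sum _ _ _) _.
  apply: (@le_trans _ _ (\sum_(j0 <= l < J.+1) delta * overlap_const * q ^+ l)).
    rewrite big_nat_cond [leRHS]big_nat_cond; apply: ler_sum => l /andP[/andP[jl lJ] _].
    apply: (sum_level_le C0 locu (c := fun i => c i - chat i) (ltW d0) jl _ x01).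
    move=> i; rewrite mem_level_indices => /andP[/eqP i1 i2]; apply: Hd.
    by apply/mem_indices_upto; rewrite /basis_index/= i1 jl i2.
  by rewrite -mulr_sumr; apply: ler_wpM2l => //; exact: sum_powR2_half.
apply: le_trans (ler_normD _ _) _; apply: le_trans (lerD B1 B2) _.
by rewrite le_eqVlt; apply/orP; left; apply/eqP; ring.
Qed.

Lemma good_level_exists (delta : R) jn chat J :
  M_upper W smax eps rho delta chat <= delta * q ^+ J -> 0 <= delta ->
  good_level W smin smax eps rho delta jn chat J.
Proof.
move=> H d0; rewrite /good_level; apply/orP; left; apply: le_trans H _.
rewrite ler_wpM2l// lerXn2r ?nnegrE ?powR_ge0//.
by rewrite /theta ler_powR ?ler1n// lerDr ltW.
Qed.

Local Notation c_low := (c_low W smax eps rho).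
Local Notation n_low := (n_low W rho).
(** The loss in estimating M from either side. For delta <= M the noisy amplitude plus
    [n_low * delta] is at most [3 * n_low * M]; for [4 * n_low * delta <= c_low * M], half of
    [c_low * M] survives in [M_lower], which is then compared with 2 M. *)
Definition upper_ratio : R := 6 * n_low / c_low.
Definition lower_ratio : R := 8 * n_low / (eps * c_low).

Lemma M_upper_le (s M delta : R) (c chat : option nat * nat -> R) :
  smin <= s -> 0 < M -> class_coef W smax eps rho s M c ->
  (forall i, i \in first_block W rho -> `|chat i - c i| <= delta) ->
  delta <= M -> M_upper W smax eps rho delta chat <= upper_ratio * M.
Proof.
move=> s1 M0 cc Hf dM; have cl := c_low_gt0 W smax rho eps01; have n1 := n_low_ge1 W rho.
have s0 : 0 < s by exact: lt_le_trans s1.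
have := amplitude_le Hf; rewrite ler_norml => /andP[h1 h2].
have h3 : amplitude W rho c <= n_low * M by apply: sum_le_size; exact: amplitude_upper cc.
have h4 : n_low * delta <= n_low * M by rewrite ler_wpM2l//; lra.
rewrite /M_upper /upper_ratio mulrAC -[leRHS]mulrAC.
have -> : 6 * n_low * M / c_low = (6 * (n_low * M)) / c_low by rewrite mulrA.
by rewrite ler_wpM2r ?invr_ge0 ?(ltW cl)//; lra.
Qed.

Lemma M_lower_ge (s M delta : R) (c chat : option nat * nat -> R) :
  0 < M -> class_coef W smax eps rho s M c ->
  (forall i, i \in first_block W rho -> `|chat i - c i| <= delta) ->
  4 * n_low * delta <= c_low * M -> 2 * M <= lower_ratio * M_lower W eps rho delta chat.
Proof.
move=> M0 cc Hf dM; have cl := c_low_gt0 W smax rho eps01; have n1 := n_low_ge1 W rho.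
case/andP: eps01 => e0 e1.
have := amplitude_le Hf; rewrite ler_norml => /andP[h1 _].
have h2 := amplitude_lower cc.
rewrite /lower_ratio /M_lower.
set X := Num.max _ _.
have X1 : amplitude W rho chat - n_low * delta <= X by rewrite le_max lexx orbT.
have -> : 8 * n_low / (eps * c_low) * (eps / (2 * n_low) * X) = 4 * X / c_low.
  have nz1 : n_low != 0 by rewrite gt_eqF//; lra.
  have nz2 : c_low != 0 by rewrite gt_eqF.
  have nz3 : eps != 0 by rewrite gt_eqF.
  by field; rewrite ?nz1 ?nz2 ?nz3.
by rewrite ler_pdivlMr//; lra.
Qed.

(** The converse of the soundness of the test, up to constants: a level passes as soon as theta^J
    exceeds M / delta by a fixed factor. The ratio between estimated and true sizes enters to the
    power J; as J <= Cj l at every level l of the block, it is at most [lower_ratio ^+ Cj] to the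
    power l and costs a constant after the l-th root. *)
Lemma good_level_size (s M delta : R) (c chat : option nat * nat -> R) (jn J Cj : nat) :
  smin <= s <= smax -> 0 < M -> 0 < delta -> (j0 <= jn)%N ->
  class_coef W smax eps rho s M c ->
  (forall i, i \in first_block W rho -> `|chat i - c i| <= delta) ->
  (forall i, i \in detail_block rho jn -> `|chat i - c i| <= delta) ->
  delta <= M -> 4 * n_low * delta <= c_low * M ->
  theta s ^+ (rho * jn) * (2 * delta) <= M ->
  (J <= Cj * jn)%N -> (0 < jn)%N ->
  upper_ratio * M * lower_ratio ^+ Cj <= delta * theta s ^+ J ->
  good_level W smin smax eps rho delta jn chat J.
Proof.
move=> /andP[s1 s2] M0 d0 jj cc Hf Hd dM dM4 small JC jn0 HJ.
have s0 : 0 < s by exact: lt_le_trans s1.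
have cl := c_low_gt0 W smax rho eps01; have n1 := n_low_ge1 W rho.
case/andP: eps01 => e0 e1.
have th0 := theta_gt0 s; have th1 := theta_ge1 s0.
have c_low_lt1 : c_low <= 1.
  rewrite /c_low; apply: (@le_trans _ _ (1 * 1)); last by rewrite mulr1.
  rewrite ler_pM ?invr_ge0 ?exprn_ge0 ?(ltW (theta_gt0 _))//; [lra|lra|].
  by rewrite invf_le1 ?exprn_gt0 ?theta_gt0// exprn_ege1// (le_trans th1)// theta_le.
have lr1 : 1 <= lower_ratio.
  have ec0 : 0 < eps * c_low by exact: mulr_gt0.
  rewrite /lower_ratio (ler_pdivlMr _ _ ec0) mul1r.
  have : eps * c_low <= 1 * 1 by rewrite ler_pM ?(ltW e0) ?(ltW cl) ?(ltW e1).
  lra.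
have Mu := M_upper_le s1 M0 cc Hf dM; have Ml := M_lower_ge M0 cc Hf dM4.
have ur0 : 0 <= upper_ratio by rewrite /upper_ratio divr_ge0 ?(ltW cl)//; lra.
set mu := M_upper _ _ _ _ _ _ in Mu *; set ml := M_lower _ _ _ _ _ in Ml *.
have lrC k : 1 <= lower_ratio ^+ k by rewrite exprn_ege1.
have MuJ : mu <= delta * theta s ^+ J.
  apply: le_trans Mu (le_trans _ HJ).
  by rewrite ler_peMr// mulr_ge0// ltW.
rewrite /good_level -/mu; apply/orP; right; apply/andP; split.
  apply: le_trans MuJ _; rewrite ler_wpM2l ?(ltW d0)//.
  by rewrite lerXn2r ?nnegrE ?(ltW (theta_gt0 _))// theta_le.
apply/allP => i iD; have := iD; move=> /mem_detail_block [l [k [/andP[jl lr] kl iE]]].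
have ml0 : 0 <= ml.
  rewrite /ml /M_lower mulr_ge0 ?le_max ?lexx// divr_ge0 ?(ltW e0) ?mulr_ge0//; lra.
have mu0 : 0 <= mu.
  rewrite /mu /M_upper; apply: mulr_ge0; first by apply: divr_ge0 => //; exact: ltW.
  apply: addr_ge0; first by rewrite /amplitude sumr_ge0.
  by apply: mulr_ge0; [lra|exact: ltW].
rewrite /level_of iE /= -iE -/mu -/ml.
have [_ c2 _ _] := cc.
(* One M comes from the coefficient itself, the other from 2 delta, which [small] makes no larger
   than M after weighting even at the end of the block. *)
have bl : theta s ^+ l * (`|chat i| + delta) <= lower_ratio * ml.
  apply: le_trans Ml.
  have h1 : `|chat i| <= `|c i| + delta.
    rewrite -[chat i](subrK (c i)) (le_trans (ler_normD _ _))// addrC lerD2l.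
    exact: Hd.
  have h2 : theta s ^+ l * `|c i| <= M by rewrite iE c2// (leq_trans jj).
  have h3 : theta s ^+ l * (2 * delta) <= M.
    apply: le_trans small; rewrite ler_wpM2r ?mulr_ge0 ?(ltW d0)//.
    by rewrite ler_weXn2l.
  apply: (@le_trans _ _ (theta s ^+ l * (`|c i| + 2 * delta))).
    by rewrite ler_wpM2l ?exprn_ge0 ?(ltW th0)//; lra.
  by rewrite mulrDr; lra.
have thl : 0 < (theta s ^+ l) ^+ J by rewrite !exprn_gt0.
rewrite -(ler_pM2l thl) mulrCA -exprMn.
have b0 : 0 <= theta s ^+ l * (`|chat i| + delta).
  by rewrite mulr_ge0 ?exprn_ge0 ?(ltW th0)// addr_ge0// ltW.
apply: (@le_trans _ _ ((mu / delta) ^+ l * (lower_ratio * ml) ^+ J)).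
  rewrite ler_wpM2l ?exprn_ge0 ?divr_ge0 ?(ltW d0)//.
  by rewrite lerXn2r ?nnegrE// (le_trans b0).
rewrite [(lower_ratio * ml) ^+ J]exprMn mulrA ler_wpM2r ?exprn_ge0//.
apply: (@le_trans _ _ ((mu / delta) ^+ l * (lower_ratio ^+ Cj) ^+ l)).
  rewrite ler_wpM2l ?exprn_ge0 ?divr_ge0 ?(ltW d0)// -exprM ler_weXn2l//.
  by rewrite (leq_trans JC)// leq_mul2l jl orbT.
rewrite -exprMn -exprM mulnC exprM lerXn2r ?nnegrE ?exprn_ge0 ?(ltW th0)//.
  by rewrite mulr_ge0 ?divr_ge0 ?(ltW d0)// exprn_ge0// (le_trans _ lr1).
have key : mu * lower_ratio ^+ Cj <= delta * theta s ^+ J.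
  by apply: le_trans HJ; apply: ler_wpM2r => //; exact: le_trans (lrC Cj).
by rewrite mulrAC ler_pdivrMr// [leRHS]mulrC.
Qed.

End band.

(** * The confidence band *)

Lemma measurable_path_eval (R : realType) (t : R) : t \in `[0, 1] ->
  measurable_fun [set: path_space R] (fun y => (y : R -> R) t).
Proof.
move=> t01 _ A mA; rewrite setTI; apply: sub_sigma_algebra.
by exists t; split => //; exists A.
Qed.

Lemma measurable_first_good d (T : measurableType d) (R : realType)
    (g : T -> pred nat) (F : nat -> T -> R) :
  (forall J, measurable_fun setT (fun y => g y J)) ->
  (forall J, measurable_fun setT (F J)) ->
  forall fuel c, measurable_fun setT (fun y => F (first_good (g y) fuel c) y).
Proof.
move=> mg mF; elim=> [|k IH] c /=; first exact: mF.
rewrite (_ : (fun y => _) = (fun y => if g y c then F c y else F (first_good (g y) k c.+1) y)).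
  by apply: measurable_fun_ifT.
by apply/funext => y; case: ifP.
Qed.

Section procedure.
Context (R : realType) (W : wavelet_system R).
Local Notation j0 := (coarsest W).
Local Notation q := (2 `^ 2^-1 : R).
Variables (C : R) (u : option nat * nat -> R -> R).
Hypothesis C0 : 0 <= C.
Hypothesis locu : forall i, basis_index W i -> localized C (index_level W i) i.2 (u i).
Variables (smin smax eps gamma : R) (rho : nat).
Hypothesis smin0 : 0 < smin.
Hypothesis smin_max : smin <= smax.
Hypothesis eps01 : 0 < eps < 1.

Definition log_size (n : nat) : nat := (trunc_log 2 n).+1.
(** Chosen so that theta(s)^rho <= 2 ^ [block_slope] for s <= s_max. With [block_start] a quarter of
    [log_size] divided by it, the weights theta^l in the block are O(n^(1/4)), and n^(1/4) times the
    noise level tends to 0. The outer successor keeps the divisor positive. *)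
Definition block_slope : nat := (rho * (Num.truncn smax).+2).+1.
Definition block_start (n : nat) : nat := (log_size n %/ (4 * block_slope))%N.
(** With t = 2 ^ [log_size] > n, the factor 4 gives 2^(top/2) = t^2, so that the search succeeds
    below the top whenever the estimate of M is at most n. Lipschitz constants at the top level are
    of order t^6, which the mesh t^-10 of the grid reduces to t^-4. *)
Definition top_level (n : nat) : nat := (4 * log_size n)%N.
Definition grid_level (n : nat) : nat := (10 * log_size n)%N.
Definition noise_const : R := (2 * C + 3) * (3 * C).
(** The path is allowed deviations of 11 log n standard deviations; the additional 1 absorbs the
    discretisation error of the drift for M <= n. *)
Definition noise_level (n : nat) : R :=
  (11 * noise_const + 1) * ln n%:R / Num.sqrt n%:R.
Definition sup_const : R :=
  overlap_const C * (q ^+ j0 + (1 - rate_min smin)^-1).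

Definition coef_est (n : nat) (y : path_space R) (i : option nat * nat) : R :=
  grid_sum (grid_level n) (u i) (y : R -> R).

Definition M_est (n : nat) (y : path_space R) : R :=
  M_upper W smax eps rho (noise_level n) (coef_est n y).

Definition level_est (n : nat) (y : path_space R) : nat :=
  selected_level W smin smax eps rho (noise_level n) (block_start n) (top_level n) (coef_est n y).

Definition projection_est (n J : nat) (y : path_space R) (t : R) : R :=
  \sum_(i <- indices_upto W J) coef_est n y i * u i t.

(** The drift error is known to lie below the noise level only for M <= n. In the other case the
    band is centred at 0, and M <= [M_est] on the good noise event makes the radius at least
    [sup_const * M], a bound for the unknown function. For fixed s and M this case disappears, on
    that event, when n is large. *)
Definition band_radius (n : nat) (y : path_space R) : R :=
  if M_est n y <= n%:R then radius_const C smin * (q ^+ level_est n y * noise_level n)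
  else sup_const * M_est n y.

Definition plain_center (n : nat) (y : path_space R) (t : R) : R :=
  if M_est n y <= n%:R then projection_est n (level_est n y) y t else 0.

(* On an event of probability close to gamma, the band is moved away from the
   target: the fractional part of a Gaussian variable of large variance is
   almost uniform, whatever its mean. *)
Definition displaced (n : nat) (y : path_space R) : bool :=
  `[< periodic_set gamma (n%:R * ((y : R -> R) 1 - (y : R -> R) 0)) >].

Definition band_center (n : nat) (y : path_space R) (t : R) : R :=
  plain_center n y t + if displaced n y then 3 * band_radius n y + 1 else 0.

Lemma noise_const_ge0 : 0 <= noise_const.
Proof. by rewrite /noise_const !mulr_ge0// addr_ge0// mulr_ge0. Qed.

Lemma noise_level_ge0 n : 0 <= noise_level n.
Proof.
have := noise_const_ge0 => D0; apply: divr_ge0 => //; apply: mulr_ge0.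
  by rewrite addr_ge0// mulr_ge0.
by case: n => [|n]; [rewrite ln0|rewrite ln_ge0// ler1n].
Qed.

Lemma sup_const_ge0 : 0 <= sup_const.
Proof.
have /andP[_ r1] := rate_min01 smin0.
apply: mulr_ge0; first exact: overlap_const_ge0.
by rewrite addr_ge0 ?exprn_ge0 ?powR_ge0// invr_ge0 subr_ge0 ltW.
Qed.

Lemma radius_ge0 n y : 0 <= band_radius n y.
Proof.
rewrite /band_radius; case: (leP (M_est n y) n%:R) => [_|h]; last first.
  apply: mulr_ge0; first exact: sup_const_ge0.
  by apply: le_trans (ltW h).
apply: mulr_ge0; first exact: radius_const_ge0.
apply: mulr_ge0; last exact: noise_level_ge0.
by rewrite exprn_ge0// powR_ge0.
Qed.

Lemma lipschitz01_center n y : lipschitz01 (band_center n y).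
Proof.
apply: lipschitz01_add; last exact: lipschitz01_cst.
rewrite /plain_center; case: (M_est n y <= n%:R); last exact: lipschitz01_cst.
exact: lipschitz01_partial C0 locu (coef_est n y) _.
Qed.

Lemma measurable_coef_est n i : measurable_fun setT (fun y => coef_est n y i).
Proof.
rewrite (_ : (fun y => _) = (fun y : path_space R => \sum_(0 <= k < 2 ^ grid_level n)
  if (k < 2 ^ grid_level n)%N then u i (grid R (grid_level n) k) *
    ((y : R -> R) (grid R (grid_level n) k.+1) - (y : R -> R) (grid R (grid_level n) k)) else 0)).
  apply: measurable_sum => k; case: (ltnP k (2 ^ grid_level n)) => kn; last exact: measurable_cst.
  apply: measurable_funM; first exact: measurable_cst.
  by apply: measurable_funB; apply: measurable_path_eval; apply: grid01 => //; exact: ltnW.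
apply/funext => y; rewrite /coef_est /grid_sum [LHS]big_nat_cond [RHS]big_nat_cond.
by apply: eq_bigr => k /andP[/andP[_ kn] _]; rewrite kn.
Qed.

Lemma measurable_amplitude n : measurable_fun setT (fun y => amplitude W rho (coef_est n y)).
Proof.
rewrite /amplitude; apply: measurable_sum => i; apply: measurableT_comp => //.
exact: measurable_coef_est.
Qed.

Lemma measurable_M_est n : measurable_fun setT (M_est n).
Proof.
apply: measurable_funM; first exact: measurable_cst.
by apply: measurable_funD; [exact: measurable_amplitude|exact: measurable_cst].
Qed.

Lemma measurable_all (I : Type) d (T : measurableType d) (s : seq I) (P : I -> T -> bool) :
  (forall i, measurable_fun setT (P i)) ->
  measurable_fun setT (fun y => all (P ^~ y) s).
Proof.
move=> mP; elim: s => [|a s IH] /=; first exact: measurable_cst.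
by apply: measurable_and.
Qed.

Lemma measurable_good_level n J : measurable_fun setT (fun y =>
  good_level W smin smax eps rho (noise_level n) (block_start n) (coef_est n y) J).
Proof.
have mM := measurable_M_est n; rewrite /M_est in mM.
apply: measurable_or.
  by apply: measurable_fun_ler => //; exact: measurable_cst.
apply: measurable_and; first by apply: measurable_fun_ler => //; exact: measurable_cst.
apply: measurable_all => i; apply: measurable_fun_ler.
  apply: measurable_funM.
    by apply: measurable_funX; apply: measurable_funM => //; exact: measurable_cst.
  apply: measurable_funX; apply: measurable_funD; last exact: measurable_cst.
  by apply: measurableT_comp => //; exact: measurable_coef_est.
apply: measurable_funX; apply: measurable_funM; first exact: measurable_cst.
apply: measurable_maxr; first exact: measurable_cst.
by apply: measurable_funB; [exact: measurable_amplitude|exact: measurable_cst].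
Qed.

Lemma measurable_radius n : measurable_fun setT (band_radius n).
Proof.
apply: measurable_fun_ifT.
- by apply: measurable_fun_ler; [exact: measurable_M_est|exact: measurable_cst].
- apply: (measurable_first_good (F := fun J _ => radius_const C smin * (q ^+ J * noise_level n))).
    exact: measurable_good_level.
  by move=> J; exact: measurable_cst.
- by apply: measurable_funM; [exact: measurable_cst|exact: measurable_M_est].
Qed.

Lemma measurable_displaced n : measurable_fun setT (displaced n).
Proof.
apply: (@measurable_fun_bool _ _ _ _ true).
rewrite setTI (_ : _ @^-1` _ = (fun y : path_space R => n%:R * ((y : R -> R) 1 - (y : R -> R) 0)) @^-1` periodic_set gamma); last first.
  by apply/seteqP; split => y /=; rewrite /displaced => /asboolP.
rewrite -[X in measurable X]setTI.
have : measurable_fun setT (fun y : path_space R => n%:R * ((y : R -> R) 1 - (y : R -> R) 0)).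
  apply: measurable_funM; first exact: measurable_cst.
  by apply: measurable_funB; apply: measurable_path_eval; rewrite in_itv/= lexx ler01.
by apply => //; exact: measurable_periodic_set.
Qed.

Lemma measurable_center n t : measurable_fun setT (fun y => band_center n y t).
Proof.
apply: measurable_funD.
  apply: measurable_fun_ifT; last exact: measurable_cst.
    by apply: measurable_fun_ler; [exact: measurable_M_est|exact: measurable_cst].
  apply: (measurable_first_good (F := fun J y => projection_est n J y t)).
    exact: measurable_good_level.
  move=> J; apply: measurable_sum => i; apply: measurable_funM; last exact: measurable_cst.
  exact: measurable_coef_est.
apply: measurable_fun_ifT; [exact: measurable_displaced| |exact: measurable_cst].
apply: measurable_funD; last exact: measurable_cst.
by apply: measurable_funM; [exact: measurable_cst|exact: measurable_radius].
Qed.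

Lemma procedure_is_band_procedure : is_band_procedure band_center band_radius.
Proof.
move=> n; split.
- by move=> y; apply: lipschitz01_continuous; exact: lipschitz01_center.
- by move=> t _; exact: measurable_center.
- exact: radius_ge0.
- exact: measurable_radius.
Qed.

End procedure.

(** * Brownian increments *)

Lemma measurable_bigsetU (I : Type) d (T : measurableType d) (s : seq I) (A : I -> set T) :
  (forall i, measurable (A i)) -> measurable (\big[setU/set0]_(i <- s) A i).
Proof.
move=> mA; elim: s => [|a s IH]; first by rewrite big_nil; exact: measurable0.
by rewrite big_cons; exact: measurableU.
Qed.

Lemma measure_bigsetU_le (I : eqType) d (T : measurableType d) (R : realType)
    (P : probability T R) (s : seq I) (A : I -> set T) (b : I -> R) :
  (forall i, measurable (A i)) -> (forall i, i \in s -> (P (A i) <= (b i)%:E)%E) ->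
  (P (\big[setU/set0]_(i <- s) A i) <= (\sum_(i <- s) b i)%:E)%E.
Proof.
move=> mA; elim: s => [|a s IH] H; first by rewrite !big_nil measure0.
rewrite !big_cons EFinD; apply: le_trans (measureU2 _ _ _) _ => //.
  exact: measurable_bigsetU.
apply: leeD; first by apply: H; rewrite mem_head.
by apply: IH => i si; apply: H; rewrite in_cons si orbT.
Qed.

Section brownian.
Context (R : realType) (d : measure_display) (T : measurableType d)
  (P : probability T R) (B : R -> {RV P >-> R}).
Hypothesis hB : standard_brownian_motion B.
Local Notation q := (2 `^ 2^-1 : R).

Definition good_noise (m : nat) (x : R) : set T :=
  [set w | dyadic_modulus m x (fun t => B t w)].

Let large_increment (x : R) (l k : nat) : set T :=
  [set w | x * q ^- l < `|B (grid R l k.+1) w - B (grid R l k) w|].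

Let measurable_large_increment x l k : measurable (large_increment x l k).
Proof.
rewrite -[large_increment x l k]setTI.
apply: measurable_fun_ltr => //.
apply: measurableT_comp => //; apply: measurable_funB; exact: measurable_funPT.
Qed.

Let bad_noiseE m x : ~` good_noise m x =
  \big[setU/set0]_(l <- iota 0 m.+1) \big[setU/set0]_(k <- iota 0 (2 ^ l)) large_increment x l k.
Proof.
rewrite -bigcup_seq; apply/seteqP; split => w.
  move=> /existsNP [l] /existsNP [k] /not_implyP [lm] /not_implyP [kl] /negP.
  rewrite -ltNge => h; exists l; first by change (l \in iota 0 m.+1); rewrite mem_iota.
  by rewrite -bigcup_seq; exists k => //; change (k \in iota 0 (2 ^ l)); rewrite mem_iota.
move=> [l lm]; have {}lm : l \in iota 0 m.+1 by exact: lm.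
rewrite -bigcup_seq => -[k kl h] H; have {}kl : k \in iota 0 (2 ^ l) by exact: kl.
rewrite mem_iota ltnS in lm; rewrite mem_iota in kl.
by have := H l k lm kl; rewrite leNgt h.
Qed.

Lemma measurable_good_noise m x : measurable (good_noise m x).
Proof.
rewrite -[good_noise m x]setCK bad_noiseE; apply: measurableC.
by apply: measurable_bigsetU => l; apply: measurable_bigsetU.
Qed.

Lemma increment_law (s t : R) (A : set R) : 0 <= s -> s < t -> t <= 1 -> measurable A ->
  P [set w | A (B t w - B s w)] = normal_prob 0 (Num.sqrt (t - s)) A.
Proof. by case: hB => _ _ H _ s0 st t1 mA; exact: H. Qed.

(** An increment at level l has standard deviation q^-l, so all events share one tail bound; there
    are 2^(m+1) - 1 of them. *)
Lemma bad_noise_le m x : 0 <= x ->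
  (P (~` good_noise m x) <= (2 ^+ m.+1 * (2 * expR (2^-1 - x)))%:E)%E.
Proof.
move=> x0; rewrite bad_noiseE; set b := 2 * expR _.
have b0 : 0 <= b by rewrite mulr_ge0// expR_ge0.
apply: (@le_trans _ _ (\sum_(l <- iota 0 m.+1) (2 ^+ l * b))%:E).
  apply: measure_bigsetU_le; first by move=> l; apply: measurable_bigsetU.
  move=> l _.
  apply: (@le_trans _ _ (\sum_(k <- iota 0 (2 ^ l)) b)%:E).
    apply: measure_bigsetU_le => // k; rewrite mem_iota /= add0n => kl.
    have g0 : grid R l k.+1 - grid R l k = 2 ^- l.
      by rewrite /grid -mulrBl -natr1 addrAC subrr add0r mul1r.
    have := grid01 R (ltnW kl); have := grid01 R kl; rewrite !in_itv/= => /andP[_ g1] /andP[g2 _].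
    have sE : Num.sqrt (2 ^- l) = q ^- l :> R.
      have -> : 2 ^- l = (q ^- l) ^+ 2 :> R.
        by rewrite exprVn -exprM mulnC exprM powR2_half.
      by rewrite sqrtr_sqr ger0_norm// invr_ge0 exprn_ge0// powR_ge0.
    have ql : 0 < q ^- l by rewrite invr_gt0 exprn_gt0// powR_gt0.
    have gl : grid R l k < grid R l k.+1 by rewrite -subr_gt0 g0 invr_gt0 exprn_gt0.
    have := @increment_law (grid R l k) (grid R l k.+1) [set z | x * q ^- l < `|z|] g2 gl g1.
    rewrite g0 sE => ->; first exact: normal_tail.
    rewrite -[X in measurable X]setTI; apply: measurable_fun_ltr => //.
  rewrite lee_fin big_const_seq count_predT size_iota iter_addr addr0 -[b *+ _]mulr_natl.
  by rewrite natrX.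
rewrite lee_fin -mulr_suml ler_wpM2r//.
have : \sum_(l <- iota 0 m.+1) (2 : R) ^+ l = 2 ^+ m.+1 - 1.
  elim: m => [|k IH]; first by rewrite big_seq1 expr0 expr1; lra.
  have -> : iota 0 k.+2 = iota 0 k.+1 ++ [:: k.+1] by rewrite -[in LHS]addn1 iotaD.
  by rewrite big_cat/= big_seq1 IH (exprS _ k.+1); lra.
by move=> ->; rewrite gerBl.
Qed.

End brownian.

(** * Estimation error and radius for a regular noise path *)

Section deterministic.
Context (R : realType) (W : wavelet_system R).
Local Notation j0 := (coarsest W).
Local Notation q := (2 `^ 2^-1 : R).
Local Notation I01 := (`[0, 1]%classic : set R).
Variables (C : R) (u : option nat * nat -> R -> R).
Hypothesis C0 : 0 <= C.
Hypothesis locu : forall i, basis_index W i -> localized C (index_level W i) i.2 (u i).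
Hypothesis basis_u : orthonormal_basis I01 (basis_index W) u.
Variables (smin smax eps gamma : R) (rho : nat).
Hypothesis smin0 : 0 < smin.
Hypothesis smin_max : smin <= smax.
Hypothesis eps01 : 0 < eps < 1.

Definition drift_const (n : nat) : R :=
  C * q ^+ top_level n * 2 ^+ top_level n * sup_const W C smin / 2 ^+ grid_level n.
Definition raw_noise (n : nat) : R := 11 * noise_const C * ln n%:R / Num.sqrt n%:R.

(** All that coverage requires of n. Nothing here mentions f, s or M, which is what makes coverage
    uniform over the union of the classes. *)
Record large_sample (n : nat) : Prop := LargeSample {
  ls_first : (rho * j0 <= top_level n)%N;
  ls_top : (j0 < top_level n)%N;
  ls_start : (j0 < block_start smax rho n)%N;
  ls_ln : 0 < ln (n%:R : R);
  ls_drift : n_low W rho * drift_const n <= c_low W smax eps rho / 2;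
  ls_drift_n : drift_const n * n%:R <= ln n%:R / Num.sqrt n%:R;
  ls_level : n%:R <= noise_level C n * q ^+ (top_level n).-1 }.

Variables (n : nat).
Hypothesis hn : large_sample n.

Lemma large_sample_gt0 : 0 < n%:R :> R.
Proof. by rewrite ltr0n lt0n; apply/negP => /eqP E; have := ls_ln hn; rewrite E ln0// ltxx. Qed.

Lemma noise_level_gt0 : 0 < noise_level C n.
Proof.
rewrite /noise_level divr_gt0 ?sqrtr_gt0 ?large_sample_gt0// mulr_gt0 ?(ls_ln hn)//.
by rewrite ltr_wpDl// mulr_ge0// noise_const_ge0.
Qed.

Lemma noise_levelE : noise_level C n = raw_noise n + ln n%:R / Num.sqrt n%:R.
Proof. by rewrite /noise_level /raw_noise; ring. Qed.

Lemma drift_const_ge0 : 0 <= drift_const n.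
Proof.
rewrite /drift_const divr_ge0 ?exprn_ge0//; apply: mulr_ge0; last exact: sup_const_ge0.
by rewrite !mulr_ge0// exprn_ge0// powR_ge0.
Qed.

Lemma detail_block_top i : i \in detail_block rho (block_start smax rho n) ->
  basis_index W i /\ (index_level W i <= top_level n)%N.
Proof.
move=> /mem_detail_block [l [k [/andP[jl lr] kl ->]]].
have jl0 : (j0 <= l)%N by apply: leq_trans jl; exact: ltnW (ls_start hn).
split => //; rewrite /index_level/=; apply: leq_trans lr _.
have : (rho * block_start smax rho n <= log_size n)%N.
  rewrite /block_start; apply: leq_trans (leq_divM (log_size n) (4 * block_slope smax rho)).
  rewrite mulnC leq_mul2l; apply/orP; right.
  by rewrite /block_slope; apply: (@leq_trans (rho * (Num.truncn smax).+2)); [rewrite leq_pmulr|lia].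
by move=> h; apply: leq_trans h _; rewrite /top_level; lia.
Qed.

Lemma first_block_top i : i \in first_block W rho ->
  basis_index W i /\ (index_level W i <= top_level n)%N.
Proof.
move=> /mem_indices_upto [Ii h]; split => //.
move: h; rewrite /index_level; case: i.1 => [l h|_]; last exact: ltnW (ls_top hn).
exact: leq_trans h (ls_first hn).
Qed.

Variables (s M : R) (f g B : R -> R).
Hypothesis s_range : smin <= s <= smax.
Hypothesis M0 : 0 < M.
Hypothesis Lf : in_L2 I01 f.
Hypothesis coef_f : class_coef W smax eps rho s M (fun i => ip I01 f (u i)).
Hypothesis cg : {within `[0, 1], continuous g}.
Hypothesis gf : {ae @lebesgue_measure R, forall x, x \in `[0, 1] -> g x = f x}.
Hypothesis g_tail : forall J x, x \in `[0, 1] ->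
  `|g x - \sum_(i <- indices_upto W J) ip I01 f (u i) * u i x|
   <= M * overlap_const C / (1 - 2 `^ (- s)) * (2 `^ (- s)) ^+ J.
Hypothesis g_bound : forall x, x \in `[0, 1] -> `|g x| <= sup_const W C smin * M.
Hypothesis modB : dyadic_modulus (grid_level n) (11 * ln n%:R) B.

Let y : path_space R :=
  fun t => \int[@lebesgue_measure R]_(v in `[0, t]) f v + (Num.sqrt n%:R)^-1 * B t.

Lemma coef_est_error i : basis_index W i -> (index_level W i <= top_level n)%N ->
  `|coef_est u n y i - ip I01 f (u i)| <= raw_noise n + drift_const n * M.
Proof.
move=> Ii itop.
have x0 : 0 <= 11 * ln n%:R :> R by rewrite mulr_ge0// ltW// (ls_ln hn).
have G0 : 0 <= sup_const W C smin * M by rewrite mulr_ge0 ?sup_const_ge0// ltW.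
have sn0 : 0 <= (Num.sqrt n%:R : R)^-1 by rewrite invr_ge0 sqrtr_ge0.
have im : (index_level W i <= grid_level n)%N.
  by apply: leq_trans itop _; rewrite /top_level /grid_level leq_mul2r orbT.
have [mf _] := Lf.
have := grid_sum_observation C0 x0 G0 sn0 im (locu Ii) modB cg gf mf g_bound.
move/le_trans; apply; apply: lerD.
  by rewrite le_eqVlt; apply/orP; left; apply/eqP; rewrite /raw_noise /noise_const; ring.
rewrite (_ : drift_const n * M = C * q ^+ top_level n * 2 ^+ top_level n *
  (sup_const W C smin * M) / 2 ^+ grid_level n); last by rewrite /drift_const; ring.
apply: ler_wpM2r; first by rewrite invr_ge0 exprn_ge0.
apply: ler_wpM2r => //.
have q1 : 1 <= q by have := powR2_half_ge R; lra.
apply: ler_pM; rewrite ?mulr_ge0 ?exprn_ge0 ?powR_ge0//; last by rewrite ler_weXn2l// ler1n.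
by rewrite ler_wpM2l// ler_weXn2l.
Qed.

Lemma M_le_est : M <= M_est W C u smax eps rho n y.
Proof.
apply: (M_upper_ge eps01 M0 coef_f (d0 := raw_noise n) (eta := drift_const n)).
- by rewrite noise_levelE lerDl divr_ge0 ?sqrtr_ge0// ltW// (ls_ln hn).
- by move=> i /first_block_top [Ii itop]; exact: coef_est_error.
- exact: ls_drift hn.
Qed.

Lemma coef_est_noise i : M <= n%:R -> basis_index W i -> (index_level W i <= top_level n)%N ->
  `|coef_est u n y i - ip I01 f (u i)| <= noise_level C n.
Proof.
move=> Mn Ii itop; apply: le_trans (coef_est_error Ii itop) _.
rewrite noise_levelE lerD2l; apply: le_trans (ls_drift_n hn).
by rewrite ler_wpM2l// drift_const_ge0.
Qed.

Lemma level_est_bounds : (j0 <= level_est W C u smin smax eps rho n y <= top_level n)%N.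
Proof.
rewrite /level_est /selected_level; have /andP[h1 h2] := first_good_bounds
  (good_level W smin smax eps rho (noise_level C n) (block_start smax rho n) (coef_est u n y))
  (top_level n - j0) j0.
by rewrite h1 (leq_trans h2)// subnKC// ltnW// (ls_top hn).
Qed.

(** If [M_est] > n, the crude band covers because M <= [M_est]. Otherwise M <= n, every relevant
    coefficient is known up to the noise level, and soundness of the level test balances bias
    against noise. *)
Lemma center_error x : x \in `[0, 1] ->
  `|g x - plain_center W C u smin smax eps rho n y x| <= band_radius W C u smin smax eps rho n y.
Proof.
move=> x01; rewrite /plain_center /band_radius.
case: (leP (M_est W C u smax eps rho n y) n%:R) => [small|large]; last first.
  rewrite subr0; apply: le_trans (g_bound x01) _.
  by apply: ler_wpM2l; [exact: sup_const_ge0|exact: M_le_est].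
have Mn : M <= n%:R by exact: le_trans M_le_est small.
have /andP[jJ Jt] := level_est_bounds; set J := level_est W C u smin smax eps rho n y in jJ Jt *.
have d0 := noise_level_gt0.
have goodJ : good_level W smin smax eps rho (noise_level C n) (block_start smax rho n) (coef_est u n y) J.
  (* The end of the search is returned untested, so a passing level strictly below it must be
     exhibited: hence the predecessor here and in [ls_level]. *)
  rewrite /J /level_est /selected_level; apply: (first_good_good (J := (top_level n).-1)).
    by have := ls_top hn; case: (top_level n) => // t jt; rewrite (subnKC (ltnW jt)) /= ltnSn andbT -ltnS.
  apply: good_level_exists => //; last exact: ltW.
  exact: le_trans small (ls_level hn).
have MJ : M <= noise_level C n * theta s ^+ J.
  apply: (good_level_theta smin0 eps01 s_range M0 d0 (ls_start hn) coef_f _ _ M_le_est goodJ).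
  - by move=> i /first_block_top [Ii itop]; exact: coef_est_noise.
  - by move=> i /detail_block_top [Ii itop]; exact: coef_est_noise.
case/andP: (s_range) => s1 _.
apply: (estimate_error C0 locu smin0 s1 (ltW M0) d0 jJ MJ (c := fun i => ip I01 f (u i))) => //.
- move=> i /mem_indices_upto [Ii h]; apply: coef_est_noise => //.
  move: h; rewrite /index_level; case: i.1 => [l h|_]; last exact: ltnW (ls_top hn).
  exact: leq_trans h Jt.
- by move=> z z01; exact: g_tail.
Qed.

Lemma radius_size (J Cj : nat) :
  M <= n%:R -> upper_ratio W smax eps rho * M <= n%:R ->
  noise_level C n <= M -> 4 * n_low W rho * noise_level C n <= c_low W smax eps rho * M ->
  theta s ^+ (rho * block_start smax rho n) * (2 * noise_level C n) <= M ->
  (j0 <= J <= Cj * block_start smax rho n)%N ->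
  upper_ratio W smax eps rho * M * lower_ratio W smax eps rho ^+ Cj <= noise_level C n * theta s ^+ J ->
  band_radius W C u smin smax eps rho n y <= radius_const C smin * (q ^+ J * noise_level C n).
Proof.
move=> Mn uMn dM dM4 small /andP[jJ JC] HJ.
have d0 := noise_level_gt0; case/andP: (s_range) => s1 s2.
have Hf i : i \in first_block W rho -> `|coef_est u n y i - ip I01 f (u i)| <= noise_level C n.
  by move=> /first_block_top [Ii itop]; exact: coef_est_noise.
have Hd i : i \in detail_block rho (block_start smax rho n) ->
    `|coef_est u n y i - ip I01 f (u i)| <= noise_level C n.
  by move=> /detail_block_top [Ii itop]; exact: coef_est_noise.
have Me : M_est W C u smax eps rho n y <= n%:R.
  by apply: le_trans uMn; exact: (M_upper_le smin0 eps01 s1 M0 coef_f Hf dM).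
rewrite /band_radius Me; apply: ler_wpM2l; first exact: radius_const_ge0.
rewrite ler_wpM2r ?(ltW d0)// ler_weXn2l//; first by have := powR2_half_ge R; lra.
rewrite /level_est /selected_level; apply: first_good_min => //.
apply: (good_level_size smin0 eps01 s_range M0 d0 _ coef_f Hf Hd dM dM4 small JC _ HJ).
- exact: ltnW (ls_start hn).
- exact: leq_trans (ls_start hn).
Qed.

End deterministic.

(** * Asymptotics in n *)

Lemma near_ln_ge (R : realType) (K : R) : \forall n \near \oo, K <= ln n%:R.
Proof.
near=> n; have h : expR K <= n%:R by near: n; exact: nbhs_infty_ger.
have n0 : 0 < n%:R :> R by apply: lt_le_trans h; exact: expR_gt0.
by rewrite -[K]expRK ler_ln ?posrE ?expR_gt0.
Unshelve. all: by end_near. Qed.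

(** With t the eighth root of n, all rates become natural powers of t: sqrt n = t^4, log n <= 8 t,
    the noise level is O(t^-3) and the weights in the high block are O(t^2), so that their product
    is O(1/t). *)
Lemma root8 (R : realType) (n : nat) : (n%:R `^ 8^-1) ^+ 8 = n%:R :> R.
Proof. by rewrite -powR_mulrn ?powR_ge0// -powRrM mulVf// powRr1. Qed.

Lemma sqrt_root8 (R : realType) (n : nat) : Num.sqrt n%:R = (n%:R `^ 8^-1) ^+ 4 :> R.
Proof.
by rewrite -[n%:R in LHS]root8 (_ : 8 = 4 * 2)%N// exprM sqrtr_sqr ger0_norm// exprn_ge0// powR_ge0.
Qed.

Lemma near_root8_ge (R : realType) (K : R) : \forall n \near \oo, K <= n%:R `^ 8^-1.
Proof.
near=> n; have h : (Num.max 0 K) ^+ 8 <= n%:R by near: n; exact: nbhs_infty_ger.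
apply: (@le_trans _ _ (Num.max 0 K)); first by rewrite le_max lexx orbT.
by rewrite -(@ler_pXn2r _ 8)// ?nnegrE ?powR_ge0 ?le_max ?lexx// root8.
Unshelve. all: by end_near. Qed.

Lemma ln_le_root8 (R : realType) (n : nat) : (0 < n)%N -> ln n%:R <= 8 * n%:R `^ 8^-1 :> R.
Proof.
move=> n0; have t0 : 0 < n%:R `^ 8^-1 :> R by rewrite powR_gt0// ltr0n.
have -> : ln n%:R = 8 * ln (n%:R `^ 8^-1) :> R by rewrite ln_powR mulrA divff// mul1r.
rewrite ler_wpM2l//; have := expR_ge1Dx (ln (n%:R `^ 8^-1) : R).
by rewrite lnK ?posrE//; lra.
Qed.

Lemma log_size_gt n : (n < 2 ^ log_size n)%N.
Proof. exact: trunc_log_ltn. Qed.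

Lemma log_size_le n : (0 < n)%N -> (2 ^ log_size n <= 2 * n)%N.
Proof. by move=> n0; rewrite /log_size expnS leq_mul2l/= trunc_logP. Qed.

Lemma near_log_size_ge (k : nat) : \forall n \near \oo, (k <= log_size n)%N.
Proof.
near=> n; have h : (2 ^ k <= n)%N by near: n; exact: nbhs_infty_ge.
by rewrite -(leq_exp2l (m := 2))//; apply: leq_trans h (ltnW (log_size_gt n)).
Unshelve. all: by end_near. Qed.

Section asymptotics.
Context (R : realType) (W : wavelet_system R).
Local Notation j0 := (coarsest W).
Local Notation q := (2 `^ 2^-1 : R).
Variables (C smin smax eps : R) (rho : nat).
Hypothesis C0 : 0 <= C.
Hypothesis smin0 : 0 < smin.
Hypothesis smin_max : smin <= smax.
Hypothesis eps01 : 0 < eps < 1.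

Lemma powR2_half_top n : q ^+ top_level n = (2 ^+ log_size n) ^+ 2.
Proof.
by rewrite /top_level (_ : 4 * log_size n = 2 * (log_size n * 2))%N ?exprM ?powR2_half// mulnCA mulnC; congr muln.
Qed.

Lemma drift_constE n :
  drift_const W C smin n = C * sup_const W C smin / (2 ^+ log_size n) ^+ 4.
Proof.
rewrite /drift_const powR2_half_top /top_level /grid_level ![(_ * log_size n)%N]mulnC !exprM.
set z := 2 ^+ log_size n; have z0 : z != 0 by rewrite expf_neq0.
by field; rewrite z0.
Qed.

Lemma noise_level_ge n : ln n%:R / Num.sqrt n%:R <= noise_level C n.
Proof.
have L0 : 0 <= ln n%:R :> R by case: n => [|n]; [rewrite ln0|rewrite ln_ge0// ler1n].
rewrite /noise_level ler_wpM2r ?invr_ge0 ?sqrtr_ge0// mulrDl mul1r lerDr.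
apply: mulr_ge0 => //; apply: mulr_ge0 => //; exact: noise_const_ge0.
Qed.

Lemma large_sample_near : \forall n \near \oo, large_sample W C smin smax eps rho n.
Proof.
have cl := c_low_gt0 W smax rho eps01; have nl := n_low_ge1 W rho.
have sc : 0 <= C * sup_const W C smin by rewrite mulr_ge0 ?sup_const_ge0.
set K := C * sup_const W C smin in sc.
near=> n.
have n1 : (1 <= n)%N by near: n; exact: nbhs_infty_ge.
have N1 : 1 <= n%:R :> R by rewrite ler1n.
have L2 : 2 <= ln n%:R :> R by near: n; exact: near_ln_ge.
have p1 : ((rho * j0).+1 + j0.+1 * (4 * block_slope smax rho) <= log_size n)%N.
  by near: n; exact: near_log_size_ge.
have NK : K * n_low W rho * 2 / c_low W smax eps rho <= n%:R by near: n; exact: nbhs_infty_ger.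
have LK : K <= ln n%:R by near: n; exact: near_ln_ge.
have pN : n%:R <= 2 ^+ log_size n :> R by rewrite -natrX ler_nat ltnW// log_size_gt.
have z0 : 0 < 2 ^+ log_size n :> R by rewrite exprn_gt0.
have sq0 : 0 < Num.sqrt n%:R :> R by rewrite sqrtr_gt0; lra.
have sqN : Num.sqrt n%:R ^+ 2 = n%:R :> R by rewrite sqr_sqrtr.
have sq1 : 1 <= Num.sqrt n%:R :> R.
  by rewrite -(@ler_pXn2r _ 2)// ?nnegrE ?ler01 ?(ltW sq0)// sqN expr1n.
have sqn : Num.sqrt n%:R <= n%:R :> R by rewrite -[leRHS]sqN expr2 ler_peMl// ltW.
have drift : drift_const W C smin n <= K / n%:R ^+ 2.
  rewrite drift_constE -/K ler_wpM2l// lef_pV2 ?posrE ?exprn_gt0//; last by lra.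
  rewrite -[leLHS]mulr1 (_ : 4 = 2 + 2)%N// exprD ler_pM ?exprn_ge0//.
    by rewrite lerXn2r ?nnegrE ?(ltW z0).
  by rewrite exprn_ege1// (le_trans N1).
split.
- apply: leq_trans (leq_pmull _ _) => //; apply: leq_trans p1.
  by rewrite addSn leqW// leq_addr.
- apply: leq_trans (leq_pmull _ _) => //; apply: leq_trans p1.
  by apply: leq_trans (leq_addl _ _); rewrite leq_pmulr// muln_gt0.
- rewrite /block_start leq_divRL ?muln_gt0//.
  by apply: leq_trans p1; exact: leq_addl.
- by lra.
- apply: (@le_trans _ _ (n_low W rho * (K / n%:R ^+ 2))).
    by rewrite ler_wpM2l//; exact: drift.
  apply: (@le_trans _ _ (n_low W rho * (K / n%:R))).
    rewrite ler_wpM2l//.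
    rewrite ler_wpM2l// lef_pV2 ?posrE ?exprn_gt0 ?ltr0n//.
    by rewrite expr2 ler_peMl// ltW// ltr0n.
  rewrite mulrA ler_pdivrMr ?ltr0n//.
  move: NK; rewrite ler_pdivrMr//; lra.
- apply: (@le_trans _ _ (K / n%:R ^+ 2 * n%:R)); first by rewrite ler_wpM2r.
  have -> : K / n%:R ^+ 2 * n%:R = K / n%:R by field; rewrite gt_eqF// ltr0n.
  by rewrite ler_pM ?invr_ge0// lef_pV2 ?posrE// ltr0n.
(* As q <= 2, the power q^(top - 1) is at least n^2 / 2; the noise level is at least 2 / sqrt n, and
   n^2 / sqrt n >= n. *)
- have q2 : 0 < q <= 2.
    rewrite powR_gt0//= -[leRHS]powRr1// ler_powR ?ler1n//; lra.
  have top : q * q ^+ (top_level n).-1 = (2 ^+ log_size n) ^+ 2.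
    by rewrite -powR2_half_top -exprS prednK// /top_level muln_gt0.
  case/andP: q2 => q0 q2.
  have h1 : n%:R ^+ 2 <= 2 * q ^+ (top_level n).-1.
    apply: (@le_trans _ _ ((2 ^+ log_size n) ^+ 2)).
      by rewrite lerXn2r ?nnegrE ?(ltW z0).
    by rewrite -top ler_wpM2r// exprn_ge0// ltW.
  apply: (@le_trans _ _ (ln n%:R / Num.sqrt n%:R * q ^+ (top_level n).-1)); last first.
    by rewrite ler_wpM2r ?noise_level_ge// exprn_ge0// ltW.
  rewrite mulrAC ler_pdivlMr//.
  apply: (@le_trans _ _ (2 * q ^+ (top_level n).-1)); last first.
    by rewrite ler_wpM2r// exprn_ge0// ltW.
  by apply: le_trans h1; rewrite expr2 ler_wpM2l.
Unshelve. all: by end_near. Qed.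

End asymptotics.

(** * Noise level, high block and rate for a fixed class *)

Section sizes.
Context (R : realType) (W : wavelet_system R).
Local Notation j0 := (coarsest W).
Local Notation q := (2 `^ 2^-1 : R).
Variables (C smin smax eps : R) (rho : nat).
Hypothesis C0 : 0 <= C.
Hypothesis smin0 : 0 < smin.
Hypothesis smin_max : smin <= smax.
Hypothesis eps01 : 0 < eps < 1.

Let K6 : R := 11 * noise_const C + 1.

Let K6_ge1 : 1 <= K6.
Proof. by rewrite /K6 lerDr mulr_ge0//; exact: noise_const_ge0. Qed.

Lemma noise_level_root8 n : (0 < n)%N ->
  noise_level C n * (n%:R `^ 8^-1) ^+ 3 <= 8 * K6.
Proof.
move=> n0; have t0 : 0 < n%:R `^ 8^-1 :> R by rewrite powR_gt0// ltr0n.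
have K1 := K6_ge1; have K0 : 0 <= K6 by lra.
have L := @ln_le_root8 R n n0.
rewrite /noise_level -/K6 sqrt_root8; set t := n%:R `^ 8^-1 in t0 L *.
have tz : t != 0 by rewrite gt_eqF.
have -> : K6 * ln n%:R / t ^+ 4 * t ^+ 3 = K6 * (ln n%:R / t) by field.
by rewrite mulrC ler_wpM2r// ler_pdivrMr.
Qed.

Lemma near_noise_level_le (e : R) : 0 < e -> \forall n \near \oo, noise_level C n <= e.
Proof.
move=> e0; have K1 := K6_ge1; near=> n.
have n0 : (0 < n)%N by near: n; exact: nbhs_infty_gt.
have t1 : 1 <= n%:R `^ 8^-1 :> R by near: n; exact: near_root8_ge.
have t2 : 8 * K6 / e <= n%:R `^ 8^-1 by near: n; exact: near_root8_ge.
have H := noise_level_root8 n0.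
set t := n%:R `^ 8^-1 in t1 t2 H *.
have t0 : 0 < t by lra.
rewrite -(@ler_pM2r _ (t ^+ 3)) ?exprn_gt0//; apply: le_trans H _.
move: t2; rewrite ler_pdivrMr// => /le_trans; apply.
rewrite mulrC ler_wpM2l ?(ltW e0)// exprS ler_peMr ?(ltW t0)// exprn_ege1//.
Unshelve. all: by end_near. Qed.

Lemma theta_slope (s : R) : s <= smax -> theta s ^+ rho <= 2 ^+ block_slope smax rho.
Proof.
move=> ss; have s0 : 0 <= smax by apply: ltW; exact: lt_le_trans smin_max.
have h : theta s <= 2 ^+ (Num.truncn smax).+2.
  rewrite -powR_mulrn// /theta ler_powR ?ler1n//.
  have := truncnS_gt smax.
  rewrite -[X in _ -> _ <= X](natr1 (Num.truncn smax).+1); lra.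
apply: (@le_trans _ _ ((2 ^+ (Num.truncn smax).+2) ^+ rho)).
  by rewrite lerXn2r ?nnegrE ?(ltW (theta_gt0 _)).
by rewrite -exprM mulnC ler_weXn2l ?ler1n// /block_slope.
Qed.

(** The fourth power of the left side is at most 2 to the power 4 [block_slope] [block_start], hence
    at most 2 ^ [log_size] <= 2 n. *)
Lemma theta_block (s : R) n : s <= smax -> (0 < n)%N ->
  theta s ^+ (rho * block_start smax rho n) <= 2 * (n%:R `^ 8^-1) ^+ 2.
Proof.
move=> ss n0; have t0 : 0 < n%:R `^ 8^-1 :> R by rewrite powR_gt0// ltr0n.
have tE := @root8 R n; set t := n%:R `^ 8^-1 in t0 tE *.
have h0 := theta_gt0 s.
rewrite -(@ler_pXn2r _ 4)// ?nnegrE ?mulr_ge0 ?exprn_ge0 ?(ltW t0) ?(ltW h0)//.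
rewrite exprM; apply: (@le_trans _ _ (((2 ^+ block_slope smax rho) ^+ block_start smax rho n) ^+ 4)).
  rewrite !lerXn2r ?nnegrE ?exprn_ge0 ?(ltW h0)//; exact: theta_slope.
rewrite -!exprM exprMn -exprM (_ : 2 * 4 = 8)%N// tE.
have h1 : (block_slope smax rho * (block_start smax rho n * 4) <= log_size n)%N.
  by rewrite mulnCA mulnA mulnAC -mulnA leq_divM.
apply: (@le_trans _ _ (2 ^+ log_size n)); first by rewrite ler_weXn2l// ?ler1n.
apply: (@le_trans _ _ ((2 * n)%N%:R)); first by rewrite -natrX ler_nat log_size_le.
by rewrite natrM ler_wpM2r//; lra.
Qed.

(** For slope a and start b >= 1, [log_size] < 4 a (b + 1) <= 8 a b, and the top level is four times
    [log_size]. *)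
Lemma top_level_block n : (0 < block_start smax rho n)%N ->
  (top_level n <= 32 * block_slope smax rho * block_start smax rho n)%N.
Proof.
have a0 : (0 < 4 * block_slope smax rho)%N by rewrite muln_gt0.
have := ltn_ceil (log_size n) a0; rewrite /top_level /block_start.
set b := (_ %/ _)%N; set a := block_slope smax rho => h b0.
have : (a <= a * b)%N by rewrite leq_pmulr.
move: h; rewrite (_ : b.+1 * (4 * a) = 4 * (a * b) + 4 * a)%N; last by rewrite mulSn; lia.
by rewrite -mulnA; move: (a * b)%N => ab; lia.
Qed.

Section fixed_class.
Variables (s M : R).
Hypothesis s_range : smin <= s <= smax.
Hypothesis M0 : 0 < M.

Let a : R := (2 * s + 1)^-1.
Let s0 : 0 < s. Proof. by case/andP: s_range => h _; exact: lt_le_trans h. Qed.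

Let theta_a : theta s `^ a = q.
Proof.
rewrite /theta -powRrM; congr (_ `^ _); rewrite /a.
have h : 2 * s + 1 != 0 by have := s0; lra.
by field.
Qed.

(** Since theta^a = q, q^J delta equals (delta theta^J)^a delta^(1-a) with 1 - a = 2 s a. The first
    factor is bounded by a constant; the second contributes (log n / n)^(sa) (log n)^(sa), with sa
    <= 1/2. Compared with [rate], a factor sqrt(log n) is left over. *)
Lemma rate_split n (A : R) J : 0 < ln (n%:R : R) -> 1 <= ln (n%:R : R) -> 0 < n%:R :> R ->
  0 <= A -> noise_level C n * theta s ^+ J <= A ->
  q ^+ J * noise_level C n <= A `^ a * K6 `^ (2 * s * a) *
    ((ln n%:R / n%:R) `^ (s * a) * ln n%:R `^ 2^-1).
Proof.
move=> L0 L1 n0 A0 HA; have K1 := K6_ge1; have K0 : 0 <= K6 by lra.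
have sp := s0; have a0 : 0 < a by rewrite invr_gt0; lra.
have a1 : 2 * s * a = 1 - a.
  by rewrite /a; have h : 2 * s + 1 != 0 by [lra|]; field.
have sq0 : 0 < Num.sqrt (n%:R : R) by rewrite sqrtr_gt0.
have d0 : 0 < noise_level C n.
  by rewrite /noise_level -/K6 divr_gt0// mulr_gt0//; lra.
have th0 := theta_gt0 s.
have -> : q ^+ J * noise_level C n =
    (noise_level C n * theta s ^+ J) `^ a * noise_level C n `^ (2 * s * a).
  rewrite powRM ?exprn_ge0 ?(ltW d0) ?(ltW th0)//.
  have -> : (theta s ^+ J) `^ a = q ^+ J.
    by rewrite -powR_mulrn ?(ltW th0)// -powRrM mulrC powRrM theta_a powR_mulrn ?powR_ge0.
  rewrite mulrAC -powRD; last by rewrite (gt_eqF d0) implybT.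
  by rewrite a1 addrC subrK powRr1 ?(ltW d0)// mulrC.
rewrite -(mulrA (A `^ a)); apply: ler_pM; rewrite ?powR_ge0//.
  by apply: ge0_ler_powR; rewrite ?nnegrE ?(ltW a0)// mulr_ge0 ?exprn_ge0 ?(ltW d0) ?(ltW th0).
rewrite {1}/noise_level -/K6 -[K6 * _ / _]mulrA powRM ?divr_ge0 ?(ltW L0) ?(ltW sq0)//.
rewrite ler_wpM2l ?powR_ge0// -mulrA powRrM powR_mulrn ?divr_ge0 ?(ltW L0) ?(ltW sq0)//.
have -> : (ln n%:R / Num.sqrt n%:R) ^+ 2 = ln n%:R / n%:R * ln n%:R :> R.
  by rewrite expr_div_n sqr_sqrtr ?(ltW n0)// expr2 mulrAC.
rewrite powRM ?divr_ge0 ?(ltW L0) ?(ltW n0)// ler_wpM2l ?powR_ge0//.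
rewrite ler_powR//.
have : 2 * s * a <= 1 by rewrite a1; lra.
rewrite -mulrA; lra.
Qed.

Lemma rateE n : 0 < ln (n%:R : R) -> 0 < n%:R :> R ->
  rate n s = (ln n%:R / n%:R) `^ (s * a) * ln n%:R.
Proof.
move=> L0 n0; rewrite /rate mulNr powRN -/a; congr (_ * _).
by rewrite -powR_inv1 ?powR_ge0// powRAC powR_inv1 ?divr_ge0 ?(ltW L0) ?(ltW n0)// invf_div.
Qed.

(** The level J is the least one that the level test is certain to accept. It is a proof device that
    depends on s and M; the procedure, which takes the first accepted level, stops no later. *)
Lemma sizes_near : \forall n \near \oo,
  [/\ M <= n%:R, upper_ratio W smax eps rho * M <= n%:R, noise_level C n <= M,
    4 * n_low W rho * noise_level C n <= c_low W smax eps rho * M &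
    theta s ^+ (rho * block_start smax rho n) * (2 * noise_level C n) <= M] /\
  exists J,
  [/\ (j0 <= J <= 32 * block_slope smax rho * block_start smax rho n)%N,
    upper_ratio W smax eps rho * M * lower_ratio W smax eps rho ^+ (32 * block_slope smax rho)
      <= noise_level C n * theta s ^+ J &
    radius_const C smin * (q ^+ J * noise_level C n) <= M `^ (2 * s + 1)^-1 * rate n s].
Proof.
have cl := c_low_gt0 W smax rho eps01; have nl := n_low_ge1 W rho.
have K1 := K6_ge1; have sp := s0; case/andP: s_range => s1 s2; case/andP: eps01 => e0 e1.
have ur0 : 0 < upper_ratio W smax eps rho by rewrite /upper_ratio divr_gt0// mulr_gt0//; lra.
have lr0 : 0 < lower_ratio W smax eps rho.
  by rewrite /lower_ratio divr_gt0// mulr_gt0//; lra.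
set K5 := upper_ratio W smax eps rho * M * lower_ratio W smax eps rho ^+ _.
have K50 : 0 < K5 by apply: mulr_gt0; [exact: mulr_gt0|exact: exprn_gt0].
have th0 := theta_gt0 s; have th1 : 1 <= theta s := theta_ge1 sp.
have a0 : 0 < a by rewrite invr_gt0; lra.
pose A := theta s * K5.
pose K7 := radius_const C smin * (A `^ a * K6 `^ (2 * s * a)).
have rc := radius_const_ge0 C0 smin0.
have Ma : 0 < M `^ a by rewrite powR_gt0.
have n4 : 0 < 4 * n_low W rho :> R by apply: mulr_gt0 => //; lra.
near=> n.
have n0 : (0 < n)%N by near: n; exact: nbhs_infty_gt.
have N0 : 0 < n%:R :> R by rewrite ltr0n.
have L1 : 1 <= ln (n%:R : R) by near: n; exact: near_ln_ge.
(* The spare factor sqrt(log n) of the rate swallows every constant, which is why L = 1 is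
   possible. *)
have L7 : (K7 / M `^ a) ^+ 2 <= ln (n%:R : R) by near: n; exact: near_ln_ge.
have L0 : 0 < ln (n%:R : R) by lra.
have t1 : 1 <= n%:R `^ 8^-1 :> R by near: n; exact: near_root8_ge.
have t2 : 32 * K6 / M <= n%:R `^ 8^-1 by near: n; exact: near_root8_ge.
have K5n : K5 <= n%:R by near: n; exact: nbhs_infty_ger.
have large : large_sample W C smin smax eps rho n by near: n; exact: large_sample_near.
have dsmall : noise_level C n <= K5 / 2 / theta s ^+ j0.
  by near: n; apply: near_noise_level_le; rewrite !divr_gt0// exprn_gt0.
split.
  split.
  - by near: n; exact: nbhs_infty_ger.
  - by near: n; exact: nbhs_infty_ger.
  - by near: n; exact: near_noise_level_le.
  - by rewrite mulrC -ler_pdivlMr//; near: n; apply: near_noise_level_le; rewrite divr_gt0// mulr_gt0.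
  - have H := noise_level_root8 n0; have X := @theta_block s n s2 n0.
    set t := n%:R `^ 8^-1 in t1 t2 H X.
    have t0 : 0 < t by lra.
    apply: (@le_trans _ _ (2 * t ^+ 2 * (2 * noise_level C n))).
      by rewrite ler_wpM2r// mulr_ge0// noise_level_ge0.
    rewrite -(@ler_pM2r _ t)//.
    have -> : 2 * t ^+ 2 * (2 * noise_level C n) * t = 4 * (noise_level C n * t ^+ 3) by ring.
    move: t2; rewrite ler_pdivrMr// [t * M]mulrC; lra.
have d0 := noise_level_gt0 C0 large.
have q1 : 1 <= q by have := powR2_half_ge R; lra.
have K5top : K5 <= noise_level C n * theta s ^+ top_level n.
  have qth : q <= theta s by rewrite /theta ler_powR ?ler1n//; lra.
  apply: le_trans K5n _; apply: le_trans (ls_level large) _.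
  rewrite ler_wpM2l ?(ltW d0)//; apply: (@le_trans _ _ (theta s ^+ (top_level n).-1)).
    by rewrite lerXn2r ?nnegrE ?powR_ge0 ?(ltW th0).
  by rewrite ler_weXn2l// leq_pred.
have ex : exists J, K5 <= noise_level C n * theta s ^+ J by exists (top_level n).
case: (ex_minnP ex) => J HJ minJ.
have Jtop : (J <= top_level n)%N by exact: minJ.
have jJ : (j0 < J)%N.
  rewrite ltnNge; apply/negP => Jj; have := HJ; apply/negP; rewrite -ltNge.
  apply: (@le_lt_trans _ _ (noise_level C n * theta s ^+ j0)).
    by rewrite ler_wpM2l ?(ltW d0)// ler_weXn2l.
  move: dsmall; rewrite ler_pdivlMr ?exprn_gt0//; lra.
exists J; split => //.
  rewrite (ltnW jJ) (leq_trans Jtop)// top_level_block//.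
  by apply: leq_trans (ls_start large).
(* By minimality J - 1 fails, so delta theta^J exceeds the threshold K5 by at most one factor theta.
   The predecessor makes sense because J > j0, which [dsmall] ensured. *)
have JA : noise_level C n * theta s ^+ J <= A.
  have J1 : (J.-1 < J)%N by rewrite prednK// (leq_trans _ jJ).
  have : ~~ (K5 <= noise_level C n * theta s ^+ J.-1).
    by apply/negP => /minJ; rewrite leqNgt J1.
  rewrite -ltNge => /ltW h.
  by rewrite -(prednK (leq_ltn_trans (leq0n _) jJ)) exprS mulrCA /A ler_wpM2l// ltW.
have A0 : 0 <= A by rewrite mulr_ge0// ltW.
have H := rate_split L0 L1 N0 A0 JA.
rewrite (rateE L0 N0) -/a.
apply: le_trans (ler_wpM2l rc H) _.
set Y := (ln n%:R / n%:R) `^ (s * a); set Z := ln n%:R `^ 2^-1.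
have ZZ : Z * Z = ln n%:R.
  by rewrite -expr2 -powR_mulrn ?powR_ge0// -powRrM mulVf// powRr1// ltW.
have Z0 : 0 <= Z by exact: powR_ge0.
have Y0 : 0 <= Y by exact: powR_ge0.
have -> : radius_const C smin * (A `^ a * K6 `^ (2 * s * a) * (Y * Z)) = K7 * Z * Y.
  by rewrite /K7; ring.
rewrite [Y * _]mulrC mulrA ler_wpM2r// -ZZ mulrA ler_wpM2r//.
have K70 : 0 <= K7 by apply: mulr_ge0 => //; apply: mulr_ge0; exact: powR_ge0.
rewrite mulrC -ler_pdivrMr// -(@ler_pXn2r _ 2)// ?nnegrE ?divr_ge0 ?(ltW Ma)//.
by rewrite [Z ^+ 2]expr2 ZZ.
Unshelve. all: by end_near. Qed.

End fixed_class.
End sizes.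

(** * Coverage and radius of the band *)

(** An open interval inside [0, 1] is found even when x0 is an end point. It serves twice: its
    positive measure shows that a continuous version is unique, and its rational points reduce the
    supremum to a countable one. *)
Lemma continuous01_gt_itv (R : realType) (h : R -> R) (r x0 : R) :
  {within `[0, 1], continuous h} -> x0 \in `[0, 1] -> r < `|h x0| ->
  exists a b : R, a < b /\ forall x, a < x < b -> x \in `[0, 1] /\ r < `|h x|.
Proof.
move=> /subspace_continuousP /(_ x0) H x01 rh; have {}H := H x01.
have e0 : 0 < `|h x0| - r by rewrite subr_gt0.
move/cvgrPdist_lt : H => /(_ _ e0) /nbhs_ballP [dl /= dl0 Hd].
have /andP[z0 z1] : 0 <= x0 <= 1 by move: x01; rewrite in_itv.
exists (Num.max 0 (x0 - dl)), (Num.min 1 (x0 + dl)); split.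
  by rewrite gt_max !lt_min ltr01/=; apply/and3P; split; [lra|lra|lra].
move=> x; rewrite gt_max lt_min => /andP[/andP[x0' h1] /andP[x1' h2]].
have x01' : x \in `[0, 1] by rewrite in_itv/= !ltW.
split => //; have := Hd x _ x01'; rewrite /ball/= ltr_norml => /(_ _).
have : - dl < x0 - x < dl by apply/andP; split; lra.
move=> -> /(_ isT).
have := lerB_dist (h x0) (h x); lra.
Qed.

Lemma continuous01_ae_eq (R : realType) (g h : R -> R) :
  {within `[0, 1], continuous g} -> {within `[0, 1], continuous h} ->
  {ae @lebesgue_measure R, forall x, x \in `[0, 1] -> g x = h x} ->
  forall x, x \in `[0, 1] -> g x = h x.
Proof.
move=> cg ch [A [mA A0 HA]] x x01; apply/eqP; rewrite -subr_eq0 -normr_eq0 eq_le normr_ge0 andbT.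
rewrite leNgt; apply/negP => gh.
have ck : {within `[0, 1], continuous (g \- h)} by move=> z; apply: cvgB; [exact: cg|exact: ch].
have [a [b [ab Hab]]] := continuous01_gt_itv ck x01 gh.
have sub : `]a, b[%classic `<=` A.
  move=> z /=; rewrite in_itv/= => /Hab [z01 gz]; apply: HA => /= /(_ z01) E.
  by move: gz; rewrite /= E subrr normr0 ltxx.
have : (lebesgue_measure `]a, b[%classic <= lebesgue_measure A)%E.
  by apply: le_measure => //; rewrite inE.
by rewrite A0 lebesgue_measure_itv/= lte_fin ab -EFinD lee_fin leNgt subr_gt0 ab.
Qed.

Section coverage.
Context (R : realType).
Variables (f g : R -> R).
Hypothesis cg : {within `[0, 1], continuous g}.
Hypothesis gf : {ae @lebesgue_measure R, forall x, x \in `[0, 1] -> g x = f x}.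

Lemma in_bandP (c : R -> R) (r : R) :
  in_band f (band c r) <-> forall x, x \in `[0, 1] -> `|g x - c x| <= r.
Proof.
split.
  move=> [g' [cg' g'f [_ H]]] x x01.
  have gg' : g x = g' x.
    apply: (continuous01_ae_eq cg cg' _ x01).
    apply: ae_lebesgueS (ae_lebesgueI gf g'f) => z [h1 h2] z01.
    by rewrite h1// h2.
  rewrite gg' -lee_fin; apply: le_trans H; apply: ereal_sup_ubound.
  by exists x.
move=> H; exists g; split => //; split => //.
by apply: ge_ereal_sup => _ [x x01 <-]; rewrite lee_fin; exact: H.
Qed.

(** By continuity countably many points decide membership, which makes the event of non-coverage
    measurable. *)
Lemma in_band_ratP (c : R -> R) (r : R) : {within `[0, 1], continuous c} ->
  in_band f (band c r) <->
  forall p : rat, (ratr p : R) \in `[0, 1] -> `|g (ratr p) - c (ratr p)| <= r.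
Proof.
move=> cc; rewrite in_bandP; split; first by move=> H p; exact: H.
move=> H x x01; rewrite leNgt; apply/negP => gt.
have ck : {within `[0, 1], continuous (g \- c)} by move=> z; apply: cvgB; [exact: cg|exact: cc].
have [a [b [ab Hab]]] := continuous01_gt_itv ck x01 gt.
have [p] := rat_in_itvoo ab; rewrite in_itv/= => /Hab [p01].
by rewrite ltNge => /negP; apply; exact: H.
Qed.

End coverage.

Section observations.
Context (R : realType) (d : measure_display) (T : measurableType d)
  (P : probability T R) (B : R -> {RV P >-> R}).
Hypothesis hB : standard_brownian_motion B.

Lemma measurable_observation n f : measurable_fun setT (observation B n f).
Proof.
have := @measurability _ _ T (path_space R) setT (observation B n f) (@path_cylinders R) erefl; apply.
move=> _ [_ [t [t01 [A [mA ->]]]] <-].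
apply: (measurable_funD (measurable_cst _) (measurable_funM (measurable_cst _) _) measurableT) => //.
Qed.

Lemma measurable_not_in_band n (f g : R -> R) (fhat : path_space R -> R -> R) (rad : path_space R -> R) :
  {within `[0, 1], continuous g} ->
  {ae @lebesgue_measure R, forall x, x \in `[0, 1] -> g x = f x} ->
  (forall y, {within `[0, 1], continuous (fhat y)}) ->
  (forall t, t \in `[0, 1] -> measurable_fun setT (fun y => fhat y t)) ->
  measurable_fun setT rad ->
  measurable [set w | ~ in_band f (band (fhat (observation B n f w)) (rad (observation B n f w)))].
Proof.
move=> cg gf cf mf mr.
pose A (p : rat) := [set y : path_space R | (ratr p : R) \in `[0, 1] ->
  `|g (ratr p) - fhat y (ratr p)| <= rad y].
have mA p : measurable (A p).
  rewrite /A; case: (boolP ((ratr p : R) \in `[0, 1])) => p01; last first.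
    by rewrite (_ : [set _ | _] = setT)//; apply/seteqP; split.
  rewrite (_ : [set _ | _] = [set y | `|g (ratr p) - fhat y (ratr p)| <= rad y]); last first.
    by apply/seteqP; split => y //= H; exact: H.
  rewrite -[X in measurable X]setTI; apply: measurable_fun_ler => //.
  apply: measurableT_comp => //; apply: measurable_funB => //; exact: mf.
rewrite (_ : [set w | _] = \bigcup_p (observation B n f @^-1` (~` A p))).
  apply: bigcupT_measurable_rat => p; rewrite -[X in measurable X]setTI.
  by apply: measurable_observation => //; exact: measurableC.
apply/seteqP; split => w /=.
  move=> H; have /existsNP [p Hp] : ~ forall p, A p (observation B n f w).
    by move=> K; apply: H; apply/(in_band_ratP cg gf _ (cf _)).
  by exists p.
by move=> [p _ Hp] K; apply: Hp; move/(in_band_ratP cg gf _ (cf _)) : K; exact.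
Qed.

Lemma bad_noise_near (e : R) : 0 < e -> \forall n \near \oo,
  (P (~` good_noise B (grid_level n) (11 * ln n%:R)) <= e%:E)%E.
Proof.
(* The union bound is (2n)^10, with two further factors 2, times exp(1/2) n^-11; hence [K] / n. *)
move=> e0; pose K : R := 2 ^+ 12 * expR 2^-1; near=> n.
have n0 : (0 < n)%N by near: n; exact: nbhs_infty_gt.
have N0 : 0 < n%:R :> R by rewrite ltr0n.
have Kn : K / e <= n%:R by near: n; exact: nbhs_infty_ger.
apply: le_trans (bad_noise_le hB _ _) _; first by rewrite mulr_ge0// ln_ge0// ler1n.
rewrite lee_fin; apply: (@le_trans _ _ (K / n%:R)); last first.
  by rewrite ler_pdivrMr// mulrC -ler_pdivrMr.
have h : 2 ^+ log_size n <= 2 * n%:R :> R by rewrite -natrM -natrX ler_nat log_size_le.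
have E : expR (- (11 * ln n%:R)) = n%:R ^- 11 :> R.
  by rewrite expRN mulrC -[11%:R]/(11%N%:R) expRM_natr lnK.
rewrite exprS /grid_level mulnC exprM expRD E.
apply: (@le_trans _ _ (2 * (2 * n%:R) ^+ 10 * (2 * (expR 2^-1 / n%:R ^+ 11)))).
  rewrite ler_wpM2r ?mulr_ge0 ?expR_ge0 ?invr_ge0 ?exprn_ge0 ?(ltW N0)//.
  by rewrite ler_wpM2l// lerXn2r ?nnegrE ?exprn_ge0 ?mulr_ge0 ?(ltW N0).
rewrite le_eqVlt; apply/orP; left; apply/eqP; rewrite /K; field.
by rewrite gt_eqF.
Unshelve. all: by end_near. Qed.

(** The observed increment has noise n^(-1/2) (B_1 - B_0), so multiplication by n leaves standard
    deviation sqrt n, which tends to infinity. The unknown function enters through the mean [m]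
    alone. *)
Lemma displaced_law gamma n f : (0 < n)%N -> exists m : R,
  P [set w | displaced gamma n (observation B n f w)] =
  normal_prob 0 1 [set z | periodic_set gamma (m + Num.sqrt n%:R * z)].
Proof.
move=> n0; have N0 : 0 < n%:R :> R by rewrite ltr0n.
exists (n%:R * (\int[@lebesgue_measure R]_(u in `[0, 1]) f u -
  \int[@lebesgue_measure R]_(u in `[0, 0]) f u)).
set m := n%:R * _.
have mA : measurable [set z : R | periodic_set gamma (m + Num.sqrt n%:R * z)].
  rewrite -[X in measurable X]setTI.
  have : measurable_fun setT (fun z : R => m + Num.sqrt n%:R * z).
    by apply: measurable_funD => //; apply: measurable_funM.
  by apply => //; exact: measurable_periodic_set.
have := @increment_law _ _ _ _ _ hB 0 1 _ (lexx 0) ltr01 (lexx 1) mA.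
rewrite subr0 sqrtr1 => <-; congr (P _); apply/seteqP; split => w /=;
  rewrite /displaced /observation asboolE.
all: have -> : n%:R * (\int[@lebesgue_measure R]_(u in `[0, 1]) f u + (Num.sqrt n%:R)^-1 * B 1 w -
   (\int[@lebesgue_measure R]_(u in `[0, 0]) f u + (Num.sqrt n%:R)^-1 * B 0 w)) =
   m + Num.sqrt n%:R * (B 1 w - B 0 w) => //.
all: have sz : Num.sqrt n%:R != 0 :> R by rewrite gt_eqF// sqrtr_gt0.
all: rewrite /m; move: (sqr_sqrtr (ltW N0)) sz; move: (Num.sqrt n%:R) => z <- z0.
all: by field.
Qed.

Lemma displaced_near gamma (e : R) : 0 <= gamma <= 1 -> 0 < e -> \forall n \near \oo,
  forall f, `|fine (P [set w | displaced gamma n (observation B n f w)]) - gamma| <= e.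
Proof.
move=> g01 e0; have [s1 H] := normal_periodic g01 e0; near=> n => f.
have n0 : (0 < n)%N by near: n; exact: nbhs_infty_gt.
have [m ->] := @displaced_law gamma n f n0; apply: H.
have h : s1 ^+ 2 <= n%:R by near: n; exact: nbhs_infty_ger.
case: (leP s1 0) => s10; first by apply: le_trans s10 _; exact: sqrtr_ge0.
by rewrite -(ger0_norm (ltW s10)) -sqrtr_sqr ler_wsqrtr.
Unshelve. all: by end_near. Qed.

Lemma measurable_displaced_observation gamma n f :
  measurable [set w | displaced gamma n (observation B n f w)].
Proof.
rewrite -[X in measurable X]setTI.
have := measurableT_comp (@measurable_displaced R gamma n) (measurable_observation n f).
by move=> /(_ measurableT [set true]); apply.
Qed.

End observations.

Lemma probability_near_eq d (T : measurableType d) (R : realType) (P : probability T R)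
    (A D G : set T) (b : R) :
  measurable A -> measurable D -> measurable G -> (P (~` G) <= b%:E)%E ->
  (forall w, G w -> A w <-> D w) -> `|fine (P A) - fine (P D)| <= b.
Proof.
move=> mA mD mG Gb AD.
have H X Y : measurable X -> measurable Y -> (forall w, G w -> X w -> Y w) ->
    fine (P X) - fine (P Y) <= b.
  move=> mX mY XY; have sub : X `<=` Y `|` ~` G.
    by move=> w Xw; have [Gw|nG] := pselect (G w); [left; exact: XY|right].
  have : (P X <= P Y + b%:E)%E.
    apply: (@le_trans _ _ (P (Y `|` ~` G))).
      by apply: le_measure => //; rewrite inE//; apply: measurableU => //; exact: measurableC.
    by apply: le_trans (measureU2 _ _ _) _ => //; [exact: measurableC|exact: leeD].
  rewrite -(fineK (fin_num_measure P X mX)) -[in X in (_ <= X)%E](fineK (fin_num_measure P Y mY)).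
  by rewrite -EFinD lee_fin; lra.
rewrite ler_norml lerNl opprB; apply/andP; split; apply: H => // w Gw; by apply AD.
Qed.

(** * Uniform coverage and the rate of the radius *)

Section main.
Context (R : realType) (W : wavelet_system R).
Hypothesis hW : cdv_wavelet_basis W.
Local Notation j0 := (coarsest W).
Local Notation q := (2 `^ 2^-1 : R).
Local Notation I01 := (`[0, 1]%classic : set R).
Variables (C : R) (u : option nat * nat -> R -> R).
Hypothesis C0 : 0 <= C.
Hypothesis locu : forall i, basis_index W i -> localized C (index_level W i) i.2 (u i).
Hypothesis basis_u : orthonormal_basis I01 (basis_index W) u.
Hypothesis alphaE : forall f k, in_L2 I01 f -> (k < 2 ^ j0)%N ->
  alpha W f k = ip I01 f (u (None, k)).
Hypothesis betaE : forall f j k, in_L2 I01 f -> (j0 <= j)%N -> (k < 2 ^ j)%N ->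
  beta W f j k = ip I01 f (u (Some j, k)).
Variables (smin smax eps gamma : R) (rho : nat).
Hypothesis smin0 : 0 < smin.
Hypothesis smin_max : smin <= smax.
Hypothesis eps01 : 0 < eps < 1.
Hypothesis gamma01 : 0 <= gamma <= 1.

Lemma self_similar_continuous s M f : smin <= s <= smax -> 0 < M ->
  self_similar W smax eps rho s M f ->
  [/\ in_L2 I01 f, class_coef W smax eps rho s M (fun i => ip I01 f (u i)) &
   exists g : R -> R, [/\ {within `[0, 1], continuous g},
     {ae @lebesgue_measure R, forall x, x \in `[0, 1] -> g x = f x},
     forall J x, x \in `[0, 1] ->
       `|g x - \sum_(i <- indices_upto W J) ip I01 f (u i) * u i x|
         <= M * overlap_const C / (1 - 2 `^ (- s)) * (2 `^ (- s)) ^+ J &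
     forall x, x \in `[0, 1] -> `|g x| <= sup_const W C smin * M]].
Proof.
move=> s_range M0 ssf; have [[Lf _] _] := ssf; case/andP: (s_range) => s1 s2.
have cc : class_coef W smax eps rho s M (fun i => ip I01 f (u i)).
  apply: (self_similar_class_coef smin0 eps01 hW s_range M0 ssf) => *; [exact: alphaE|exact: betaE].
split => //.
have /andP[r0 r1] := rate_le s1; have /andP[_ rm1] := rate_min01 smin0.
have r01 : 0 <= 2 `^ (- s) < 1 by rewrite (ltW r0) (le_lt_trans r1).
have [c1 c2 _ _] := cc.
have [|g [cg gf tail bound]] := wavelet_expansion C0 locu basis_u (ltW M0) r01 Lf c1.
  move=> l k jl kl; rewrite -(thetaE s) exprMn mulrA ler_wpM2r ?exprn_ge0 ?(ltW r0)//.
  by rewrite mulrC c2.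
exists g; split => // x x01; apply: le_trans (bound x x01) _.
rewrite (_ : sup_const W C smin * M = M * overlap_const C * (q ^+ j0 + (1 - rate_min smin)^-1)).
  2: by rewrite /sup_const; ring.
apply: ler_wpM2l; first by apply: mulr_ge0; [exact: ltW|exact: overlap_const_ge0].
rewrite lerD2l lef_pV2 ?posrE; lra.
Qed.

Local Notation fhat := (band_center W C u smin smax eps gamma rho).
Local Notation rad := (band_radius W C u smin smax eps rho).

Context (d : measure_display) (T : measurableType d)
  (P : probability T R) (B : R -> {RV P >-> R}).
Hypothesis hB : standard_brownian_motion B.

(** On the good noise event f is missed exactly when the band is displaced. Hence the probability of
    a miss differs from gamma by at most the probability of bad noise plus the error in the
    displacement probability, both bounded uniformly in f. *)
Lemma coverage : sup_tends_to_0 (self_similar_union W smin smax eps rho)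
  (fun n f => data_law B n f [set y | ~ in_band f (band (fhat n y) (rad n y))] - gamma%:E)%E.
Proof.
move=> dl dl0; near=> n; apply: ge_ereal_sup => _ [f [s [M [s_range M0 ssf]]] <-].
have [Lf cc [g [cg gf tail bound]]] := self_similar_continuous s_range M0 ssf.
have hn : large_sample W C smin smax eps rho n by near: n; exact: large_sample_near.
have bad : (P (~` good_noise B (grid_level n) (11 * ln n%:R)) <= (dl / 2)%:E)%E by near: n; apply: bad_noise_near => //; rewrite divr_gt0.
set G := good_noise B (grid_level n) (11 * ln n%:R) in bad.
have disp : `|fine (P [set w | displaced gamma n (observation B n f w)]) - gamma| <= dl / 2.
  by move: f {s_range M0 ssf Lf cc g cg gf tail bound}; near: n; apply: displaced_near => //; rewrite divr_gt0.
set A := [set w | ~ in_band f (band (fhat n (observation B n f w)) (rad n (observation B n f w)))].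
have cc0 y : {within `[0, 1], continuous (fhat n y)}.
  by apply: lipschitz01_continuous; exact: lipschitz01_center.
have mA : measurable A.
  apply: (@measurable_not_in_band _ _ _ _ B n f g (fhat n) (rad n)) => //.
  - by move=> t _; exact: measurable_center.
  - exact: measurable_radius.
rewrite -[data_law _ _ _ _]/(P A) -(fineK (fin_num_measure P A mA)) -EFinB lee_fin.
have mD := measurable_displaced_observation B gamma n f.
have mG : measurable G := measurable_good_noise B _ _.
suff H : `|fine (P A) - fine (P [set w | displaced gamma n (observation B n f w)])| <= dl / 2.
  rewrite -(subrK (fine (P [set w | displaced gamma n (observation B n f w)])) (fine (P A))) -addrA.
  by apply: le_trans (ler_normD _ _) _; lra.
apply: probability_near_eq mA mD mG bad _ => w Gw.
have err x : x \in `[0, 1] -> `|g x - plain_center W C u smin smax eps rho n (observation B n f w) x|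
    <= rad n (observation B n f w).
  by move=> x01; apply: (center_error C0 locu smin0 smin_max eps01 hn s_range M0 Lf cc cg gf tail bound Gw).
rewrite /A /= (in_bandP cg gf).
have r0 : 0 <= rad n (observation B n f w) by exact: radius_ge0.
rewrite /band_center; case: (displaced gamma n (observation B n f w)); split => //.
  (* One point suffices: the plain centre is within R of g at 0, so the displaced centre is at least
     2 R + 1 away; the summand 1 matters when R = 0. *)
  move=> _ /(_ 0); rewrite in_itv/= lexx ler01 => /(_ isT).
  have := err 0; rewrite in_itv/= lexx ler01 => /(_ isT).
  rewrite !ler_norml => /andP[h1 h2] /andP[h3 h4]; lra.
by move=> []; move=> x x01; rewrite addr0; exact: err.
Unshelve. all: by end_near. Qed.

Lemma radius_rate s M : smin <= s <= smax -> 0 < M ->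
  sup_tends_to_0 (self_similar W smax eps rho s M)
   (fun n f => data_law B n f [set y | 1 * M `^ (2 * s + 1)^-1 * rate n s < rad n y]).
Proof.
move=> s_range M0 dl dl0.
have := sizes_near W rho C0 smin0 smin_max eps01 s_range M0.
apply: filter_app; near=> n => -[[h1 h2 h3 h4 h5] [J [h6 h7 h8]]]; apply: ge_ereal_sup => _ [f ssf <-].
have [Lf cc [g [cg gf tail bound]]] := self_similar_continuous s_range M0 ssf.
have hn : large_sample W C smin smax eps rho n by near: n; exact: large_sample_near.
have bad : (P (~` good_noise B (grid_level n) (11 * ln n%:R)) <= dl%:E)%E by near: n; exact: bad_noise_near.
set G := good_noise B (grid_level n) (11 * ln n%:R) in bad.
rewrite /data_law /pushforward gee0_abs ?measure_ge0//; apply: (le_trans _ bad).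
have mG : measurable G := measurable_good_noise B _ _.
apply: le_measure.
- rewrite inE -[X in measurable X]setTI.
  apply: measurable_observation => //; rewrite -[X in measurable X]setTI.
  by apply: measurable_fun_ltr => //; exact: measurable_radius.
- by rewrite inE; exact: measurableC.
- move=> w /= lt Gw; move: lt; apply/negP; rewrite -leNgt mul1r; apply: le_trans h8.
  by apply: (radius_size C0 locu smin0 smin_max eps01 hn s_range M0 Lf cc cg gf bound Gw h1 h2 h3 h4 h5 h6 h7).
Unshelve. all: by end_near. Qed.

End main.

Theorem theorem3p2 (R : realType) (W : wavelet_system R)
  (hW : cdv_wavelet_basis W)
  (smax : R) (hsmax : 0 < smax < (moments W)%:R)
  (eps : R) (heps : 0 < eps < 1) (rho : nat)
  (gamma : R) (hgamma : 0 < gamma < 1)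
  (smin : R) (hsmin : 0 < smin <= smax) :
  exists (fhat : nat -> path_space R -> R -> R)
         (rad : nat -> path_space R -> R) (L : R),
    [/\ is_band_procedure fhat rad, 0 < L &
      forall (d : measure_display) (T : measurableType d)
             (P : probability T R) (B : R -> {RV P >-> R}),
      standard_brownian_motion B ->
      sup_tends_to_0 (self_similar_union W smin smax eps rho)
        (fun n f =>
           data_law B n f [set y | ~ in_band f (band (fhat n y) (rad n y))]
           - gamma%:E)%E /\
      (forall s M : R, smin <= s <= smax -> 0 < M ->
       sup_tends_to_0 (self_similar W smax eps rho s M)
         (fun n f =>
            data_law B n f
              [set y | L * M `^ (2 * s + 1)^-1 * rate n s < rad n y]))].
Proof.
have [C [u [C0 locu basis_u alphaE betaE]]] := cdv_regular_basis hW.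
case/andP: hsmin => smin0 smin_max; case/andP: hgamma => g0 g1.
exists (band_center W C u smin smax eps gamma rho), (band_radius W C u smin smax eps rho), 1.
split => //; first exact: procedure_is_band_procedure.
move=> d T P B hB; split.
  by apply: (coverage hW) => //; rewrite !ltW.
by move=> s M s_range M0; exact: (radius_rate hW).
Qed.
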